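(* Let $d,N,n\ge1$ and $1\le m\le\min(d,N)$ be integers, $\alpha\ge-\frac12$ and $0<\delta<1$. Let $f:I^d\to\mathbb R$ (measurable, $I^d=[-1,1]^d$) satisfy $|f(\boldsymbol x)|\le K_f$ for all $\boldsymbol x\in I^d$, for some constant $K_f$. Let $Y_i=f(X_i)+\varepsilon_i$, $i=1,\dots,n$, where $X_1,\dots,X_n$ are i.i.d. with density $\boldsymbol g_\alpha(\boldsymbol x)=\big(h_0^{(\alpha)}\big)^{-d}\prod_{i=1}^d(1-x_i^2)^\alpha$ on $I^d$, and $\varepsilon_1,\dots,\varepsilon_n$ are i.i.d. centered real random variables with finite variance $\sigma^2$, independent of the $X_i$. Let $\widehat f_{N,n,m}^{(\alpha)}$ be the least squares estimator defined in the context and $$\widehat F_{N,n,m}^{(\alpha)}(\boldsymbol x)=\mathrm{Sign}\big(\widehat f_{N,n,m}^{(\alpha)}(\boldsymbol x)\big)\,\min\big\{K_f,\,|\widehat f_{N,n,m}^{(\alpha)}(\boldsymbol x)|\big\}$$ its truncation. Then $$\mathbb E\Big[\|f-\widehat F_{N,n,m}^{(\alpha)}\|_\alpha^2\Big]\le 4K_f^2\big(h_0^{(\alpha)}\big)^dM_{N,m,d}\exp\left(-\frac{\delta^2n}{2[D(N,\alpha)]^{2m}M_{N,m,d}}\right)$$ $$\qquad+\frac{M_{N,m,d}}{n(1-\delta)^2}\Big([D(N,\alpha)]^{2m}\|f-\Pi_{N,m}f\|_\alpha^2+\sigma^2\big(h_0^{(\alpha)}\big)^d\Big)+\|f-\Pi_{N,m}f\|_\alpha^2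 .$$
   Context: For real $\alpha\ge-\frac12$ let $w_\alpha(x)=(1-x^2)^\alpha$ on $I=[-1,1]$, and let $\widetilde P_k^{(\alpha)}$ ($k\ge0$) be the normalized Jacobi polynomial of degree $k$ with parameters $(\alpha,\alpha)$, so that $\int_{-1}^1\widetilde P_j^{(\alpha)}\widetilde P_k^{(\alpha)}w_\alpha\,dx=\delta_{j,k}$ (positive leading coefficient). Let $h_0^{(\alpha)}=\int_{-1}^1 w_\alpha=2^{2\alpha+1}\mathrm B(\alpha+1,\alpha+1)$, with $\mathrm B$ the Beta function. Let $\boldsymbol w_\alpha(\boldsymbol x)=\prod_{i=1}^d(1-x_i^2)^\alpha$ and $\|g\|_\alpha^2=\int_{I^d}|g|^2\boldsymbol w_\alpha\,d\boldsymbol x$, the norm of $L^2(I^d,\boldsymbol w_\alpha)$. Let $\mathcal D=\{1,\dots,d\}$. For $\boldsymbol u\subset\mathcal D$ with $|\boldsymbol u|\ge1$ and $\boldsymbol k\in\mathbb N_0^d$ with $k_j\ge1$ for $j\in\boldsymbol u$ and $k_j=0$ for $j\notin\boldsymbol u$, put $$\Phi^{(\alpha)}_{\boldsymbol u,\boldsymbol k}(\boldsymbol x)=\big(h_0^{(\alpha)}\big)^{-(d-|\boldsymbol u|)/2}\prod_{i\in\boldsymbol u}\widetilde P^{(\alpha)}_{k_i}(x_i),$$ and $\Phi^{(\alpha)}_{\boldsymbol 0}=\big(h_0^{(\alpha)}\big)^{-d/2}$. Let $\Psi_1^{(\alpha)},\dots,\Psi^{(\alpha)}_{M_{N,m,d}}$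 be an enumeration of $\Phi^{(\alpha)}_{\boldsymbol 0}$ and all $\Phi^{(\alpha)}_{\boldsymbol u,\boldsymbol k}$ with $1\le|\boldsymbol u|\le m$, $\|\boldsymbol k\|_1\le N$; their number is $M_{N,m,d}=\sum_{k=0}^m\binom dk\binom Nk$, and $\mathcal P_{N,m,d}$ denotes their linear span. $\Pi_{N,m}$ is the orthogonal projection of $L^2(I^d,\boldsymbol w_\alpha)$ onto $\mathcal P_{N,m,d}$. Let $D(N,\alpha)=\pi^{3/4}N^{\alpha+\frac12}e^{\alpha+\frac34}$ if $\alpha>-\frac12$, and $D(N,-\frac12)=2$. Estimator: let $F=F_{N,n,m}^{(\alpha)}$ be the $n\times M_{N,m,d}$ matrix $F(i,j)=\big(h_0^{(\alpha)}\big)^{d/2}n^{-1/2}\,\Psi_j^{(\alpha)}(X_i)$, let $G=F^TF$, and $$\widehat C=G^{-1}F^T\,\big(h_0^{(\alpha)}\big)^{d/2}n^{-1/2}\,(Y_1,\dots,Y_n)^T,\qquad \widehat f_{N,n,m}^{(\alpha)}=\sum_{j=1}^{M_{N,m,d}}\widehat C_j\Psi_j^{(\alpha)}.$$ When $G$ is singular, set $\widehat C=0$ by convention. $\mathrm{Sign}$ is the usual sign function. The expectation is over the $X_i$ and $\varepsilon_i$. *)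

(* Defs.v *)
From HB Require Import structures.
From mathcomp Require Import all_boot all_order all_algebra.
From mathcomp Require Import all_classical all_reals all_analysis.
Set Implicit Arguments.
Unset Strict Implicit.
Unset Printing Implicit Defensive.
Import Order.TTheory GRing.Theory Num.Theory.
Import numFieldNormedType.Exports.
Local Open Scope classical_set_scope.
Local Open Scope ring_scope.

(* Points of R^d are elements of [d.-tuple R], with the product
   sigma-algebra.  Lebesgue measure on R^(n+1) is the image of
   lebesgue_measure \x (Lebesgue measure on R^n) under (x, t) |-> x :: t;
   on R^0 it is the Dirac measure at the empty tuple. *)
Section LebesgueTuple.
Context {R : realType}.

Definition tcons n (p : measurableTypeR R * n.-tuple R) : n.+1.-tuple R :=
  [tuple of p.1 :: p.2].

Lemma measurable_tcons n : measurable_fun setT (@tcons n).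
Proof. by apply: measurable_cons; [exact: measurable_fst|exact: measurable_snd]. Qed.

Section Step.
Variables (n : nat) (mu : {sigma_finite_measure set (n.-tuple R) -> \bar R}).

Definition leb_step : set (n.+1.-tuple R) -> \bar R :=
  pushforward (product_measure1 (@lebesgue_measure R) mu) (@tcons n).

Let leb_step0 : leb_step set0 = 0%E.
Proof. by rewrite /leb_step /pushforward preimage_set0 (measure0 (product_measure1 _ mu)). Qed.

Let leb_step_ge0 A : (0 <= leb_step A)%E.
Proof. exact: (measure_ge0 (product_measure1 _ mu)). Qed.

Let leb_step_sigma_additive : semi_sigma_additive leb_step.
Proof.
move=> F mF tF mUF; rewrite /leb_step /pushforward preimage_bigcup.
apply: measure_semi_sigma_additive.
- by move=> k; rewrite -[X in measurable X]setTI; exact: measurable_tcons.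
- apply/trivIsetP => /= i j _ _ ij; rewrite -preimage_setI.
  by move/trivIsetP : tF => /(_ _ _ _ _ ij) ->//; rewrite preimage_set0.
- by rewrite -preimage_bigcup -[X in measurable X]setTI; exact: measurable_tcons.
Qed.

HB.instance Definition _ := isMeasure.Build _ _ _ leb_step
  leb_step0 leb_step_ge0 leb_step_sigma_additive.

Let leb_step_sigma_finite : sigma_finite setT leb_step.
Proof.
have /sigma_finiteP[F [TF ndF Foo]] := sigma_finiteT (@lebesgue_measure R).
have /sigma_finiteP[G [TG ndG Goo]] := sigma_finiteT mu.
pose g (t : n.+1.-tuple R) : measurableTypeR R * n.-tuple R :=
  (tnth t ord0, [tuple of behead t]).
have mg : measurable_fun setT g.
  by apply/measurable_fun_pairP; split;
    [exact: measurable_tnth|exact: measurable_behead].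
have gK : cancel (@tcons n) g.
  by move=> [x t]; congr pair; apply/val_inj.
exists (fun k => g @^-1` (F k `*` G k)).
  rewrite -preimage_bigcup (_ : \bigcup_i _ = setT) ?preimage_setT//.
  rewrite -setXTT TF TG predeqE => -[x y]; split.
    by move=> [k _ []/= ? ?]; split; exists k.
  move=> [/= [k _ Fkx] [l _ Gly]]; exists (maxn k l) => //; split.
  - by move: x Fkx; exact/subsetPset/ndF/leq_maxl.
  - by move: y Gly; exact/subsetPset/ndG/leq_maxr.
move=> k; have [mFk Fk] := Foo k; have [mGk Gk] := Goo k; split.
  by rewrite -[X in measurable X]setTI; apply: mg => //; exact: measurableX.
rewrite /leb_step /pushforward -comp_preimage.
rewrite (_ : g \o _ = id) ?preimage_id; last first.
  by apply/funext => p /=; rewrite gK.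
by rewrite product_measure1E// lte_mul_pinfty// ge0_fin_numE.
Qed.

HB.instance Definition _ := Measure_isSigmaFinite.Build _ _ _ leb_step
  leb_step_sigma_finite.

End Step.

Fixpoint leb n : {sigma_finite_measure set (n.-tuple R) -> \bar R} :=
  if n is k.+1 then leb_step (leb k) else \d_[tuple].

End LebesgueTuple.

Section Jacobi.
Context {R : realType}.
Implicit Types (a b alpha x : R) (k : nat).

(* Values of the weight at the endpoints -1, 1 are irrelevant: for
   alpha < 0, powR makes them 0. *)
Definition weight1 alpha x : R := (1 - x ^+ 2) `^ alpha.

Definition h0 alpha : R :=
  \int[lebesgue_measure]_(x in `[-1, 1]) weight1 alpha x.

(* Generalized binomial coefficient a (a - 1) ... (a - k + 1) / k! *)
Definition gbinom a k : R := (\prod_(i < k) (a - i%:R)) / k`!%:R.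

(* The Jacobi polynomial P_k^(a,b), in the classical form
   sum_s C(k+a, k-s) C(k+b, s) ((x-1)/2)^s ((x+1)/2)^(k-s),
   which makes sense for every a, b > -1. *)
Definition jacobi a b k : {poly R} :=
  \sum_(s < k.+1) (gbinom (k%:R + a) (k - s) * gbinom (k%:R + b) s) *:
    ((2^-1 *: ('X - 1)) ^+ s * (2^-1 *: ('X + 1)) ^+ (k - s)).

(* jacobi alpha alpha k has positive leading coefficient for
   alpha >= -1/2, and dividing by its norm preserves this. *)
Definition njacobi alpha k : {poly R} :=
  (Num.sqrt (\int[lebesgue_measure]_(x in `[-1, 1])
     ((jacobi alpha alpha k).[x] ^+ 2 * weight1 alpha x)))^-1 *:
  jacobi alpha alpha k.

Definition Dconst (N : nat) alpha : R :=
  if - 2^-1 < alpha then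
    pi `^ (3 / 4) * N%:R `^ (alpha + 2^-1) * expR (alpha + 3 / 4)
  else 2.

End Jacobi.

Definition mindex (d N : nat) : finType :=
  ({set 'I_d} * {ffun 'I_d -> 'I_N.+1})%type.

Section Space.
Context {R : realType} (d : nat).
Implicit Types (alpha : R) (f g : d.-tuple R -> R).

Definition cube : set (d.-tuple R) := [set x | forall i, tnth x i \in `[-1, 1]].

Definition weight alpha (x : d.-tuple R) : R :=
  \prod_(i < d) weight1 alpha (tnth x i).

Definition normsq alpha g : \bar R :=
  (\int[leb d]_(x in cube) (g x ^+ 2 * weight alpha x)%:E)%E.

Definition inner alpha f g : R :=
  \int[leb d]_(x in cube) (f x * g x * weight alpha x).

(* On the indices below this is Phi_(u,k); for u empty it is the constant
   Phi_0 = h0^(-d/2). *)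
Definition Phi alpha N (uk : mindex d N) (x : d.-tuple R) : R :=
  h0 alpha `^ (- (d%:R - #|uk.1|%:R) / 2) *
  \prod_(i in uk.1) (njacobi alpha (uk.2 i)).[tnth x i].

End Space.

(* Pairs (u, k) with |u| <= m, k_j >= 1 iff j \in u, and |k|_1 <= N (so that
   bounding each k_j by N loses nothing); u empty gives the pair (0, 0). *)
Definition basis_index (N m d : nat) :
    {set mindex d N} :=
  [set uk : mindex d N | [&& (#|uk.1| <= m)%N,
                [forall j, (j \in uk.1) == (0 < uk.2 j)%N] &
                (\sum_j uk.2 j <= N)%N]]%SET.

Definition Mdim (N m d : nat) : nat :=
  (\sum_(k < m.+1) 'C(d, k) * 'C(N, k))%N.

Definition enumerates (T : finType) (A : {set T}) (e : 'I_#|A| -> T) : Prop :=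
  injective e /\ forall a, a \in A <-> exists j, e j = a.

Section Projection.
Context {R : realType} (alpha : R) (N m d : nat).

Definition Pspace : set (d.-tuple R -> R) :=
  [set g | exists c : mindex d N -> R,
     g = fun x => \sum_(uk in basis_index N m d) c uk * Phi alpha uk x].

(* The orthogonal projection onto Pspace, as the polynomial function in
   Pspace it determines. *)
Definition Proj (f : d.-tuple R -> R) : d.-tuple R -> R :=
  xget (fun=> 0) [set p | Pspace p /\
    forall q, Pspace q -> inner alpha (f \- p) q = 0].

End Projection.

Section Estimator.
Context {R : realType} (alpha : R) (d n M : nat).
Variables (Psi : 'I_M -> d.-tuple R -> R).
Variables (X : 'I_n -> d.-tuple R) (Y : 'I_n -> R).

Let scaling : R := h0 alpha `^ (d%:R / 2) / Num.sqrt n%:R.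

Definition Fmx : 'M[R]_(n, M) := \matrix_(i, j) (scaling * Psi j (X i)).

Definition Gmx : 'M[R]_M := Fmx^T *m Fmx.

Definition Chat : 'cV[R]_M :=
  if Gmx \in unitmx then
    invmx Gmx *m Fmx^T *m (scaling *: \col_i Y i)
  else 0.

Definition fhat (x : d.-tuple R) : R := \sum_j Chat j 0 * Psi j x.

End Estimator.

Definition truncation (R : realType) (T : Type) (K : R) (g : T -> R) (x : T) : R :=
  Num.sg (g x) * Num.min K `|g x|.

Section Independence.
Context {dO : measure_display} {Omega : measurableType dO} {R : realType}
  (P : probability Omega R).

Definition independent_pair d1 d2 (T1 : measurableType d1)
    (T2 : measurableType d2) (U : Omega -> T1) (V : Omega -> T2) : Prop :=
  forall (A : set T1) (B : set T2), measurable A -> measurable B ->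
    P (U @^-1` A `&` V @^-1` B) = (P (U @^-1` A) * P (V @^-1` B))%E.

Definition mutually_independent d1 (T : measurableType d1) n
    (Z : 'I_n -> Omega -> T) : Prop :=
  forall (J : {set 'I_n}) (A : 'I_n -> set T),
    (forall i, measurable (A i)) ->
    P (\bigcap_(i in [set i | i \in J]) (Z i @^-1` A i)) =
    (\prod_(i in J) P (Z i @^-1` A i))%E.

Definition joint (T : Type) n (Z : 'I_n -> Omega -> T) (w : Omega) : n.-tuple T :=
  [tuple Z i w | i < n].

End Independence.

(* Main.v *)
(* Let V(x) be the vector of the h0^(d/2) n^(-1/2) Psi_j(x), so that the Gram
   matrix is G = sum_i V(X_i) V(X_i)^T with expectation 1.

   Lower tail of G.  For small s > 0 the matrices H_k = 1 - s sum_(i < k)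
   V(X_i) V(X_i)^T are positive semidefinite, and tr(H^p) decreases under a rank
   one update by at least s p V^T H^(p-1) V - (s p)^2 |V|^2 (V^T H^(p-2) V) / 2.
   Taking expectations, X_k being independent of H_k, bounds E tr(H_n^p)
   by M exp(-theta + theta^2 ell / 2) up to o(1), where theta = s p and
   |V|^2 <= ell; this is the matrix Chernoff bound, without matrix exponentials
   or Golden-Thompson.  On the event that G has an eigenvalue below 1 - delta,
   tr(H_n^p) >= (1 - s (1 - delta))^p.  Letting p be large but finite loses a
   factor 1 + o(1) in the exponent, which is absorbed because
   h0^d Psi_j^2 <= D(N,alpha)^(2m) / 2 holds with a factor 2 to spare: for
   a solution y of the Jacobi equation with eigenvalue lambda, the function
   y^2 + (1 - x^2) y'^2 / lambda decreases on [-1, 0] and increases on [0, 1],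
   so |y| is largest at the endpoints.

   When G has an eigenvalue below 1 - delta the truncation costs at most
   4 K_f^2 h0^d.  Otherwise Pythagoras reduces the error to
   |f - Pi f|^2 + |C - c|^2, with c the coefficients of Pi f and G (C - c) a sum
   of n uncorrelated centred terms, whose second moments give the variance part
   of the bound. *)
Require Import Defs.
From mathcomp Require Import all_boot all_order all_algebra.
From mathcomp Require Import all_classical all_reals all_analysis.
From mathcomp Require Import measurable_realfun ring lra.
Set Implicit Arguments.
Unset Strict Implicit.
Unset Printing Implicit Defensive.
Import Order.TTheory GRing.Theory Num.Theory.
Import numFieldNormedType.Exports.
Local Open Scope classical_set_scope.
Local Open Scope ring_scope.

(** * Positive semidefinite matrices *)

Section PositiveSemidefinite.
Variables (R : realFieldType) (M : nat).
Implicit Types (H K : 'M[R]_M) (u v : 'cV[R]_M) (k : nat).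

(** The constant in the exponent dictates the numbers. With [L = D^(2m) M / n], Markov's inequality
    applied to the trace gives, to leading order, the exponent [- theta delta + theta^2 ell / 2],
    whose minimum over theta is [- delta^2 / (2 ell)]. For [ell = L] this would be the target
    itself, with nothing left for the error of a finite power; [ell = L / 2] leaves room, which is
    spent at [theta = delta / L]. Powers respond algebraically to a rank one update. H and K = H - s
    v v^T do not commute, but replacing one factor at a time produces only products of the scalars
    [v^T H^b v] and [v^T K^a v], which behave like moments of a positive measure. Cauchy-Schwarz
    handles these without eigenvalues or matrix square roots. The noise has two moments and the
    estimator contains a matrix inverse, so the loss is never integrated directly: at every outcome
    it is bounded by an explicit integrable function. *)

Definition bform H u v : R := (u^T *m H *m v) 0 0.

Definition psd H := H^T = H /\ forall v, 0 <= bform H v v.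

Lemma bform_sym H u v : H^T = H -> bform H u v = bform H v u.
Proof.
move=> Hs; rewrite /bform; transitivity ((u^T *m H *m v)^T 0 0); first by rewrite [RHS]mxE.
by rewrite !trmx_mul trmxK Hs mulmxA.
Qed.

Lemma bformDl H u u' v : bform H (u + u') v = bform H u v + bform H u' v.
Proof. by rewrite /bform linearD /= !mulmxDl mxE. Qed.

Lemma bformDr H u v v' : bform H u (v + v') = bform H u v + bform H u v'.
Proof. by rewrite /bform mulmxDr mxE. Qed.

Lemma bformZl H a u v : bform H (a *: u) v = a * bform H u v.
Proof. by rewrite /bform linearZ /= -!scalemxAl mxE. Qed.

Lemma bformZr H a u v : bform H u (a *: v) = a * bform H u v.
Proof. by rewrite /bform -scalemxAr mxE. Qed.

Lemma bformBm H K u v : bform (H - K) u v = bform H u v - bform K u v.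
Proof. by rewrite /bform mulmxBr mulmxBl !mxE. Qed.

Lemma bformZm a H u v : bform (a *: H) u v = a * bform H u v.
Proof. by rewrite /bform -scalemxAr -scalemxAl mxE. Qed.

Lemma bform_outer H K u v w z :
  bform (H *m (v *m w^T) *m K) u z = bform H u v * bform K w z.
Proof.
rewrite /bform; have -> : u^T *m (H *m (v *m w^T) *m K) *m z =
  (u^T *m H *m v) *m (w^T *m K *m z) by rewrite !mulmxA.
by rewrite mxE big_ord1.
Qed.

Lemma bform_cauchy_schwarz H u v : psd H ->
  bform H u v ^+ 2 <= bform H u u * bform H v v.
Proof.
move=> [Hs Hp].
have key a b : 0 <= a ^+ 2 * bform H u u + 2 * a * b * bform H u v + b ^+ 2 * bform H v v.
  have := Hp (a *: u + b *: v).
  rewrite !(bformDl, bformDr, bformZl, bformZr) (bform_sym v u)//.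
  by congr (0 <= _); ring.
have [v0|vn0] := eqVneq (bform H v v) 0.
  (* With t = [bform H u v] and this second coefficient the quadratic expression equals - t^2, so t
     = 0. *)
  by have := key (bform H u v) (- (bform H u u + 1) / 2); rewrite v0; nra.
have v_gt0 : 0 < bform H v v by rewrite lt_neqAle eq_sym vn0 Hp.
have := key (bform H v v) (- bform H u v).
have -> : bform H v v ^+ 2 * bform H u u + 2 * bform H v v * - bform H u v * bform H u v + (- bform H u v) ^+ 2 * bform H v v = bform H v v * (bform H u u * bform H v v - bform H u v ^+ 2) by ring.
by rewrite pmulr_rge0// subr_ge0.
Qed.

Lemma trmx_expr H k : H^T = H -> (H ^+ k)^T = H ^+ k.
Proof.
move=> Hs; elim: k => [|k IH]; first by rewrite !expr0 trmx1.
rewrite [in LHS]exprS -[_ * _]/(_ *m _) trmx_mul IH Hs.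
by rewrite -[_ *m _]/(_ * _) -exprSr.
Qed.

Lemma bform_expr_shift H k u v : H^T = H ->
  bform (H ^+ k) (H *m u) (H *m v) = bform (H ^+ k.+2) u v.
Proof.
move=> Hs; rewrite /bform trmx_mul Hs exprS exprSr.
by rewrite -[_ * (_ * _)]/(_ *m (_ *m _)) !mulmxA.
Qed.

Lemma psd1 : psd 1.
Proof.
split; first exact: trmx1.
move=> v; rewrite /bform mulmx1 mxE; apply: sumr_ge0 => i _.
by rewrite mxE -expr2 sqr_ge0.
Qed.

(** Induction by steps of two: v^T H^(k+2) v is the form of H^k at H v. *)
Lemma psd_expr H k : psd H -> psd (H ^+ k).
Proof.
move=> psdH; have [Hs Hp] := psdH; split; first exact: trmx_expr.
elim/ltn_ind: k => -[|[|k]] IH v; first by rewrite expr0; exact: psd1.2.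
  by rewrite expr1.
by rewrite -bform_expr_shift//; exact: IH.
Qed.

(** The k-th moment of the spectral measure of H at v. The inequalities below are those of the
    moments of a positive measure on the half-line, obtained without diagonalizing H. *)
Definition moment H v k := bform (H ^+ k) v v.

Lemma moment_ge0 H v k : psd H -> 0 <= moment H v k.
Proof. by move=> /(psd_expr k)[_]; exact. Qed.

Lemma moment_shift H v k : psd H -> moment H (H *m v) k = moment H v k.+2.
Proof. by move=> [Hs _]; rewrite /moment bform_expr_shift. Qed.

Lemma moment_log_convex H v k : psd H ->
  moment H v k.+1 ^+ 2 <= moment H v k * moment H v k.+2.
Proof.
move=> psdH; have [Hs _] := psdH.
have := bform_cauchy_schwarz v (H *m v) (psd_expr k psdH).
rewrite bform_expr_shift//; congr (_ ^+ 2 <= _).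
by rewrite /moment /bform exprSr -[_ * _]/(_ *m _) !mulmxA.
Qed.

(** Log-convexity means that the ratios m(k+1) / m(k) increase, so moving two indices apart at
    constant sum increases the product. [step] states this with denominators cleared; a vanishing
    term forces the next one to vanish. *)
Lemma log_convex_seqM (m : nat -> R) (m_ge0 : forall k, 0 <= m k)
    (m_lc : forall k, m k.+1 ^+ 2 <= m k * m k.+2) i j :
  m i * m j <= m 0%N * m (i + j)%N.
Proof.
have step k l : (k <= l)%N -> m k.+1 * m l <= m k * m l.+1.
  elim: l => [|l IH]; first by rewrite leqn0 => /eqP ->; rewrite mulrC.
  rewrite leq_eqVlt => /predU1P[<-|kl]; first by rewrite mulrC.
  have {}IH := IH kl; have lc := m_lc l.
  have [ml0|mln0] := eqVneq (m l) 0.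
    move: lc; rewrite ml0 mul0r -[X in _ <= X](expr0n R 2) => lc.
    have -> : m l.+1 = 0 by apply/eqP; rewrite -sqrf_eq0 eq_le sqr_ge0 andbT; rewrite expr0n in lc.
    by rewrite mulr0 mulr_ge0.
  have ml_gt0 : 0 < m l by rewrite lt_neqAle eq_sym mln0 m_ge0.
  rewrite -(ler_pM2l ml_gt0).
  have mk := m_ge0 k; have ml1 := m_ge0 l.+1.
  have h1 := ler_wpM2r ml1 IH; have h2 := ler_wpM2l mk lc.
  apply: le_trans (_ : m k * m l.+1 ^+ 2 <= _).
    by apply: le_trans (le_trans h1 _); rewrite le_eqVlt; apply/orP; left; apply/eqP; ring.
  by apply: le_trans h2 _; rewrite le_eqVlt; apply/orP; left; apply/eqP; ring.
wlog ij : i j / (i <= j)%N.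
  move=> W; have [/W//|/ltnW/W] := leqP i j.
  by rewrite mulrC addnC.
elim: i j ij => [//|i IH] j ij.
apply: le_trans (step _ _ (ltnW ij)) _.
by rewrite addSnnS; apply: IH; rewrite (leq_trans (ltnW ij)).
Qed.

Lemma momentM H v i j : psd H ->
  moment H v i * moment H v j <= moment H v 0 * moment H v (i + j).
Proof.
move=> psdH; apply: log_convex_seqM => k; first exact: moment_ge0.
exact: moment_log_convex.
Qed.

Lemma moment0 H v : moment H v 0 = \sum_i v i 0 ^+ 2.
Proof.
rewrite /moment /bform expr0 mulmx1 mxE.
by apply: eq_bigr => i _; rewrite mxE expr2.
Qed.

Lemma moment0_eq0 H v : moment H v 0 = 0 -> v = 0.
Proof.
rewrite moment0 => /eqP; rewrite psumr_eq0; last by move=> i _; exact: sqr_ge0.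
move=> /allP h; apply/colP => i; rewrite mxE.
by have /= := h i (mem_index_enum i); rewrite sqrf_eq0 => /eqP.
Qed.

(** Jensen's inequality for the spectral measure, a probability measure when u is a unit vector. *)
Lemma moment_geX H u k : psd H -> moment H u 0 = 1 ->
  moment H u 1 ^+ k <= moment H u k.
Proof.
move=> psdH u1; elim: k => [|k IH]; first by rewrite u1 expr0.
rewrite exprS; apply: le_trans (_ : moment H u 1 * moment H u k <= _).
  by rewrite ler_wpM2l// moment_ge0.
by have := momentM u 1 k psdH; rewrite u1 mul1r add1n.
Qed.

Lemma moment_decr H v k : psd H -> (forall u, moment H u 1 <= moment H u 0) ->
  moment H v k.+1 <= moment H v k.
Proof.
move=> psdH H1; elim/ltn_ind: k v => -[|[|k]] IH v; first exact: H1.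
  (* Shifting by H v does not reach this exponent; m_2^2 <= m_1 m_3 together with m_3 <= m_2
     does. *)
  have lc := moment_log_convex v 1 psdH.
  have m3 : moment H v 3 <= moment H v 2 by rewrite -!moment_shift.
  have := moment_ge0 v 1 psdH; have := moment_ge0 v 2 psdH; nra.
by rewrite -!moment_shift// IH.
Qed.

(** m_1 m_k <= m_0 m_(k+1): no ratio of consecutive moments is below the first one, the Rayleigh
    quotient of v. *)
Lemma moment_incr H v c k : psd H -> (forall u, c * moment H u 0 <= moment H u 1) ->
  c * moment H v k <= moment H v k.+1.
Proof.
move=> psdH Hc; have [/moment0_eq0 ->|m0] := eqVneq (moment H v 0) 0.
  by rewrite /moment /bform !mulmx0 mxE mulr0.
have m0_gt0 : 0 < moment H v 0 by rewrite lt_neqAle eq_sym m0 moment_ge0.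
rewrite -(ler_pM2l m0_gt0) mulrA [_ * c]mulrC.
have := momentM v 1 k psdH; rewrite add1n; apply: le_trans.
by rewrite ler_wpM2r// moment_ge0.
Qed.

Lemma mxtrace_expr_moment H k :
  \tr (H ^+ k) = \sum_i moment H (delta_mx i 0) k.
Proof.
apply: eq_bigr => i _; rewrite /moment /bform trmx_delta -rowE.
by rewrite -colE !mxE.
Qed.

Lemma mxtrace_expr_decr H k : psd H -> (forall u, moment H u 1 <= moment H u 0) ->
  \tr (H ^+ k.+1) <= \tr (H ^+ k).
Proof.
by move=> psdH H1; rewrite !mxtrace_expr_moment ler_sum// => i _; exact: moment_decr.
Qed.

Lemma mxtrace_expr_incr H c k : psd H ->
  (forall u, c * moment H u 0 <= moment H u 1) ->
  c * \tr (H ^+ k) <= \tr (H ^+ k.+1).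
Proof.
move=> psdH Hc; rewrite !mxtrace_expr_moment mulr_sumr ler_sum// => i _.
exact: moment_incr.
Qed.

Lemma mxtrace_expr_ge0 H k : psd H -> 0 <= \tr (H ^+ k).
Proof.
by move=> psdH; rewrite mxtrace_expr_moment sumr_ge0// => i _; exact: moment_ge0.
Qed.

(** The left side is |H^q u|^2 and the right side the squared Frobenius norm of H^q. This plays the
    part of bounding the largest eigenvalue by the trace. *)
Lemma moment_double_le_mxtrace H u q : H^T = H -> moment H u 0 = 1 ->
  moment H u q.*2 <= \tr (H ^+ q.*2).
Proof.
move=> Hs u1; have Ks : (H ^+ q)^T = H ^+ q by exact: trmx_expr.
set K := H ^+ q in Ks *.
have -> : moment H u q.*2 = \sum_i (K *m u) i 0 ^+ 2.
  rewrite /moment /bform -addnn exprD -/K -[K * K]/(K *m K).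
  rewrite mulmxA -mulmxA -{1}Ks -trmx_mul mxE.
  by apply: eq_bigr => i _; rewrite mxE expr2.
rewrite -addnn exprD -/K /mxtrace ler_sum// => i _.
have := bform_cauchy_schwarz (row i K)^T u psd1.
have -> : bform 1 u u = 1 by rewrite -u1 /moment expr0.
rewrite mulr1 {1}/bform trmxK mulmx1 -row_mul mxE => /le_trans; apply.
rewrite /bform trmxK mulmx1 -[K * K]/(K *m K) !mxE.
apply: ler_sum => j _; have Kji : K j i = K i j by rewrite -{1}Ks mxE.
by rewrite !mxE Kji.
Qed.

(** * Traces of powers under a rank one update *)

Section RankOneUpdate.
Variables (H : 'M[R]_M) (v : 'cV[R]_M) (s : R).
Let K := H - s *: (v *m v^T).
Hypotheses (s_ge0 : 0 <= s) (psdH : psd H) (psdK : psd K).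

(** Interpolates between the moments of H and those of K: factors H are exchanged for K one at a
    time, each exchange costing s times a product of a moment of H and a moment of K. *)
Let mix b a := bform (H ^+ b *m K ^+ a) v v.

Let mixS b a : mix b a.+1 = mix b.+1 a - s * (moment H v b * moment K v a).
Proof.
rewrite /mix exprS -[K * _]/(K *m _) mulmxA {1}/K mulmxBr mulmxBl.
rewrite bformBm exprSr -[H ^+ b * H]/(H ^+ b *m H); congr (_ - _).
by rewrite -scalemxAr -scalemxAl bformZm bform_outer.
Qed.

Let momentK_le j : moment K v j <= moment H v j.
Proof.
suff key a b : mix b a <= moment H v (a + b).
  have := key j 0%N; rewrite addn0; apply: le_trans.
  by rewrite /mix expr0 mul1mx.
elim: a b => [|a IH] b; first by rewrite /mix expr0 mulmx1.
rewrite mixS addSnnS; apply: le_trans (IH b.+1); rewrite gerBl.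
by rewrite !mulr_ge0// moment_ge0.
Qed.

(** Each of the a exchanges costs s times a product of two moments whose indices add up to P;
    [momentM] bounds all of these by the same m_0 m_P. *)
Let mix_ge a b P : (a + b = P.+1)%N ->
  moment H v P.+1 - s * a%:R * (moment H v 0 * moment H v P) <= mix b a.
Proof.
elim: a b => [|a IH] b.
  by rewrite add0n => <-; rewrite mulr0 mul0r subr0 /mix expr0 mulmx1.
rewrite addSn => -[abP]; rewrite mixS.
have := IH b.+1; rewrite addnS abP => /(_ erefl).
have : moment H v b * moment K v a <= moment H v 0 * moment H v P.
  rewrite -abP addnC; apply: le_trans (momentM v b a psdH).
  by rewrite ler_wpM2l// moment_ge0.
move=> h1 h2; apply: le_trans (lerB h2 (ler_wpM2l s_ge0 h1)).
by rewrite -natr1 le_eqVlt; apply/orP; left; apply/eqP; ring.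
Qed.

Let mixtrS b a : \tr (H ^+ b *m K ^+ a.+1) = \tr (H ^+ b.+1 *m K ^+ a) - s * mix b a.
Proof.
rewrite exprS -[K * _]/(K *m _) {1}/K mulmxBl mulmxBr linearB /= exprSr.
rewrite -[H ^+ b * H]/(H ^+ b *m H) mulmxA; congr (_ - _).
rewrite -scalemxAl -scalemxAr linearZ /=; congr (_ * _).
have -> : H ^+ b *m (v *m v^T *m K ^+ a) = (H ^+ b *m v) *m (v^T *m K ^+ a).
  by rewrite !mulmxA.
rewrite mxtrace_mulC /mxtrace big_ord1 /mix /bform.
transitivity ((v^T *m (K ^+ a *m (H ^+ b *m v)))^T 0 0); first by rewrite [RHS]mxE !mulmxA.
by rewrite !trmx_mul trmxK !trmx_expr ?psdH.1 ?psdK.1// !mulmxA.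
Qed.

(** A second order Taylor bound. Each exchange lowers the trace by s times a [mix], estimated from
    below by [mix_ge]; the corrections add up to s^2 (0 + 1 + ... + (P + 1)), at most s^2 (P + 2)^2
    / 2. *)
Lemma mxtrace_expr_rank1_le P :
  \tr (K ^+ P.+2) <= \tr (H ^+ P.+2) - s * P.+2%:R * moment H v P.+1
    + s ^+ 2 * P.+2%:R ^+ 2 / 2 * (moment H v 0 * moment H v P).
Proof.
suff key a b : (a + b = P.+2)%N -> \tr (H ^+ b *m K ^+ a) <=
    \tr (H ^+ P.+2) - s * a%:R * moment H v P.+1
    + s ^+ 2 * a%:R ^+ 2 / 2 * (moment H v 0 * moment H v P).
  by have := key P.+2 0%N; rewrite addn0 expr0 mul1mx; exact.
elim: a b => [|a IH] b.
  by rewrite add0n => <-; rewrite expr0 mulmx1 mulr0 expr0n/= mulr0 !mul0r subr0 addr0.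
rewrite addSn => -[abP]; rewrite mixtrS.
have := IH b.+1; rewrite addnS abP => /(_ erefl).
have := mix_ge abP; rewrite -natr1.
have : 0 <= moment H v 0 * moment H v P by rewrite mulr_ge0// moment_ge0.
set A := _ * moment H v P; set B := moment H v P.+1; set C := mix b a.
set T := \tr (H ^+ P.+2); set t := a%:R.
move=> A0 h1 h2.
have h3 : s * (B - s * t * A) <= s * C by rewrite ler_wpM2l.
have h4 : 0 <= s ^+ 2 * A by rewrite mulr_ge0// sqr_ge0.
apply: le_trans (lerB h2 h3) _; rewrite -subr_ge0 -natr1 -/t.
by rewrite (_ : _ - _ = s ^+ 2 * A / 2) ?divr_ge0//; field.
Qed.

End RankOneUpdate.

End PositiveSemidefinite.

(** * The weight (1 - x^2)^alpha *)

Section WeightedIntegral.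
Context {R : realType}.
Implicit Types (alpha a x : R) (q : {poly R}).
Local Notation mu := (@lebesgue_measure R).

Lemma weight1_ge0 alpha x : 0 <= weight1 alpha x.
Proof. exact: powR_ge0. Qed.

Lemma measurable_weight1 alpha (A : set R) : measurable_fun A (@weight1 R alpha).
Proof.
apply/measurable_funTS; apply: (@measurableT_comp _ _ _ _ _ _ (@powR R ^~ alpha)).
  exact: measurable_powR.
by apply: measurable_funB => //; exact: measurable_funX.
Qed.

(** Chosen so that (q w_(alpha+1))' = [wderiv alpha q] w_alpha. Every integration by parts below
    says that such a polynomial has weighted integral zero. *)
Definition wderiv alpha q : {poly R} :=
  (1 - 'X^2) * q^`() - (2 * alpha + 2) *: ('X * q).

Lemma horner_wderiv alpha q x : (wderiv alpha q).[x] =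
  (1 - x ^+ 2) * q^`().[x] - (2 * alpha + 2) * (x * q.[x]).
Proof. by rewrite !(hornerD, hornerN, hornerM, hornerZ, hornerC, hornerX, hornerXn). Qed.

Lemma sqr_lt1 x : -1 < x -> x < 1 -> 0 < 1 - x ^+ 2.
Proof. nra. Qed.

Lemma is_derive_weight1 alpha x : -1 < x -> x < 1 ->
  is_derive x 1 (@weight1 R (alpha + 1)) (- (2 * alpha + 2) * x * weight1 alpha x).
Proof.
move=> x1 x2; have x_gt0 := sqr_lt1 x1 x2.
rewrite /weight1.
have -> : (fun x : R => (1 - x ^+ 2) `^ (alpha + 1)) =
  (@powR R ^~ (alpha + 1)) \o (horner (1 - 'X^2)).
  by apply/funext => y /=; rewrite !hornerE.
have h : 0 < (1 - 'X^2 : {poly R}).[x] by rewrite !hornerE.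
have := is_derive1_powR (alpha + 1) h.
move=> d1; apply: is_derive_eq.
rewrite derivB derivXn derivC !hornerE /= addrK; ring.
Qed.

Lemma is_derive_wderiv alpha q x : -1 < x -> x < 1 ->
  is_derive x 1 (fun x => q.[x] * weight1 (alpha + 1) x)
    ((wderiv alpha q).[x] * weight1 alpha x).
Proof.
move=> x1 x2; have x_gt0 := sqr_lt1 x1 x2.
have d1 := is_derive_weight1 alpha x1 x2.
apply: is_derive_eq.
have -> : weight1 (alpha + 1) x = (1 - x ^+ 2) * weight1 alpha x.
  rewrite /weight1 powRD ?powRr1 ?(ltW x_gt0) 1?mulrC//.
  by rewrite (gt_eqF x_gt0) implybT.
rewrite horner_wderiv /GRing.scale/=; ring.
Qed.

Lemma weight1S alpha x : - 2^-1 <= alpha -> x \in `[-1, 1] ->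
  weight1 (alpha + 1) x = (1 - x ^+ 2) * weight1 alpha x.
Proof.
rewrite in_itv/= => al /andP[x1 x2]; rewrite /weight1.
have [->|x0] := eqVneq (1 - x ^+ 2) 0.
  by rewrite powR0 ?mul0r//; apply/eqP; lra.
have x_ge0 : 0 <= 1 - x ^+ 2 by nra.
by rewrite powRD ?powRr1 1?mulrC// x0 implybT.
Qed.

Lemma derivable_weight1 alpha x : -1 < x -> x < 1 -> derivable (@weight1 R alpha) x 1.
Proof.
move=> x1 x2; have := is_derive_weight1 (alpha - 1) x1 x2.
by rewrite subrK => -[].
Qed.

Lemma integral_wderiv_itv alpha q a : 0 < a -> a < 1 ->
  (\int[mu]_(x in `[(- a)%R, a]) ((wderiv alpha q).[x] * weight1 alpha x)%:E =
   (q.[a] * weight1 (alpha + 1) a - q.[- a] * weight1 (alpha + 1) (- a))%:E)%E.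
Proof.
move=> a_gt0 a_lt1.
have F0 : - a < a by lra.
have dF (x : R) : - a <= x -> x <= a ->
    derivable (fun x => q.[x] * weight1 (alpha + 1) x) x 1.
  by move=> x1 x2; have [||//] := @is_derive_wderiv alpha q x; lra.
have cF : {within `[- a, a], continuous (fun x => q.[x] * weight1 (alpha + 1) x)}.
  by apply: derivable_within_continuous => x; rewrite in_itv/= => /andP[]; exact: dF.
rewrite (@continuous_FTC2 _ _ (fun x => q.[x] * weight1 (alpha + 1) x))//.
- apply: derivable_within_continuous => x; rewrite in_itv/= => /andP[x1 x2].
  apply: derivableM; first exact: derivable_horner.
  by apply: derivable_weight1; lra.
- have [_ ? ?] := (continuous_within_itvP _ F0).1 cF.
  by split => // x; rewrite in_itv/= => /andP[/ltW + /ltW]; exact: dF.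
- move=> x; rewrite in_itv/= => /andP[x1 x2]; rewrite derive1E.
  by have [||_ ->//] := @is_derive_wderiv alpha q x; lra.
Qed.

Lemma nondecreasing_itv : nondecreasing_seq
  (fun n => `[- (1 - n.+2%:R^-1), 1 - n.+2%:R^-1]%classic : set R).
Proof.
move=> m n mn; rewrite subsetEset; apply: subset_itv; rewrite bnd_simp.
  by rewrite lerN2 lerB// lef_pV2 ?posrE// ler_nat.
by rewrite lerB// lef_pV2 ?posrE// ler_nat.
Qed.

Lemma bigcup_itv_oo :
  \bigcup_n `[- (1 - n.+2%:R^-1), 1 - n.+2%:R^-1]%classic = `]-1, 1[%classic :> set R.
Proof.
apply/seteqP; split => [x [n _]|x] /=; rewrite !in_itv/= => /andP[x1 x2].
  have : 0 < n.+2%:R^-1 :> R by rewrite invr_gt0.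
  move: x1 x2; set u := n.+2%:R^-1 => x1 x2 u0.
  by apply/andP; split; lra.
have d_gt0 : 0 < Num.min (1 - x) (1 + x) by rewrite lt_min; apply/andP; split; lra.
have [n nd] := ltr_add_invr d_gt0.
exists n => //=; rewrite in_itv/=.
have : n.+2%:R^-1 <= n.+1%:R^-1 :> R by rewrite lef_pV2 ?posrE// ler_nat.
move: nd; rewrite add0r lt_min; set u := n.+1%:R^-1; set v := n.+2%:R^-1.
by move=> /andP[? ?] ?; apply/andP; split; lra.
Qed.

Lemma continuous_polyw alpha q a : 0 < a -> a < 1 ->
  {within `[- a, a], continuous (fun x => q.[x] * weight1 alpha x)}.
Proof.
move=> a0 a1; apply: derivable_within_continuous => x; rewrite in_itv/= => /andP[x1 x2].
apply: derivableM; first exact: derivable_horner.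
by apply: derivable_weight1; lra.
Qed.

Lemma integrable_polyw_itv alpha q a : 0 < a -> a < 1 ->
  mu.-integrable `[- a, a] (EFin \o (fun x => q.[x] * weight1 alpha x)).
Proof.
move=> a0 a1; apply: continuous_compact_integrable; first exact: segment_compact.
exact: continuous_polyw.
Qed.

Lemma weight1_le1 alpha x : 0 <= alpha -> -1 <= x -> x <= 1 -> weight1 alpha x <= 1.
Proof.
move=> al x1 x2; apply: le_trans (_ : 1 `^ alpha <= _); last by rewrite powR1.
by apply: ge0_ler_powR => //; rewrite ?nnegrE; have := sqr_ge0 x; nra.
Qed.

(** For alpha < 0 the weight blows up at the endpoints. Pointwise w <= 2 - Q w, because (1 - x^2) w
    <= 1 and 2 alpha + 1 >= 0, while Q w is an exact derivative with nonnegative integral. The bound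
    4 is uniform in a. *)
Lemma integral_weight1_itv_le alpha a : - 2^-1 <= alpha -> 0 < a -> a < 1 ->
  (\int[mu]_(x in `[(- a)%R, a]) (weight1 alpha x)%:E <= 4%:E)%E.
Proof.
move=> al a0 a1; set Q := wderiv alpha 'X.
have Qi := integrable_polyw_itv alpha Q a0 a1.
have Ci : mu.-integrable `[- a, a] (EFin \o cst (2 : R)).
  by apply: continuous_compact_integrable; [exact: segment_compact|exact: cst_continuous].
apply: (@le_trans _ _ (\int[mu]_(x in `[(- a)%R, a]) ((2%R : R)%:E - (Q.[x] * weight1 alpha x)%:E))%E).
  apply: le_integral => //=.
  - have := integrable_polyw_itv alpha 1 a0 a1; apply: eq_integrable => //.
    by move=> x _ /=; rewrite hornerE mul1r.
  - exact: (integrableB _ Ci Qi).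
  move=> x; rewrite inE/= in_itv/= => /andP[x1 x2]; rewrite -EFinB lee_fin.
  have w1 : (1 - x ^+ 2) * weight1 alpha x <= 1.
    rewrite -weight1S//; first by apply: weight1_le1; lra.
    by rewrite in_itv/=; apply/andP; split; lra.
  have w0 := weight1_ge0 alpha x.
  have x2w : 0 <= x ^+ 2 * weight1 alpha x by rewrite mulr_ge0// sqr_ge0.
  have h : 0 <= (2 * alpha + 1) * (x ^+ 2 * weight1 alpha x).
    by rewrite mulr_ge0//; lra.
  by rewrite /Q horner_wderiv derivX hornerC hornerX; nra.
rewrite integralB_EFin// integral_cst//= integral_wderiv_itv//.
rewrite lebesgue_measure_itv/= lte_fin ifT; last lra.
rewrite -!(EFinD, EFinM) lee_fin !hornerX.
have := weight1_ge0 (alpha + 1) a; have := weight1_ge0 (alpha + 1) (- a).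
nra.
Qed.

Lemma invn2_bounds n : 0 < 1 - n.+2%:R^-1 :> R /\ 1 - n.+2%:R^-1 < 1 :> R.
Proof.
by rewrite gtrBl invr_gt0 ltr0n subr_gt0 invf_lt1// ltr1n.
Qed.

Lemma integrable_weight1 alpha : - 2^-1 <= alpha ->
  mu.-integrable `[-1, 1] (EFin \o @weight1 R alpha).
Proof.
move=> al; apply/integrableP; split.
  by apply/measurable_EFinP; exact: measurable_weight1.
under eq_integral do rewrite gee0_abs ?lee_fin ?weight1_ge0//.
rewrite integral_itv_bndoo; last first.
  by apply/measurable_EFinP; exact: measurable_weight1.
rewrite -bigcup_itv_oo; set F := fun n => _.
have mF i : measurable (F i : set (measurableTypeR R)) by exact: measurable_itv.
have cvgF : (\int[mu]_(x in F i) (weight1 alpha x)%:E @[i --> \oo] -->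
    \int[mu]_(x in \bigcup_i F i) (weight1 alpha x)%:E)%E.
  apply: ge0_nondecreasing_set_cvg_integral => //; first exact: nondecreasing_itv.
    by move=> i; apply/measurable_EFinP; exact: measurable_weight1.
  by move=> i x _; rewrite lee_fin weight1_ge0.
apply: (@le_lt_trans _ _ (4%R : R)%:E); last exact: ltry.
rewrite -(cvg_lim _ cvgF)//; apply: lime_le; first by apply/cvg_ex; eexists; exact: cvgF.
apply: nearW => n; have [n0 n1] := invn2_bounds n.
exact: integral_weight1_itv_le.
Qed.

Lemma horner_bounded q : [bounded q.[x] | x in `[-1, 1]%classic : set R].
Proof.
have := @compact_bounded _ _ _ (continuous_compact
  (continuous_subspaceT (@continuous_horner R q)) (@segment_compact R (-1) 1)).
move=> [M [Mr Mh]]; exists M; split => // y My x xI.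
by apply: Mh => //; exists x.
Qed.

Lemma integrable_polyw alpha q : - 2^-1 <= alpha ->
  mu.-integrable `[-1, 1] (EFin \o (fun x => q.[x] * weight1 alpha x)).
Proof.
move=> al.
have mI : measurable (`[-1, 1]%classic : set (measurableTypeR R)) by exact: measurable_itv.
have := integrableMr mI (measurable_poly q (A := `[-1, 1]%classic)) (horner_bounded q) (integrable_weight1 al).
by apply: eq_integrable.
Qed.

Definition wint alpha q : R :=
  \int[mu]_(x in `[-1, 1]) (q.[x] * weight1 alpha x).

Lemma wintE alpha q : - 2^-1 <= alpha ->
  (\int[mu]_(x in `[(-1)%R, 1%R]) (q.[x] * weight1 alpha x)%:E = (wint alpha q)%:E)%E.
Proof.
move=> al; rewrite /wint /Rintegral fineK//.
by apply: integrable_fin_num => //; exact: integrable_polyw.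
Qed.

Lemma wintD alpha p q : - 2^-1 <= alpha ->
  wint alpha (p + q) = wint alpha p + wint alpha q.
Proof.
move=> al; rewrite /wint -RintegralD//; try exact: integrable_polyw.
by apply: eq_Rintegral => x _; rewrite hornerD mulrDl.
Qed.

Lemma wintZ alpha c q : - 2^-1 <= alpha -> wint alpha (c *: q) = c * wint alpha q.
Proof.
move=> al; rewrite /wint -RintegralZl//; last exact: integrable_polyw.
by apply: eq_Rintegral => x _; rewrite hornerZ mulrA.
Qed.

Lemma wintB alpha p q : - 2^-1 <= alpha ->
  wint alpha (p - q) = wint alpha p - wint alpha q.
Proof. by move=> al; rewrite -scaleN1r wintD// wintZ// mulN1r. Qed.

Lemma wint1 alpha : wint alpha 1 = h0 alpha.
Proof. by apply: eq_Rintegral => x _; rewrite hornerE mul1r. Qed.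

Lemma wintS alpha q : - 2^-1 <= alpha ->
  wint alpha ((1 - 'X^2) * q) = wint (alpha + 1) q.
Proof.
move=> al; apply: eq_Rintegral => x; rewrite inE/= => x1.
by rewrite weight1S// hornerM !(hornerD, hornerN, hornerC, hornerXn) mulrAC mulrC.
Qed.

Lemma cvg_boundary alpha q : - 2^-1 <= alpha ->
  (fun n => q.[1 - n.+2%:R^-1] * weight1 (alpha + 1) (1 - n.+2%:R^-1)) @ \oo --> 0.
Proof.
move=> al.
have cvg1 : (fun n => 1 - n.+2%:R^-1 : R) @ \oo --> (1 : R).
  rewrite -[X in _ --> X]subr0; apply: cvgB; first exact: cvg_cst.
  by have := @cvg_harmonic R; rewrite -(cvg_shiftS).
have cq : (fun n => q.[1 - n.+2%:R^-1]) @ \oo --> q.[1].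
  by apply: (cvg_comp _ _ cvg1); exact: continuous_horner.
rewrite -(mulr0 q.[1]); apply: cvgM => //.
have cs : (fun n => Num.sqrt (1 - 'X^2 : {poly R}).[1 - n.+2%:R^-1]) @ \oo --> (0 : R).
  have -> : (0 : R) = Num.sqrt (1 - 'X^2 : {poly R}).[1].
    by rewrite !(hornerD, hornerN, hornerC, hornerXn) expr1n subrr sqrtr0.
  have cp : (fun n => (1 - 'X^2 : {poly R}).[1 - n.+2%:R^-1]) @ \oo -->
      (1 - 'X^2 : {poly R}).[1].
    by apply: (cvg_comp _ _ cvg1); exact: continuous_horner.
  by apply: (cvg_comp _ _ cp); exact: sqrt_continuous.
(* Since alpha + 1 >= 1/2 and 1 - x^2 lies in (0, 1], the weight is at most the square root of 1 -
   x^2. *)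
apply: (squeeze_cvgr _ (cvg_cst 0) cs); apply: nearW => n.
rewrite weight1_ge0/= !(hornerD, hornerN, hornerC, hornerXn).
have [n0 n1] := invn2_bounds n; move: n0 n1; set y := 1 - _ => y0 y1.
rewrite -powR12_sqrt; last by nra.
by rewrite /weight1; apply: ger_powR; [apply/andP; split; nra | lra].
Qed.

(** The fundamental theorem of calculus on [-a, a] with a tending to 1: the boundary terms vanish in
    the limit and dominated convergence gives the integral. The energy identity, the orthogonality
    and the recurrence for [h0] all come from here. *)
Lemma wint_wderiv alpha q : - 2^-1 <= alpha -> wint alpha (wderiv alpha q) = 0.
Proof.
move=> al; set Q := wderiv alpha q; set g := fun x => Q.[x] * weight1 alpha x.
pose A n : set (measurableTypeR R) := `[- (1 - n.+2%:R^-1), 1 - n.+2%:R^-1]%classic.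
have mA n : measurable (A n) by exact: measurable_itv.
have mg D : measurable_fun D g.
  by apply: measurable_funM; [exact: measurable_poly|exact: measurable_weight1].
have gi : mu.-integrable `]-1, 1[ (EFin \o g).
  apply: (integrableS _ _ _ (integrable_polyw Q al)) => //.
  by apply: subset_itv; rewrite bnd_simp.
have mI : measurable (`]-1, 1[%classic : set (measurableTypeR R)) by exact: measurable_itv.
have := @dominated_convergence _ _ R mu `]-1, 1[%classic mI
  (fun n => (EFin \o g) \_ (A n)) (EFin \o g) (abse \o (EFin \o g)).
case.
- move=> n; apply/measurable_restrict => //.
  by apply/measurable_EFinP; exact: mg.
- by apply/measurable_EFinP; exact: mg.
- apply: aeW => x xI.
  have := xI; rewrite -bigcup_itv_oo => -[n _ xn].
  apply: cvg_near_cst; exists n => // m /= nm.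
  rewrite patchE ifT// inE; have := nondecreasing_itv nm.
  by rewrite subsetEset; exact.
- exact: integrable_abse.
- apply: aeW => x n _ /=; rewrite patchE; case: ifPn => //= _.
  by rewrite normr0 lee_fin.
move=> _ _; rewrite -(@integral_itv_bndoo _ _ _ _ true false); last first.
  by apply/measurable_EFinP; exact: mg.
rewrite (wintE Q al) => cvgI.
have cvg0 : (fun n => (q.[1 - n.+2%:R^-1] * weight1 (alpha + 1) (1 - n.+2%:R^-1) -
    q.[- (1 - n.+2%:R^-1)] * weight1 (alpha + 1) (- (1 - n.+2%:R^-1)))%:E) @ \oo --> (0 : R)%:E.
  apply/fine_cvgP; split; first by apply: nearW.
  rewrite -[X in _ --> X]subr0; apply: cvgB; first exact: cvg_boundary.
  (* The weight is even, so the left endpoint is the right endpoint of the reflected polynomial. *)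
  have := cvg_boundary (q \Po (- 'X)) al.
  rewrite (_ : (fun n => _) = (fun n => q.[- (1 - n.+2%:R^-1)] *
    weight1 (alpha + 1) (- (1 - n.+2%:R^-1))))//.
  by apply/funext => k; rewrite horner_comp hornerN hornerX /weight1 sqrrN.
have E n : (\int[mu]_(x in `](-1)%R, 1%R[) ((EFin \o g) \_ (A n)) x =
    (q.[1 - n.+2%:R^-1] * weight1 (alpha + 1) (1 - n.+2%:R^-1) -
    q.[- (1 - n.+2%:R^-1)] * weight1 (alpha + 1) (- (1 - n.+2%:R^-1)))%:E)%E.
  have [n0 n1] := invn2_bounds n.
  rewrite -integral_wderiv_itv// -integral_mkcondr setIidr//.
  by move=> x An; rewrite -bigcup_itv_oo; exists n.
have seqE : [sequence (\int[mu]_(x in `](-1)%R, 1%R[) ((EFin \o g) \_ (A n)) x)%E]_n =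
  (fun n => (q.[1 - n.+2%:R^-1] * weight1 (alpha + 1) (1 - n.+2%:R^-1) -
    q.[- (1 - n.+2%:R^-1)] * weight1 (alpha + 1) (- (1 - n.+2%:R^-1)))%:E).
  by apply/funext => n; exact: E.
rewrite seqE in cvgI.
have : (wint alpha Q)%:E = (0 : R)%:E.
  by apply: (cvg_unique _ cvgI cvg0); exact: ereal_hausdorff.
by case.
Qed.

End WeightedIntegral.

(** * Jacobi polynomials *)

Section JacobiEquation.
Context {R : realType}.
Implicit Types (alpha b x : R) (k : nat) (y : {poly R}).

Definition jacobi_eigen alpha k : R := k%:R * (k%:R + 2 * alpha + 1).

(** The Jacobi equation (1 - x^2) y'' - (2 alpha + 2) x y' + k (k + 2 alpha + 1) y = 0, written in
    the divergence form that [wint_wderiv] integrates. *)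
Definition jacobi_equation alpha k y :=
  wderiv alpha y^`() = - jacobi_eigen alpha k *: y.

Lemma wderivD alpha p q : wderiv alpha (p + q) = wderiv alpha p + wderiv alpha q.
Proof. by rewrite /wderiv derivD -!mul_polyC; ring. Qed.

Lemma wderivZ alpha c p : wderiv alpha (c *: p) = c *: wderiv alpha p.
Proof. by rewrite /wderiv derivZ -!mul_polyC; ring. Qed.

Lemma wderiv0 alpha : wderiv alpha 0 = 0 :> {poly R}.
Proof. by rewrite /wderiv deriv0 !mulr0 scaler0 subr0. Qed.

Lemma deriv_expM_monic (p q : {poly R}) s r : p^`() = 1 -> q^`() = 1 ->
  (p ^+ s * q ^+ r)^`() = s%:R * (p ^+ s.-1 * q ^+ r) + r%:R * (p ^+ s * q ^+ r.-1).
Proof.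
move=> dp dq; rewrite derivM (deriv_exp p) (deriv_exp q) dp dq !mul1r.
by rewrite !mulr_natl mulrnAl mulrnAr.
Qed.

Let U : {poly R} := 'X - 1.
Let V : {poly R} := 'X + 1.

Let dU : U^`() = 1. Proof. by rewrite derivB derivX derivC subr0. Qed.

Let dV : V^`() = 1. Proof. by rewrite derivD derivX derivC addr0. Qed.

(** In powers of x - 1 and x + 1 the Jacobi operator couples a product only with its two neighbours
    of the same total degree, and the result consists of differences ready to telescope. Small
    exponents are separate cases because of the truncated predecessors. *)
Let wderiv_UV alpha s r :
  wderiv alpha (U ^+ s * V ^+ r)^`() + jacobi_eigen alpha (s + r) *: (U ^+ s * V ^+ r) =
  (s%:R * (s%:R + alpha)) *: (U ^+ s * V ^+ r - U ^+ s.-1 * V ^+ r.+1) -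
  (r%:R * (r%:R + alpha)) *: (U ^+ s.+1 * V ^+ r.-1 - U ^+ s * V ^+ r).
Proof.
rewrite (deriv_expM_monic _ _ dU dV) /wderiv derivD -!polyC_natr !mul_polyC !derivZ.
rewrite !(deriv_expM_monic _ _ dU dV).
rewrite /jacobi_eigen natrD -!mul_polyC !(polyCD, polyCM, polyC_natr, polyC1).
case: s => [|[|s]]; case: r => [|[|r]];
  rewrite /= ?(exprS U) ?(exprS V) ?(expr0 U) ?(expr0 V);
  try move: (U ^+ s) => P; try move: (V ^+ r) => Q; rewrite /U /V; move: (alpha%:P) => a.
all: ring.
Qed.

Lemma gbinomS a j : gbinom a j.+1 * j.+1%:R = gbinom a j * (a - j%:R) :> R.
Proof.
rewrite /gbinom big_ord_recr/= factS natrM invfM.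
have j1 : j.+1%:R != 0 :> R by rewrite pnatr_eq0.
have j0 : j`!%:R != 0 :> R by rewrite pnatr_eq0 -lt0n fact_gt0.
by field; rewrite j0 addrC natr1 j1.
Qed.

Let jcoef alpha k s : R := gbinom (k%:R + alpha) (k - s) * gbinom (k%:R + alpha) s.

Let jcoefS alpha k s : (s < k)%N ->
  s.+1%:R * (s.+1%:R + alpha) * jcoef alpha k s.+1 =
  (k - s)%:R * ((k - s)%:R + alpha) * jcoef alpha k s.
Proof.
move=> sk; rewrite /jcoef -(subnSK sk).
set j := (k - s.+1)%N; have kE : k%:R = j%:R + s.+1%:R :> R.
  by rewrite -natrD subnK.
have h1 := gbinomS (k%:R + alpha) j; have h2 := gbinomS (k%:R + alpha) s.
transitivity ((s.+1%:R + alpha) * gbinom (k%:R + alpha) j *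
    (gbinom (k%:R + alpha) s.+1 * s.+1%:R)); first by ring.
rewrite h2; transitivity ((j.+1%:R + alpha) *
    (gbinom (k%:R + alpha) j.+1 * j.+1%:R) * gbinom (k%:R + alpha) s); last by ring.
rewrite h1 kE -!natr1; ring.
Qed.

Lemma jacobi_expand alpha k : jacobi alpha alpha k =
  2^-1 ^+ k *: \sum_(s < k.+1) jcoef alpha k s *: (('X - 1) ^+ s * ('X + 1) ^+ (k - s)).
Proof.
rewrite /jacobi scaler_sumr; apply: eq_bigr => -[s sk] _ /=.
have -> : 2^-1 ^+ k = 2^-1 ^+ s * 2^-1 ^+ (k - s) :> R by rewrite -exprD subnKC.
rewrite !exprZn -!mul_polyC (polyCM (gbinom _ _)).
move: (('X - 1) ^+ s) (('X + 1) ^+ (k - s)) => P Q.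
by rewrite (polyCM (2^-1 ^+ s)); ring.
Qed.

(** By [jcoefS], what the s-th product passes to its successor cancels what the successor passes
    back, so the sum over s telescopes. *)
Lemma jacobiP alpha k : jacobi_equation alpha k (jacobi alpha alpha k).
Proof.
rewrite /jacobi_equation; apply/eqP; rewrite scaleNr -addr_eq0 jacobi_expand.
rewrite derivZ wderivZ scalerA mulrC -scalerA -scalerDr scaler_eq0; apply/orP; right.
rewrite (big_morph _ (@derivD R) (@deriv0 R)) (big_morph _ (wderivD alpha) (wderiv0 alpha)).
rewrite scaler_sumr -big_split /=.
(* The exchange between the products of index s - 1 and s. It vanishes at s = 0 through the factor
   s, and at s = k + 1 by the case distinction. *)
pose D s : {poly R} := if (s <= k)%N then (jcoef alpha k s * (s%:R * (s%:R + alpha))) *: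
  (U ^+ s * V ^+ (k - s) - U ^+ s.-1 * V ^+ (k - s).+1) else 0.
rewrite (eq_bigr (fun s : 'I_k.+1 => - (D s.+1 - D s))); last first.
  move=> -[s sk] _ /=; rewrite derivZ wderivZ.
  rewrite (scalerA (jacobi_eigen _ _)) (mulrC (jacobi_eigen _ _)) -(scalerA (jcoef _ _ _)).
  rewrite -(scalerDr (jcoef _ _ _)).
  have := wderiv_UV alpha s (k - s); rewrite subnKC// => ->.
  rewrite opprB /D; have -> : (s <= k)%N by [].
  rewrite scalerBr !scalerA; congr (_ - _).
  case: (ltnP s k) => [{}sk|ks]; last first.
    have -> : (k - s = 0)%N by apply/eqP; rewrite subn_eq0.
    by rewrite mul0r mulr0 scale0r.
  rewrite [jcoef _ _ s * _]mulrC -jcoefS// [jcoef _ _ s.+1 * _]mulrC.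
  by rewrite subnSK// subnS.
rewrite sumrN oppr_eq0 -(big_mkord xpredT (fun s => D s.+1 - D s)) telescope_sumr//.
by rewrite /D ltnn leq0n !mul0r mulr0 scale0r subr0.
Qed.

Lemma size_jacobi alpha k : (size (jacobi alpha alpha k) <= k.+1)%N.
Proof.
rewrite jacobi_expand; apply: leq_trans (size_scale_leq _ _) _.
apply: leq_trans (size_sum _ _ _) _; apply/bigmax_leqP => -[s sk] _ /=.
apply: leq_trans (size_scale_leq _ _) _.
rewrite (_ : 'X + 1 = 'X - (- 1)%:P); last by rewrite polyCN opprK.
rewrite size_monicM ?monic_exp ?monicXsubC// -?size_poly_gt0 !size_exp_XsubC//.
by rewrite addnS addSn subnKC.
Qed.

Lemma gbinom_gt0 k alpha : - 2^-1 <= alpha -> 0 < gbinom (k%:R + alpha) k :> R.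
Proof.
move=> al; rewrite /gbinom divr_gt0 ?ltr0n ?fact_gt0//.
apply: prodr_gt0 => -[i ik] _ /=.
have : i.+1%:R <= k%:R :> R by rewrite ler_nat.
rewrite -natr1; lra.
Qed.

(** Only the term s = 0 survives at 1. This value later shows that the norm is not zero. *)
Lemma jacobi1_gt0 alpha k : - 2^-1 <= alpha -> 0 < (jacobi alpha alpha k).[1].
Proof.
move=> al; rewrite jacobi_expand hornerZ horner_sum big_ord_recl /= big1; last first.
  by move=> i _; rewrite !(hornerZ, hornerM, horner_exp, hornerD, hornerN, hornerX, hornerC) subrr expr0n mul0r mulr0.
rewrite addr0 !(hornerZ, hornerM, horner_exp, hornerD, hornerN, hornerX, hornerC) expr0 mul1r subn0.
rewrite -[X in _ * (_ * X)]mul1r.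
rewrite mulr_gt0 ?exprn_gt0// mulr_gt0 ?mul1r ?exprn_gt0//.
by rewrite /jcoef subn0 mulr_gt0 ?gbinom_gt0// /gbinom big_ord0 fact0 divr1.
Qed.

End JacobiEquation.

(** * Norms, endpoint values and sup norms of Jacobi polynomials *)

Section JacobiNorm.
Context {R : realType}.
Implicit Types (alpha b x : R) (k : nat) (y : {poly R}).

Lemma jacobi_eigen_gt0 alpha k : - 2^-1 <= alpha -> 0 < jacobi_eigen alpha k.+1.
Proof.
move=> al; rewrite /jacobi_eigen mulr_gt0 ?ltr0n//.
have : 0 < k.+1%:R :> R by rewrite ltr0n.
lra.
Qed.

Lemma jacobi_eigen_inj alpha j k : - 2^-1 <= alpha -> (j < k)%N ->
  jacobi_eigen alpha j < jacobi_eigen alpha k.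
Proof.
move=> al jk; rewrite /jacobi_eigen.
have : j%:R < k%:R :> R by rewrite ltr_nat.
have : 0 <= j%:R :> R by rewrite ler0n.
nra.
Qed.

Lemma jacobi_equation_horner alpha k y x : jacobi_equation alpha k y ->
  (1 - x ^+ 2) * y^`()^`().[x] - (2 * alpha + 2) * (x * y^`().[x]) =
  - jacobi_eigen alpha k * y.[x].
Proof. by move=> /(congr1 (horner^~ x)); rewrite /= horner_wderiv hornerZ. Qed.

(** The eigenvalues match: (k + 1)(k + 2 + 2 alpha) - (2 alpha + 2) = k (k + 2 (alpha + 1) + 1). *)
Lemma jacobi_equation_deriv alpha k y : jacobi_equation alpha k.+1 y ->
  jacobi_equation (alpha + 1) k y^`().
Proof.
move=> /(congr1 deriv); rewrite /jacobi_equation /wderiv derivB derivM derivZ derivM.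
rewrite derivB derivXn derivX derivC derivZ => /eqP; rewrite -subr_eq0 => /eqP E.
apply/eqP; rewrite -subr_eq0 -E; apply/eqP.
rewrite /jacobi_eigen -natr1 -!mul_polyC !(polyCN, polyCD, polyCM, polyC_natr, polyC1) /=.
rewrite expr1; move: (y^`()) (y^`()^`()) (y^`()^`()^`()) (alpha%:P) => y1 y2 y3 a.
ring.
Qed.

(** Integrates the derivative of y y' w_(alpha+1). *)
Lemma wint_jacobi_energy alpha k y : - 2^-1 <= alpha -> jacobi_equation alpha k y ->
  wint (alpha + 1) (y^`() ^+ 2) = jacobi_eigen alpha k * wint alpha (y ^+ 2).
Proof.
move=> al E; rewrite -wintS//.
have := wint_wderiv (y * y^`()) al.
have -> : wderiv alpha (y * y^`()) =
    (1 - 'X^2) * y^`() ^+ 2 - jacobi_eigen alpha k *: (y ^+ 2).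
  rewrite -scaleNr expr2 scalerAl -E /wderiv derivM -!mul_polyC; ring.
by rewrite wintB// wintZ// => /eqP; rewrite subr_eq0 => /eqP.
Qed.

(** Integrates the derivative of the weighted Wronskian; distinct degrees have distinct
    eigenvalues. *)
Lemma wint_jacobi_orthogonal alpha j k y z : - 2^-1 <= alpha -> j != k ->
  jacobi_equation alpha j y -> jacobi_equation alpha k z -> wint alpha (y * z) = 0.
Proof.
move=> al jk Ey Ez; have := wint_wderiv (y * z^`() - z * y^`()) al.
have -> : wderiv alpha (y * z^`() - z * y^`()) =
    (jacobi_eigen alpha j - jacobi_eigen alpha k) *: (y * z).
  transitivity (y * wderiv alpha z^`() - z * wderiv alpha y^`()).
    by rewrite /wderiv derivB !derivM -!mul_polyC; ring.
  by rewrite Ey Ez -!mul_polyC !polyCN polyCB; ring.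
rewrite wintZ// => /eqP; rewrite mulf_eq0 subr_eq0 => /orP[|/eqP//].
by move: jk; rewrite neq_ltn => /orP[] /(jacobi_eigen_inj al) h /eqP E; move: h; rewrite E ltxx.
Qed.

(** Integrates the derivative of x w_(alpha+1); this recurrence stands in for the Beta function. *)
Lemma h0S alpha : - 2^-1 <= alpha ->
  (2 * alpha + 3) * h0 (alpha + 1) = (2 * alpha + 2) * h0 alpha.
Proof.
move=> al; have := wint_wderiv 'X al.
have -> : wderiv alpha ('X : {poly R}) =
    (2 * alpha + 3) *: ((1 - 'X^2) * 1) - (2 * alpha + 2) *: 1.
  by rewrite /wderiv derivX -!mul_polyC !polyCD; ring.
rewrite (wintB _ _ al) (wintZ (2 * alpha + 3) _ al) (wintZ (2 * alpha + 2) _ al) (wintS _ al) !wint1 => /eqP.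
by rewrite subr_eq0 => /eqP.
Qed.

(* The squared sup norm on [-1, 1] of the orthonormal polynomial of degree k
   times h0, in terms of b = 2 alpha + 1. *)
Fixpoint jacobi_peak k b : R :=
  if k is j.+1 then
    (b + 2) * (b + 1) / (k%:R * (k%:R + b)) * jacobi_peak j (b + 2)
  else 1.

(** Induction on the degree through the derivative. Where e^2 = 1 the equation loses its y'' term
    and reads lambda y(e) = (2 alpha + 2) e y'(e); y' solves the equation with alpha + 1 and degree
    one lower, and the energy identity converts its norm. This replaces the Gamma function formulas
    for norms and endpoint values. *)
Lemma jacobi_endpoint alpha k y e : - 2^-1 <= alpha -> e ^+ 2 = 1 ->
  jacobi_equation alpha k y -> (size y <= k.+1)%N ->
  h0 alpha * y.[e] ^+ 2 = jacobi_peak k (2 * alpha + 1) * wint alpha (y ^+ 2).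
Proof.
move=> + e1; elim: k alpha y => [|k IH] alpha y al E sy.
  have [c ->] : exists c, y = c%:P by exists y`_0; exact: size1_polyC.
  have -> : c%:P ^+ 2 = c ^+ 2 *: (1 : {poly R}).
    by rewrite -mul_polyC mulr1 polyC_exp.
  by rewrite hornerC mul1r (wintZ _ _ al) wint1 mulrC.
have al1 : - 2^-1 <= alpha + 1 by lra.
have sy' : (size y^`() <= k.+1)%N.
  by apply: leq_trans (size_poly _ _) _; case: (size y) sy.
have {}IH := IH _ _ al1 (jacobi_equation_deriv E) sy'.
rewrite /= (wint_jacobi_energy al E) in IH.
have := jacobi_equation_horner e E; rewrite e1 subrr mul0r sub0r.
have := jacobi_eigen_gt0 k al; set lam := jacobi_eigen _ _ in IH *.
move=> lam_gt0 ye; have h0E := h0S al.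
have -> : y.[e] = (2 * alpha + 2) * (e * y^`().[e]) / lam.
  apply: (canRL (mulfK (lt0r_neq0 lam_gt0))).
  by apply: oppr_inj; rewrite ye mulNr mulrC.
have lamE : lam = k.+1%:R * (k.+1%:R + (2 * alpha + 1)) by rewrite /lam /jacobi_eigen addrA.
rewrite [jacobi_peak k.+1 _]/= -lamE !exprMn e1 mul1r exprVn.
have -> : h0 alpha * ((2 * alpha + 2) ^+ 2 * y^`().[e] ^+ 2 * (lam ^+ 2)^-1) =
  ((2 * alpha + 2) * h0 alpha) * (2 * alpha + 2) * y^`().[e] ^+ 2 * (lam ^+ 2)^-1 by ring.
rewrite -h0E.
have -> : (2 * alpha + 3) * h0 (alpha + 1) * (2 * alpha + 2) * y^`().[e] ^+ 2 * (lam ^+ 2)^-1 =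
  (2 * alpha + 3) * (2 * alpha + 2) * (h0 (alpha + 1) * y^`().[e] ^+ 2) * (lam ^+ 2)^-1 by ring.
rewrite IH (_ : 2 * (alpha + 1) + 1 = 2 * alpha + 1 + 2); last ring.
field; exact: lt0r_neq0.
Qed.

(** The recursion shifts b by 2: the factors (b + 1)(b + 2) extend the product at its lower end, and
    its top factor cancels against the denominator. *)
Lemma jacobi_peak_closed k b : 0 <= b ->
  jacobi_peak k.+1 b = (2 * k.+1%:R + b) / k.+1`!%:R * \prod_(j < k) (b + j.+1%:R).
Proof.
elim: k b => [|k IH] b b0.
  by rewrite /= big_ord0 (factS 0) fact0 muln1; field; apply: lt0r_neq0; lra.
have b2 : 0 <= b + 2 by lra.
have -> : jacobi_peak k.+2 b =
  (b + 2) * (b + 1) / (k.+2%:R * (k.+2%:R + b)) * jacobi_peak k.+1 (b + 2) by [].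
rewrite (IH _ b2) (factS k.+1) natrM.
have P : (b + 2) * (b + 1) * \prod_(j < k) (b + 2 + j.+1%:R) =
         (k.+2%:R + b) * \prod_(j < k.+1) (b + j.+1%:R).
  transitivity (\prod_(j < k.+2) (b + j.+1%:R)).
    rewrite 2!big_ord_recl /= mulrA [(b + 2) * _]mulrC; congr (_ * _).
    by apply: eq_bigr => j _; rewrite /bump /= !add1n; ring.
  by rewrite big_ord_recr /= mulrC addrC.
have f0 : k.+1`!%:R != 0 :> R by rewrite pnatr_eq0 -lt0n fact_gt0.
have k2 : k.+2%:R != 0 :> R by rewrite pnatr_eq0.
have kb : k.+2%:R + b != 0 by apply: lt0r_neq0; rewrite ltr_pwDl// ltr0n.
have E2 : k.+2%:R = 2 + k%:R :> R by ring.
transitivity ((2 * k.+1%:R + (b + 2)) / (k.+2%:R * (k.+2%:R + b) * k.+1`!%:R) *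
    ((b + 2) * (b + 1) * \prod_(j < k) (b + 2 + j.+1%:R))).
  by field; rewrite -E2 f0 kb k2.
rewrite P (_ : 2 * k.+1%:R + (b + 2) = 2 * k.+2%:R + b); last ring.
by field; rewrite -E2 f0 kb k2.
Qed.

Lemma jacobi_peak_gt0 k b : 0 <= b -> 0 < jacobi_peak k b.
Proof.
elim: k b => [|k IH] b b0; first exact: ltr01.
have b2 : 0 <= b + 2 by lra.
rewrite /= mulr_gt0 ?IH// divr_gt0 ?mulr_gt0 ?ltr0n//; try lra.
by rewrite ltr_pwDl// ltr0n.
Qed.

(** Combines ln (k + 2) - ln (k + 1) >= 1 / (k + 2) with 1 + x <= e^x. *)
Lemma powR_succ_ge k b : 0 <= b ->
  (1 + b / k.+2%:R) * k.+1%:R `^ b <= k.+2%:R `^ b.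
Proof.
move=> b0; have k1 : 0 < k.+1%:R :> R by rewrite ltr0n.
have k2 : 0 < k.+2%:R :> R by rewrite ltr0n.
rewrite /powR !gt_eqF//.
have lnk : 1 / k.+2%:R <= ln k.+2%:R - ln k.+1%:R :> R.
  have h : ln (1 + - k.+2%:R^-1) <= - k.+2%:R^-1 :> R.
    by apply: le_ln1Dx; rewrite ltrN2 invf_lt1// ltr1n.
  have E : 1 + - k.+2%:R^-1 = k.+1%:R / k.+2%:R :> R.
    by field; rewrite -natrD pnatr_eq0.
  by move: h; rewrite E ln_div ?posrE// div1r -[X in _ -> _ <= X]opprB lerNr.
apply: le_trans (_ : expR (b / k.+2%:R) * expR (b * ln k.+1%:R) <= _).
  by rewrite ler_wpM2r ?expR_ge0// expR_ge1Dx.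
rewrite -expRD ler_expR -lerBrDr -mulrBr ler_wpM2l//.
by rewrite -div1r.
Qed.

(** The left side is a quotient of Gamma functions of order k^b. In place of Stirling's formula, the
    factor 1 + b is absorbed by e^b and each later factor 1 + b / j by the growth of j^b. *)
Lemma prod_le_powR k b : 0 <= b ->
  \prod_(j < k.+1) (b + j.+1%:R) / k.+1`!%:R <= expR b * k.+1%:R `^ b.
Proof.
move=> b0; elim: k => [|k IH].
  by rewrite big_ord1 (factS 0) fact0 muln1 divr1 powR1 mulr1 addrC expR_ge1Dx.
rewrite big_ord_recr /= (factS k.+1) natrM invfM.
apply: le_trans (_ : (1 + b / k.+2%:R) * (expR b * k.+1%:R `^ b) <= _).
  have -> : forall p q f : R, p * q * ((k.+2%:R)^-1 * f) = (q / k.+2%:R) * (p * f).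
    by move=> p q f; ring.
  have -> : (b + k.+2%:R) / k.+2%:R = 1 + b / k.+2%:R.
    by rewrite mulrDl divff ?pnatr_eq0// addrC.
  by rewrite ler_wpM2l// addr_ge0// divr_ge0.
by rewrite mulrCA ler_wpM2l ?expR_ge0// powR_succ_ge.
Qed.

Lemma jacobi_peak_le k b : 0 <= b ->
  jacobi_peak k.+1 b <= 2 * (expR b * k.+1%:R `^ b).
Proof.
move=> b0; rewrite jacobi_peak_closed//.
apply: le_trans (_ : 2 * (\prod_(j < k.+1) (b + j.+1%:R) / k.+1`!%:R) <= _); last first.
  by rewrite ler_wpM2l// prod_le_powR.
rewrite big_ord_recr /= mulrAC mulrA ler_wpM2r ?invr_ge0//.
rewrite [X in _ <= _ * X]mulrC mulrA ler_wpM2r ?prodr_ge0//; last lra.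
by move=> j _; rewrite addr_ge0.
Qed.

(** Eliminating y through the equation, the derivative of g is (2 (2 alpha + 1) / lambda) x y'^2,
    whose sign is that of x because alpha >= -1/2. For alpha = -1/2 the function g is constant, as
    for Chebyshev polynomials. *)
Lemma jacobi_sup alpha k y x : - 2^-1 <= alpha -> jacobi_equation alpha k.+1 y ->
  -1 <= x -> x <= 1 -> y.[x] ^+ 2 <= Num.max (y.[1] ^+ 2) (y.[-1] ^+ 2).
Proof.
move=> al E x1 x2; set lam := jacobi_eigen alpha k.+1.
have lam_gt0 : 0 < lam by exact: jacobi_eigen_gt0.
pose g := y ^+ 2 + lam^-1 *: ((1 - 'X^2) * y^`() ^+ 2).
have gE z : g.[z] = y.[z] ^+ 2 + lam^-1 * ((1 - z ^+ 2) * y^`().[z] ^+ 2).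
  by rewrite !(hornerD, hornerN, hornerM, hornerZ, hornerC, horner_exp, hornerX).
have g'E z : g^`().[z] = lam^-1 * (2 * (2 * alpha + 1)) * (z * y^`().[z] ^+ 2).
  rewrite /g !expr2 derivD derivZ !derivM derivB derivC derivM derivX.
  rewrite !(hornerD, hornerN, hornerM, hornerZ, hornerC, hornerX).
  have := jacobi_equation_horner z E; rewrite -/lam.
  set a := y^`()^`().[z]; set b := y^`().[z]; set c := y.[z] => h.
  have -> : c = lam^-1 * ((2 * alpha + 2) * (z * b) - (1 - z ^+ 2) * a).
    by rewrite -opprB h mulNr opprK mulKf// lt0r_neq0.
  by field; exact: lt0r_neq0.
have cg : {within `[-1, 1], continuous (horner g)}.
  by apply: continuous_subspaceT; exact: continuous_horner.
have yg : y.[x] ^+ 2 <= g.[x].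
  by rewrite gE lerDl mulr_ge0 ?invr_ge0 ?(ltW lam_gt0)// mulr_ge0 ?sqr_ge0//; nra.
have g1 : g.[1] = y.[1] ^+ 2 by rewrite gE expr1n subrr mul0r mulr0 addr0.
have gN1 : g.[-1] = y.[-1] ^+ 2 by rewrite gE sqrrN expr1n subrr mul0r mulr0 addr0.
have coef_ge0 : 0 <= lam^-1 * (2 * (2 * alpha + 1)).
  by rewrite mulr_ge0 ?invr_ge0 ?(ltW lam_gt0)//; lra.
apply: le_trans yg _; rewrite le_max -g1 -gN1.
have MVTg a b : a <= b -> exists2 c, c \in `[a, b] & g.[b] - g.[a] = g^`().[c] * (b - a).
  move=> ab; apply: (@MVT_segment _ (horner g) (horner g^`())) => //.
  by apply: continuous_subspaceT; exact: continuous_horner.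
have [x0|/ltW x0] := leP 0 x.
  have [c] := MVTg _ _ x2; rewrite in_itv/= => /andP[c1 c2] gc.
  apply/orP; left; rewrite -subr_ge0 gc g'E; apply: mulr_ge0; last lra.
  by apply: mulr_ge0 => //; apply: mulr_ge0; [lra|exact: sqr_ge0].
have [c] := MVTg _ _ x1; rewrite in_itv/= => /andP[c1 c2] gc.
apply/orP; right; rewrite -subr_le0 gc g'E; apply: mulr_le0_ge0; last lra.
by apply: mulr_ge0_le0 => //; apply: mulr_le0_ge0; [lra|exact: sqr_ge0].
Qed.

Lemma h0_gt0 alpha : - 2^-1 <= alpha -> 0 < h0 alpha.
Proof.
(* On [-1/2, 1/2], an interval of length 1, the base 1 - x^2 lies between 3/4 and 1, so the weight
   is at least c. *)
move=> al; pose c : R := (3 / 4) `^ `|alpha|.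
have c_gt0 : 0 < c by apply: powR_gt0; lra.
apply: (lt_le_trans c_gt0); rewrite -lee_fin -(wint1 alpha) -(wintE _ al).
have mw (A : set (measurableTypeR R)) :
    measurable_fun A (fun x : R => ((1 : {poly R}).[x] * weight1 alpha x)%:E).
  apply/measurable_EFinP; apply: measurable_funM; first exact: measurable_poly.
  exact: measurable_weight1.
apply: (@le_trans _ _ (\int[@lebesgue_measure R]_(x in `[(- 2^-1)%R, 2^-1%R])
    ((1 : {poly R}).[x] * weight1 alpha x)%:E)%E); last first.
  apply: ge0_subset_integral => //.
  - by move=> x _; rewrite lee_fin hornerE mul1r weight1_ge0.
  - by apply: subset_itv; rewrite bnd_simp; lra.
apply: (@le_trans _ _ (\int[@lebesgue_measure R]_(x in `[(- 2^-1)%R, 2^-1%R]) c%:E)%E).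
  rewrite integral_cst//= lebesgue_measure_itv/= lte_fin ifT; last lra.
  rewrite -EFinB -EFinM lee_fin ler_peMr ?(ltW c_gt0)//; lra.
apply: ge0_le_integral => //=.
- by move=> x _; rewrite lee_fin (ltW c_gt0).
- move=> x; rewrite in_itv/= => /andP[x1 x2].
  rewrite lee_fin hornerE mul1r /weight1.
  apply: le_trans (_ : (1 - x ^+ 2) `^ `|alpha| <= _).
    by apply: ge0_ler_powR; rewrite ?nnegrE//; nra.
  by apply: ger_powR; [have h := sqr_ge0 x; apply/andP; split; nra|exact: ler_norm].
Qed.

(** Read off from the endpoint identity: a positive value at 1 forces a positive norm. *)
Lemma wint_jacobi_sq_gt0 alpha k : - 2^-1 <= alpha ->
  0 < wint alpha (jacobi alpha alpha k ^+ 2).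
Proof.
move=> al; have e1 := jacobi_endpoint al (expr1n _ 2) (jacobiP alpha k) (size_jacobi alpha k).
have r0 : 0 < jacobi_peak k (2 * alpha + 1) by apply: jacobi_peak_gt0; lra.
by rewrite -(pmulr_rgt0 _ r0) -e1 mulr_gt0 ?h0_gt0// exprn_gt0// jacobi1_gt0.
Qed.

Lemma njacobiE alpha k : njacobi alpha k =
  (Num.sqrt (wint alpha (jacobi alpha alpha k ^+ 2)))^-1 *: jacobi alpha alpha k.
Proof.
congr ((Num.sqrt _)^-1 *: _); apply: eq_Rintegral => x _.
by rewrite horner_exp.
Qed.

Lemma wint_njacobi alpha j k : - 2^-1 <= alpha ->
  wint alpha (njacobi alpha j * njacobi alpha k) = (j == k)%:R.
Proof.
move=> al; rewrite !njacobiE -scalerAl -scalerAr scalerA (wintZ _ _ al).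
have [->|jk] := eqVneq j k; last first.
  by rewrite (wint_jacobi_orthogonal al jk (jacobiP _ _) (jacobiP _ _)) mulr0.
rewrite -invfM -!expr2 sqr_sqrtr ?mulVf//.
  by rewrite lt0r_neq0// wint_jacobi_sq_gt0.
by rewrite ltW// wint_jacobi_sq_gt0.
Qed.

Lemma njacobi_sup alpha k x : - 2^-1 <= alpha -> -1 <= x -> x <= 1 ->
  h0 alpha * (njacobi alpha k.+1).[x] ^+ 2 <= jacobi_peak k.+1 (2 * alpha + 1).
Proof.
move=> al x1 x2.
have J0 := wint_jacobi_sq_gt0 k.+1 al.
have e1 := jacobi_endpoint al (expr1n _ 2) (jacobiP alpha k.+1) (size_jacobi alpha k.+1).
have sN1 : (-1) ^+ 2 = 1 :> R by rewrite sqrrN expr1n.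
have eN1 := jacobi_endpoint al sN1 (jacobiP alpha k.+1) (size_jacobi alpha k.+1).
rewrite njacobiE hornerZ exprMn exprVn sqr_sqrtr ?(ltW J0)// mulrCA mulrC ler_pdivrMr//.
have := jacobi_sup al (jacobiP alpha k.+1) x1 x2.
have hp := h0_gt0 al; rewrite -(ler_pM2l hp) => /le_trans; apply.
by rewrite maxr_pMr ?(ltW hp)// e1 eN1 maxxx.
Qed.

(** For alpha > -1/2, D^2 = pi^(3/2) e^(1/2) e^b N^b, so [jacobi_peak_le] reduces the claim to 4 <=
    pi^(3/2) e^(1/2). For alpha = -1/2 the bound 2 on the peak is exactly D^2 / 2. *)
Lemma Dconst_sqr_ge N alpha k : - 2^-1 <= alpha -> (k < N)%N ->
  jacobi_peak k.+1 (2 * alpha + 1) <= Dconst N alpha ^+ 2 / 2.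
Proof.
move=> al kN; set b := 2 * alpha + 1; have b0 : 0 <= b by rewrite /b; lra.
have N0 : 0 < N%:R :> R by rewrite ltr0n (leq_trans _ kN).
have k0 : 0 < k.+1%:R :> R by rewrite ltr0n.
apply: le_trans (jacobi_peak_le k b0) _.
rewrite /Dconst; case: ltP => [al1|al1]; last first.
  have -> : b = 0 by rewrite /b; lra.
  by rewrite expR0 powRr0; lra.
have Nb : k.+1%:R `^ b <= N%:R `^ b.
  by apply: ge0_ler_powR; rewrite ?nnegrE ?(ltW k0) ?(ltW N0) ?ler_nat.
rewrite !exprMn.
have -> : (N%:R `^ (alpha + 2^-1)) ^+ 2 = N%:R `^ b.
  by rewrite -powR_mulrn ?powR_ge0// -powRrM; congr (_ `^ _); rewrite /b; field.
have -> : expR (alpha + 3 / 4) ^+ 2 = expR b * expR 2^-1.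
  by rewrite -expRM_natr -expRD; congr expR; rewrite /b; field.
(* Squared, this is 16 <= pi^3 e, which follows from pi >= 2 and e >= 2. *)
have pi_e : 4 <= (pi `^ (3 / 4)) ^+ 2 * expR 2^-1 :> R.
  have p2 : 2 <= pi :> R by exact: pi_ge2.
  have pp : 0 <= (pi `^ (3 / 4)) ^+ 2 :> R by rewrite sqr_ge0.
  have e2 : 2 <= expR 1 :> R by have := expR_ge1Dx (1 : R); lra.
  have qq : expR 2^-1 ^+ 2 = expR 1 :> R.
    by rewrite -expRM_natr; congr expR; field.
  have ppE : ((pi `^ (3 / 4)) ^+ 2) ^+ 2 = pi ^+ 3 :> R.
    rewrite -exprM -powR_mulrn ?powR_ge0// -powRrM -powR_mulrn ?pi_ge0//.
    by congr (_ `^ _); field.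
  have p3 : 8 <= pi ^+ 3 :> R.
    have : 2 ^+ 3 <= pi ^+ 3 :> R by apply: lerXn2r; rewrite ?nnegrE ?pi_ge0.
    by apply: le_trans; rewrite -natrX.
  have : 4 ^+ 2 <= ((pi `^ (3 / 4)) ^+ 2 * expR 2^-1) ^+ 2 :> R.
    rewrite exprMn ppE qq (_ : 4 ^+ 2 = 8 * 2); last by rewrite -natrX -natrM.
    by apply: ler_pM.
  rewrite ler_sqr ?nnegrE; [by []|by rewrite ler0n|by rewrite mulr_ge0 ?expR_ge0].
have h1 : expR b * k.+1%:R `^ b <= expR b * N%:R `^ b by rewrite ler_wpM2l ?expR_ge0.
have h2 : 0 <= expR b * N%:R `^ b by rewrite mulr_ge0 ?expR_ge0 ?powR_ge0.
have h3 := ler_wpM2r h2 pi_e.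
lra.
Qed.

(** Degree 1, where the peak is 2 + b. It makes D^2 / 2 at least 1, so that its powers increase with
    the exponent. *)
Lemma Dconst_sqr_ge4 N alpha : (0 < N)%N -> - 2^-1 <= alpha -> 4 <= Dconst N alpha ^+ 2 :> R.
Proof.
move=> N0 al; have := Dconst_sqr_ge al N0; rewrite jacobi_peak_closed; last lra.
rewrite (factS 0) fact0 big_ord0 !muln1; lra.
Qed.

End JacobiNorm.

(** * The dimension of the polynomial space *)

Section Dimension.
Local Open Scope nat_scope.

Lemma sum_support_decr d N (u : {set 'I_d}) (k : {ffun 'I_d -> 'I_N.+1}) :
  (forall j, (j \in u) = (0 < k j)) ->
  (\sum_(i < #|u|) (k (enum_val i)).-1) + #|u| = \sum_j k j.
Proof.
move=> uk; rewrite -(big_enum_val (fun j => (k j).-1)) -[X in _ + X]sum1_card -big_split /=.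
rewrite [RHS](bigID (mem u))/= [X in _ = _ + X]big1 ?addn0; last first.
  by move=> j; rewrite uk lt0n negbK => /eqP.
by apply: eq_bigr => j; rewrite uk addn1 => /prednK.
Qed.

(** Lowering each positive entry by one maps these k injectively to |u|-tuples of naturals of sum at
    most N - |u|, of which there are ['C(N, #|u|)]. *)
Lemma card_support_le N d (u : {set 'I_d}) : #|u| <= N ->
  #|[set k : {ffun 'I_d -> 'I_N.+1} |
      [forall j, (j \in u) == (0 < k j)] && (\sum_j k j <= N)]%SET| <= 'C(N, #|u|).
Proof.
move=> uN; set A := [set _ | _]%SET.
have AP k : k \in A -> (forall j, (j \in u) = (0 < k j)) /\ \sum_j k j <= N.
  by rewrite inE => /andP[/forallP h ->]; split => // j; exact/eqP.
pose t (k : {ffun 'I_d -> 'I_N.+1}) : #|u|.-tuple 'I_(N - #|u|).+1 :=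
  [tuple inord (k (enum_val i)).-1 | i < #|u|].
have tE k i : k \in A -> tnth (t k) i = (k (enum_val i)).-1 :> nat.
  move=> /AP[uk kN]; rewrite tnth_mktuple inordK// ltnS leq_subRL//.
  rewrite addnC; apply: leq_trans kN; rewrite -(sum_support_decr uk) leq_add2r.
  by rewrite (bigD1 i)//= leq_addr.
have t_inj : {in A &, injective t}.
  move=> k l kA lA tkl; apply/ffunP => j; apply: val_inj => /=.
  have [uk _] := AP _ kA; have [ul _] := AP _ lA.
  have [ju|jnu] := boolP (j \in u); last first.
    have := jnu; rewrite uk lt0n negbK => /eqP ->.
    by have := jnu; rewrite ul lt0n negbK => /eqP ->.
  have : (k j).-1 = (l j).-1.
    have := congr1 (fun s => nat_of_ord (tnth s (enum_rank_in ju j))) tkl.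
    by rewrite /= !tE// enum_rankK_in.
  by move=> /(congr1 succn); rewrite !prednK// -?uk -?ul.
rewrite -(card_in_imset t_inj).
have -> : 'C(N, #|u|) = 'C(#|u| + (N - #|u|), #|u|) by rewrite subnKC.
rewrite -card_partial_ord_partitions; apply: subset_leq_card.
apply/fintype.subsetP => _ /imsetP[k kA ->]; rewrite inE.
have [uk kN] := AP _ kA.
rewrite big_tuple; under eq_bigr do rewrite tE//.
by rewrite leq_subRL// addnC (sum_support_decr uk).
Qed.

(** An upper bound serves the risk estimate, since both terms containing M increase with M. *)
Lemma card_basis_index_le N m d : m <= N -> #|basis_index N m d| <= Mdim N m d.
Proof.
move=> mN; rewrite /Mdim -sum1_card.
rewrite (eq_bigl (fun uk : mindex d N => (#|uk.1| <= m) &&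
  (uk.2 \in [set k : {ffun 'I_d -> 'I_N.+1} |
      [forall j, (j \in uk.1) == (0 < k j)] && (\sum_j k j <= N)]%SET))); last first.
  by move=> uk; rewrite !inE.
rewrite -(pair_big_dep (fun u : {set 'I_d} => #|u| <= m)
  (fun u k => k \in [set k : {ffun 'I_d -> 'I_N.+1} |
      [forall j, (j \in u) == (0 < k j)] && (\sum_j k j <= N)]%SET) (fun _ _ => 1)) /=.
apply: (@leq_trans (\sum_(u : {set 'I_d} | #|u| <= m) 'C(N, #|u|))).
  apply: leq_sum => u um; rewrite sum1_card.
  apply: leq_trans (card_support_le (leq_trans um mN)).
  by apply: eq_leq; apply: eq_card => k; rewrite !inE.
rewrite (partition_big (fun u : {set 'I_d} => inord #|u| : 'I_m.+1) predT) //=.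
apply: leq_sum => r _.
rewrite (eq_bigr (fun=> 'C(N, r))); last first.
  by move=> u /andP[um /eqP <-]; rewrite inordK.
rewrite sum_nat_const leq_mul2r; apply/orP; right.
rewrite -[X in 'C(X, _)]card_ord -card_draws; apply: subset_leq_card.
apply/fintype.subsetP => u; rewrite !inE => /andP[um /eqP <-].
by rewrite inordK.
Qed.

End Dimension.

(** * Integrals over products *)

Section ProductIntegral.
Context d1 d2 (T1 : measurableType d1) (T2 : measurableType d2) (R : realType).
Variables (m1 : {sigma_finite_measure set T1 -> \bar R}).
Variables (m2 : {sigma_finite_measure set T2 -> \bar R}).
Variables (a : T1 -> R) (b : T2 -> R).
Hypothesis ia : m1.-integrable setT (EFin \o a).
Hypothesis ib : m2.-integrable setT (EFin \o b).

Let ma : measurable_fun setT a.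
Proof. by apply/measurable_EFinP; exact: (measurable_int m1). Qed.

Let mb : measurable_fun setT b.
Proof. by apply/measurable_EFinP; exact: (measurable_int m2). Qed.

Let mab : measurable_fun setT (fun z : T1 * T2 => (a z.1 * b z.2)%:E).
Proof.
apply/measurable_EFinP; apply: measurable_funM.
  exact: (measurableT_comp ma).
exact: (measurableT_comp mb).
Qed.

Lemma integrable_prodM :
  (m1 \x m2)%E.-integrable setT (fun z => (a z.1 * b z.2)%:E).
Proof.
apply/integrable12ltyP => //.
under eq_integral => x _.
  under eq_integral => y _ do rewrite /= normrM EFinM.
  rewrite ge0_integralZl//; last by apply/measurable_EFinP; exact: measurableT_comp.
  over.
have /integrableP[_ iboo] := ib; have /integrableP[_ iaoo] := ia.
have bfin : (\int[m2]_x `|b x|%:E)%E \is a fin_num.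
  rewrite ge0_fin_numE; first exact: iboo.
  by apply: integral_ge0 => x _; rewrite lee_fin.
rewrite ge0_integralZr//; last 2 first.
- by apply/measurable_EFinP; exact: measurableT_comp.
- by apply: integral_ge0 => x _; rewrite lee_fin.
rewrite -(fineK bfin) muleC lte_mul_pinfty//.
by rewrite lee_fin fine_ge0// integral_ge0// => x _; rewrite lee_fin.
Qed.

Lemma integral_prodM : (\int[m1 \x m2]_z (a z.1 * b z.2)%:E =
  \int[m1]_x (a x)%:E * \int[m2]_y (b y)%:E)%E.
Proof.
rewrite -(integral12_prod_meas1 integrable_prodM) /fubini_F /=.
have bfin : (\int[m2]_x (b x)%:E)%E \is a fin_num by exact: integrable_fin_num.
under eq_integral => x _.
  under eq_integral => y _ do rewrite EFinM.
  rewrite integralZl// -(fineK bfin) muleC.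
  over.
by rewrite integralZl//= fineK// muleC.
Qed.

End ProductIntegral.

(** * Independence and product laws *)

Section Independence.
Context {d0 d1 d2} {Omega : measurableType d0} {T1 : measurableType d1}
  {T2 : measurableType d2} {R : realType} (P : probability Omega R).
Variables (U : Omega -> T1) (V : Omega -> T2).
Hypotheses (mU : measurable_fun setT U) (mV : measurable_fun setT V).
Hypothesis UV : independent_pair P U V.

(** The law of (U, V) agrees with the product of the two laws on rectangles, hence everywhere, and
    Fubini applies. *)
Lemma integral_independent (a : T1 -> R) (b : T2 -> R) :
  measurable_fun setT a -> measurable_fun setT b ->
  P.-integrable setT (EFin \o (a \o U)) -> P.-integrable setT (EFin \o (b \o V)) ->
  P.-integrable setT (fun w => (a (U w) * b (V w))%:E) /\
  (\int[P]_w (a (U w) * b (V w))%:E =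
   \int[P]_w (a (U w))%:E * \int[P]_w (b (V w))%:E)%E.
Proof.
move=> ma mb ia ib.
pose U' : {mfun Omega >-> T1} := MeasurableFun.Pack (MeasurableFun.Class (isMeasurableFun.Build _ _ _ _ _ mU)).
pose V' : {mfun Omega >-> T2} := MeasurableFun.Pack (MeasurableFun.Class (isMeasurableFun.Build _ _ _ _ _ mV)).
have mUV : measurable_fun setT (fun w => (U w, V w)) by exact: measurable_fun_pair.
pose UV' : {mfun Omega >-> (T1 * T2)%type} := MeasurableFun.Pack (MeasurableFun.Class (isMeasurableFun.Build _ _ _ _ _ mUV)).
have E : forall A, measurable A ->
    (distribution P U' \x distribution P V')%E A = distribution P UV' A.
  apply: product_measure_unique => A B mA mB.
  exact: (UV mA mB).
have mc : measurable_fun setT (fun z : T1 * T2 => (a z.1 * b z.2)%:E).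
  apply/measurable_EFinP; apply: measurable_funM.
    exact: (measurableT_comp ma).
  exact: (measurableT_comp mb).
have iaU : (distribution P U').-integrable setT (EFin \o a).
  apply: integrable_pushforward => //; exact/measurable_EFinP.
have ibV : (distribution P V').-integrable setT (EFin \o b).
  apply: integrable_pushforward => //; exact/measurable_EFinP.
have ic : (distribution P UV').-integrable setT (fun z : T1 * T2 => (a z.1 * b z.2)%:E).
  have /integrableP[_ h] := integrable_prodM iaU ibV.
  apply/integrableP; split => //; apply: le_lt_trans h.
  rewrite le_eqVlt; apply/orP; left; apply/eqP.
  by apply: eq_measure_integral => A mA _; exact/esym/E.
have icP : P.-integrable setT (fun w => (a (U w) * b (V w))%:E).
  have /integrableP[_ h] := ic; apply/integrableP; split.
    exact: (measurableT_comp mc mUV).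
  move: h; rewrite ge0_integral_distribution//.
  exact: measurableT_comp.
split=> //.
transitivity (\int[distribution P UV']_z (a z.1 * b z.2)%:E)%E.
  by rewrite integral_distribution.
transitivity (\int[distribution P U' \x distribution P V']_z (a z.1 * b z.2)%:E)%E.
  by apply: eq_measure_integral => A mA _; exact/esym/E.
rewrite (integral_prodM iaU ibV) !integral_distribution//.
  exact/measurable_EFinP.
exact/measurable_EFinP.
Qed.

End Independence.

(** * Integration against a density *)

Section Density.
Local Open Scope ereal_scope.
Context {d} {T : measurableType d} {R : realType}.
Variables (nu mu : {measure set T -> \bar R}) (rho : T -> R).
Hypotheses (rho0 : forall x, (0 <= rho x)%R) (mrho : measurable_fun setT rho).
Hypothesis nuE : forall A, measurable A -> nu A = \int[mu]_(x in A) (rho x)%:E.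
Import HBNNSimple.

Lemma ge0_integral_density (f : T -> \bar R) : (forall x, 0 <= f x) ->
  measurable_fun setT f -> \int[nu]_x f x = \int[mu]_x (f x * (rho x)%:E).
Proof.
move=> f0 mf; pose h := nnsfun_approx measurableT mf.
have mr : measurable_fun setT (EFin \o rho) by exact/measurable_EFinP.
have -> : \int[nu]_x f x = lim (\int[nu]_x (EFin \o h n) x @[n --> \oo]).
  have fE x : f x = lim ((EFin \o h n) x @[n --> \oo]).
    by apply/esym/cvg_lim => //; apply: cvg_nnsfun_approx.
  under eq_integral => x _ do rewrite fE.
  apply: monotone_convergence => //.
  - move=> n; apply/measurable_EFinP; exact/measurable_funP.
  - by move=> n x Ex //=; rewrite lee_fin.
  - by move=> x Ex a b ab; rewrite lee_fin; exact/lefP/nd_nnsfun_approx.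
have -> : \int[mu]_x (f x * (rho x)%:E) =
    lim (\int[mu]_x ((EFin \o h n) x * (rho x)%:E) @[n --> \oo]).
  have fE x : f x * (rho x)%:E = lim (((EFin \o h n) x * (rho x)%:E) @[n --> \oo]).
    apply/esym/cvg_lim => //; apply: cvgeZr => //.
    by apply: cvg_nnsfun_approx.
  under eq_integral => x _ do rewrite fE.
  apply: monotone_convergence => //.
  - move=> n; apply/emeasurable_funM => //; exact/measurable_EFinP.
  - by move=> n x Ex /=; rewrite mule_ge0 ?lee_fin.
  - move=> x Ex a b ab/=; rewrite lee_wpmul2r ?lee_fin//; exact/lefP/nd_nnsfun_approx.
suff suf n : \int[nu]_x (EFin \o h n) x = \int[mu]_x ((EFin \o h n) x * (rho x)%:E).
  by under eq_fun do rewrite suf.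
transitivity (\int[nu]_x
   (\sum_(y \in range (h n)) (y * \1_(h n @^-1` [set y]) x)%:E)).
  by apply: eq_integral => t tE; rewrite /= fimfunE -fsumEFin.
rewrite ge0_integral_fsum//; last 2 first.
- move=> r; apply/measurable_EFinP; exact: measurable_funM.
- by move=> m y Ey; exact: nnfun_muleindic_ge0.
transitivity (\int[mu]_x (\sum_(y \in range (h n))
    (y * \1_(h n @^-1` [set y]) x)%:E * (rho x)%:E)); last first.
  apply: eq_integral => x xE.
  rewrite -ge0_mule_fsuml => [|y]; last exact: nnfun_muleindic_ge0.
  by rewrite fsumEFin // -(fimfunE _ x).
rewrite ge0_integral_fsum//; last 2 first.
- move=> r; apply/emeasurable_funM => //; apply/measurable_EFinP; exact: measurable_funM.
- move=> m y Ey; apply: mule_ge0; first exact: nnfun_muleindic_ge0.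
  by rewrite lee_fin.
apply: eq_fsbigr => r /[!inE] -[x _ <-]{r}.
set A := h n @^-1` _; have mA : measurable A by exact: measurable_sfunP.
have r0 : 0 <= (h n x)%:E by rewrite lee_fin.
under eq_integral do rewrite EFinM.
rewrite ge0_integralZl//; last first.
  by apply/measurable_EFinP; exact: measurable_indic.
under [RHS]eq_integral do rewrite EFinM -muleA.
rewrite ge0_integralZl//; last 2 first.
- by apply/emeasurable_funM => //; apply/measurable_EFinP.
- by move=> y _; rewrite mule_ge0 ?lee_fin.
rewrite integral_indic// setIT nuE// integral_mkcond; congr (_ * _).
apply: eq_integral => y _; rewrite patchE indicE.
by case: ifPn => yA; rewrite ?mul1e ?mul0e.
Qed.

Lemma integral_density (f : T -> R) : measurable_fun setT f ->
  \int[nu]_x (f x)%:E = \int[mu]_x (f x * rho x)%:E.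
Proof.
move=> mf; have mf' : measurable_fun setT (EFin \o f) by exact/measurable_EFinP.
rewrite integralE [RHS]integralE; congr (_ - _).
  rewrite ge0_integral_density//; last exact: measurable_funepos.
  apply: eq_integral => x _; rewrite !funeposE EFinM /= ![_ * (rho x)%:E]muleC.
  by rewrite maxe_pMr ?mule0// lee_fin.
rewrite ge0_integral_density//; last exact: measurable_funeneg.
apply: eq_integral => x _; rewrite !funenegE /= -mulNr EFinM ![_ * (rho x)%:E]muleC.
by rewrite maxe_pMr ?mule0// lee_fin.
Qed.

End Density.

Section LebProduct.
Context {R : realType}.

(** Fubini one coordinate at a time, following the construction of [leb] by adjoining a head to a
    tuple. *)
Lemma integral_leb_prod d (g : 'I_d -> R -> R) :
  (forall i, (@lebesgue_measure R).-integrable setT (EFin \o g i)) ->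
  (leb d).-integrable setT (fun x : d.-tuple R => (\prod_i g i (tnth x i))%:E) /\
  (\int[leb d]_x (\prod_i g i (tnth x i))%:E =
   (\prod_i \int[@lebesgue_measure R]_x g i x)%:E)%E.
Proof.
elim: d g => [|d IH] g ig.
  have mF : measurable_fun setT (fun x : 0.-tuple R => (\prod_(i < 0) g i (tnth x i))%:E).
    rewrite (_ : (fun _ => _) = cst 1%E); first exact: measurable_cst.
    by apply/funext => x; rewrite big_ord0.
  split.
    apply/integrableP; split => //=; rewrite integral_dirac//=.
      by rewrite diracT mul1e ltry.
    exact: (measurableT_comp (f := abse) _ mF).
  by rewrite /= integral_dirac// !big_ord0 diracT mul1e.
have [ig' IHE] := IH (fun i => g (lift ord0 i)) (fun i => ig _).
have mF : measurable_fun setT (fun x : d.+1.-tuple R => (\prod_i g i (tnth x i))%:E).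
  apply/measurable_EFinP; apply: measurable_prod => i _.
  apply: (measurableT_comp (f := g i)); last exact: measurable_tnth.
  by apply/measurable_EFinP; apply: measurable_int (ig i).
have FE (z : measurableTypeR R * d.-tuple R) :
    \prod_i g i (tnth (tcons z) i) = g ord0 z.1 * \prod_i g (lift ord0 i) (tnth z.2 i).
  rewrite big_ord_recl; congr (_ * _).
  by apply: eq_bigr => i _; rewrite /tcons tnthS.
have ip := integrable_prodM (ig ord0) ig'.
have ip' : (product_measure1 (@lebesgue_measure R) (leb d)).-integrable (@tcons R d @^-1` setT)
    ((fun x : d.+1.-tuple R => (\prod_i g i (tnth x i))%:E) \o @tcons R d).
  rewrite preimage_setT; apply: eq_integrable ip => //.
  by move=> z _ /=; rewrite FE.
split.
  exact: (integrable_pushforward (@measurable_tcons R d) mF ip').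
transitivity (\int[product_measure1 (@lebesgue_measure R) (leb d)]_(z in @tcons R d @^-1` setT)
    ((fun x : d.+1.-tuple R => (\prod_i g i (tnth x i))%:E) \o @tcons R d) z)%E.
  exact: (integral_pushforward (@measurable_tcons R d) mF ip').
rewrite preimage_setT.
transitivity (\int[product_measure1 (@lebesgue_measure R) (leb d)]_z
    (g ord0 z.1 * \prod_i g (lift ord0 i) (tnth z.2 i))%:E)%E.
  by apply: eq_integral => z _ /=; rewrite FE.
rewrite (integral_prodM (ig ord0) ig') IHE big_ord_recl EFinM; congr (_ * _)%E.
by rewrite /Rintegral fineK//; apply: integrable_fin_num => //; exact: ig.
Qed.

End LebProduct.

(** * Bounded measurable functions and matrices *)

Section BoundedMeasurable.
Context {d} {T : measurableType d} {R : realType}.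
Implicit Types f g : T -> R.

(** The quantities in the trace argument are polynomial in bounded entries. This class is an algebra
    and is integrable for every probability, which settles integrability there once and for all. *)
Definition bounded_measurable f :=
  measurable_fun setT f /\ exists K, forall x, `|f x| <= K.

Lemma bm_cst c : bounded_measurable (cst c).
Proof. by split; [exact: measurable_cst|exists `|c|]. Qed.

Lemma bmD f g : bounded_measurable f -> bounded_measurable g ->
  bounded_measurable (fun x => f x + g x).
Proof.
move=> [mf [K fK]] [mg [L gL]]; split; first exact: measurable_funD.
by exists (K + L) => x; apply: le_trans (ler_normD _ _) _; exact: lerD.
Qed.

Lemma bmM f g : bounded_measurable f -> bounded_measurable g ->
  bounded_measurable (fun x => f x * g x).
Proof.
move=> [mf [K fK]] [mg [L gL]]; split; first exact: measurable_funM.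
by exists (K * L) => x; rewrite normrM ler_pM.
Qed.

Lemma bmZ c f : bounded_measurable f -> bounded_measurable (fun x => c * f x).
Proof. by apply: bmM; exact: bm_cst. Qed.

Lemma bmB f g : bounded_measurable f -> bounded_measurable g ->
  bounded_measurable (fun x => f x - g x).
Proof.
move=> bf bg; apply: (bmD bf).
by rewrite (_ : (fun _ => _) = fun x => (-1) * g x); [exact: bmZ|apply/funext => x; rewrite mulN1r].
Qed.

Lemma bm_sum I (r : seq I) (p : pred I) (F : I -> T -> R) :
  (forall i, p i -> bounded_measurable (F i)) ->
  bounded_measurable (fun x => \sum_(i <- r | p i) F i x).
Proof.
move=> bF; elim: r => [|i r IH].
  rewrite (_ : (fun _ => _) = cst 0); first exact: bm_cst.
  by apply/funext => x; rewrite big_nil.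
have [pi|pi] := boolP (p i).
  rewrite (_ : (fun _ => _) = fun x => F i x + \sum_(i <- r | p i) F i x).
    by apply: bmD => //; exact: bF.
  by apply/funext => x; rewrite big_cons pi.
rewrite (_ : (fun _ => _) = fun x => \sum_(i <- r | p i) F i x)//.
by apply/funext => x; rewrite big_cons (negbTE pi).
Qed.

Lemma bm_comp d' (T' : measurableType d') (U : T' -> T) f :
  measurable_fun setT U -> bounded_measurable f ->
  measurable_fun setT (f \o U) /\ exists K, forall x, `|(f \o U) x| <= K.
Proof.
move=> mU [mf [K fK]]; split; first exact: measurableT_comp.
by exists K => x; exact: fK.
Qed.

Definition mx_bounded_measurable m n (A : T -> 'M[R]_(m, n)) :=
  forall i j, bounded_measurable (fun x => A x i j).

Lemma mxbmM m n p (A : T -> 'M[R]_(m, n)) (B : T -> 'M[R]_(n, p)) :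
  mx_bounded_measurable A -> mx_bounded_measurable B ->
  mx_bounded_measurable (fun x => A x *m B x).
Proof.
move=> bA bB i j.
rewrite (_ : (fun _ => _) = fun x => \sum_k A x i k * B x k j).
  by apply: bm_sum => k _; exact: bmM.
by apply/funext => x; rewrite mxE.
Qed.

Lemma mxbmX n (A : T -> 'M[R]_n) k : mx_bounded_measurable A ->
  mx_bounded_measurable (fun x => A x ^+ k).
Proof.
move=> bA; elim: k => [|k IH].
  by move=> i j; under eq_fun do rewrite expr0; exact: bm_cst.
under eq_fun do rewrite exprS.
exact: (mxbmM bA IH).
Qed.

Lemma bm_mxtrace n (A : T -> 'M[R]_n) : mx_bounded_measurable A ->
  bounded_measurable (fun x => \tr (A x)).
Proof. by move=> bA; apply: bm_sum => i _; exact: bA. Qed.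

Lemma bm_bform n (A : T -> 'M[R]_n) (u v : T -> 'cV[R]_n) :
  mx_bounded_measurable A -> mx_bounded_measurable u -> mx_bounded_measurable v ->
  bounded_measurable (fun x => bform (A x) (u x) (v x)).
Proof.
move=> bA bu bv; apply: (mxbmM (A := fun x => (u x)^T *m A x) _ bv).
apply: mxbmM => // i j; under eq_fun do rewrite mxE.
exact: bu.
Qed.

Variable P : probability T R.

Lemma bm_integrable f : bounded_measurable f -> P.-integrable setT (EFin \o f).
Proof.
move=> [mf [K fK]]; apply: measurable_bounded_integrable => //.
  by rewrite -ge0_fin_numE ?fin_num_measure.
by exists K; split; [exact: num_real|] => y Ky x _; apply: le_trans (fK x) (ltW Ky).
Qed.

End BoundedMeasurable.

Section MeanValue.
Context {d} {T : measurableType d} {R : realType} (P : probability T R).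
Implicit Types f g : T -> R.

Definition mean f : R := \int[P]_x f x.

Lemma meanE f : P.-integrable setT (EFin \o f) -> (\int[P]_x (f x)%:E = (mean f)%:E)%E.
Proof. by move=> fi; rewrite /mean /Rintegral fineK//; exact: integrable_fin_num. Qed.

Lemma meanD f g : bounded_measurable f -> bounded_measurable g ->
  mean (fun x => f x + g x) = mean f + mean g.
Proof. by move=> bf bg; rewrite /mean RintegralD//; exact: bm_integrable. Qed.

Lemma meanZ c f : bounded_measurable f -> mean (fun x => c * f x) = c * mean f.
Proof. by move=> bf; rewrite /mean RintegralZl//; exact: bm_integrable. Qed.

Lemma mean_cst c : mean (cst c) = c.
Proof.
have := expectation_cst P c; rewrite unlock => h.
by rewrite /mean /Rintegral h.
Qed.

Lemma mean_sum I (r : seq I) (F : I -> T -> R) :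
  (forall i, bounded_measurable (F i)) ->
  mean (fun x => \sum_(i <- r) F i x) = \sum_(i <- r) mean (F i).
Proof.
move=> bF; elim: r => [|i r IH].
  rewrite big_nil (_ : (fun _ => _) = cst 0) ?mean_cst//.
  by apply/funext => x; rewrite big_nil.
rewrite big_cons -IH -meanD//; last by apply: bm_sum => j _; exact: bF.
by congr mean; apply/funext => x; rewrite big_cons.
Qed.

Lemma le_mean f g : bounded_measurable f -> bounded_measurable g ->
  (forall x, f x <= g x) -> mean f <= mean g.
Proof. by move=> bf bg fg; apply: le_Rintegral => //; exact: bm_integrable. Qed.

Lemma mean_independent d1 d2 (T1 : measurableType d1) (T2 : measurableType d2)
    (U : T -> T1) (W : T -> T2) (a : T1 -> R) (b : T2 -> R) :
  measurable_fun setT U -> measurable_fun setT W -> independent_pair P U W ->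
  bounded_measurable a -> bounded_measurable b ->
  mean (fun w => a (U w) * b (W w)) = mean (a \o U) * mean (b \o W).
Proof.
move=> mU mW UW ba bb.
have ia := bm_integrable P (bm_comp mU ba); have ib := bm_integrable P (bm_comp mW bb).
have [_ h] := integral_independent mU mW UW ba.1 bb.1 ia ib.
rewrite /mean /Rintegral h fineM//; by apply: integrable_fin_num.
Qed.

End MeanValue.

(** * Independence of an observation from the earlier ones *)

Section Past.
Context {d0 d} {Omega : measurableType d0} {T : measurableType d} {R : realType}
  (P : probability Omega R) (n : nat).

Definition tuple_box (A : 'I_n -> set T) : set (n.-tuple T) :=
  [set t | forall i, A i (tnth t i)].

Definition tuple_boxes : set (set (n.-tuple T)) :=
  [set B | exists2 A, (forall i, measurable (A i)) & B = tuple_box A].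

Lemma measurable_tuple_box A : (forall i, measurable (A i)) -> measurable (tuple_box A).
Proof.
move=> mA; rewrite (_ : tuple_box A = \bigcap_(i in [set: 'I_n]) ((fun t => tnth t i) @^-1` A i)).
  apply: fin_bigcap_measurable; first exact: finite_finset.
  by move=> i _; rewrite -[X in measurable X]setTI; exact: measurable_tnth.
by apply/seteqP; split => [t tA i _|t tA i]; [exact: tA|exact: (tA i I)].
Qed.

Lemma measurable_tuple_boxes : measurable = <<s tuple_boxes >>.
Proof.
apply/seteqP; split.
  apply: smallest_sub; first exact: smallest_sigma_algebra.
  move=> B; rewrite -bigcup_seq => -[i _ [A mA <-]].
  apply: sub_sigma_algebra; exists (fun j => if j == i then A else setT).
    by move=> j; case: ifP.
  rewrite setTI; apply/seteqP; split => [t tA j|t tA].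
    by case: eqP => // ->.
  by have := tA i; rewrite eqxx.
apply: smallest_sub; first exact: sigma_algebra_measurable.
by move=> _ [A mA ->]; exact: measurable_tuple_box.
Qed.

Lemma tuple_boxes_setI : setI_closed tuple_boxes.
Proof.
move=> _ _ [A mA ->] [B mB ->]; exists (fun i => A i `&` B i).
  by move=> i; exact: measurableI.
apply/seteqP; split => [t [tA tB] i|t tAB]; first by split; [exact: tA|exact: tB].
by split => i; have [] := tAB i.
Qed.

Variable X : 'I_n -> Omega -> T.
Hypothesis mX : forall i, measurable_fun setT (X i).
Hypothesis X_indep : mutually_independent P X.

(** Slots from k on hold a fixed value, so that the pasts for all k live in the same tuple space. *)
Definition past (k : nat) (w : Omega) : n.-tuple T :=
  [tuple if (i < k)%N then X i w else point | i < n].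

Lemma measurable_past k : measurable_fun setT (past k).
Proof.
apply/measurable_fun_tnthP => i.
rewrite (_ : _ \o _ = if (i < k)%N then X i else cst point); first by case: ifP.
by apply/funext => w /=; rewrite tnth_mktuple; case: ifP.
Qed.

Let past_box (k : 'I_n) (A : 'I_n -> set T) : (forall i, measurable (A i)) ->
  forall B, measurable B ->
  P (past k @^-1` tuple_box A `&` X k @^-1` B) =
  (P (past k @^-1` tuple_box A) * P (X k @^-1` B))%E.
Proof.
move=> mA B mB.
(* If some [A i] with i >= k misses [point], the event is empty. Otherwise these coordinates impose
   nothing, and mutual independence applies to the indices below k together with k. *)
have [Ap|nAp] := pselect (forall i : 'I_n, (k <= i)%N -> A i point); last first.
  have -> : past k @^-1` tuple_box A = set0.
    apply/seteqP; split => // w wA; apply: nAp => i ki.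
    by have := wA i; rewrite tnth_mktuple ltnNge ki.
  by rewrite set0I measure0 mul0e.
pose J : {set 'I_n} := [set i : 'I_n | (i < k)%N]%SET.
have kJ : k \notin J by rewrite inE ltnn.
have E1 : past k @^-1` tuple_box A = \bigcap_(i in [set i | i \in J]) (X i @^-1` A i).
  apply/seteqP; split => [w wA i /=|w wA i /=].
    by rewrite inE => ik; have := wA i; rewrite tnth_mktuple ik.
  rewrite tnth_mktuple; case: ltnP => ik; last exact: Ap.
  by apply: wA; rewrite /= inE.
pose A' i := if i == k then B else A i.
have E2 : past k @^-1` tuple_box A `&` X k @^-1` B =
    \bigcap_(i in [set i | i \in (k |: J)%SET]) (X i @^-1` A' i).
  rewrite E1; apply/seteqP; split => [w [wA wB] i /=|w wA].
    rewrite in_setU1 /A' => /orP[/eqP ->|iJ]; first by rewrite eqxx.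
    by case: eqP => [->//|_]; exact: wA.
  split => [i /= iJ|].
    have := wA i; rewrite /= in_setU1 iJ orbT /A' => /(_ isT).
    by case: eqP => // ik; move: kJ; rewrite -ik iJ.
  by have := wA k; rewrite /= in_setU1 eqxx /A' eqxx => /(_ isT).
rewrite E2 X_indep; last by move=> i; rewrite /A'; case: ifP.
rewrite big_setU1//= E1 X_indep// muleC /A' eqxx; congr (_ * _)%E.
apply: eq_bigr => i iJ; case: eqP => // ik.
by move: kJ; rewrite -ik iJ.
Qed.

(** For fixed B both sides are finite measures in A; they agree on boxes, a generating family closed
    under intersection. *)
Lemma past_independent (k : 'I_n) : independent_pair P (past k) (X k).
Proof.
move=> A B mA mB.
have mXB : measurable (X k @^-1` B).
  by rewrite -[X in measurable X]setTI; exact: mX.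
have mJ := measurable_past k.
pose m1 : measure (n.-tuple T) R :=
  pushforward (mrestr P mXB) (past k).
have XBfin : P (X k @^-1` B) \is a fin_num by exact: fin_num_measure.
have XBge0 : 0 <= fine (P (X k @^-1` B)) by rewrite fine_ge0.
pose m2 : measure (n.-tuple T) R :=
  mscale (NngNum XBge0) (pushforward P (past k)).
suff : m1 mJ A = m2 mJ A.
  move=> h; rewrite -[LHS]/(m1 mJ A) h.
  by rewrite -[LHS]/((fine (P (X k @^-1` B)))%:E * P (past k @^-1` A))%E fineK// muleC.
apply: (measure_unique tuple_boxes (fun=> setT)) => //.
- exact: measurable_tuple_boxes.
- exact: tuple_boxes_setI.
- move=> _; exists (fun=> setT) => //.
  by apply/seteqP; split.
- by apply/seteqP; split => // t _; exists 0%N.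
- move=> _ [C mC ->].
  rewrite -[RHS]/((fine (P (X k @^-1` B)))%:E * P (past k @^-1` tuple_box C))%E.
  by rewrite fineK// muleC -past_box.
- move=> _; rewrite -[X in (X < _)%E]/(P (past k @^-1` setT `&` X k @^-1` B)).
  rewrite preimage_setT setTI.
  by rewrite -ge0_fin_numE// fin_num_measure.
Qed.

End Past.

(** * The residual matrix *)

Section TraceMoment.
Context {d0 d} {Omega : measurableType d0} {T : measurableType d} {R : realType}
  (P : probability Omega R) (n M : nat).
Variable X : 'I_n -> Omega -> T.
Hypothesis n_gt0 : (0 < n)%N.
Hypothesis mX : forall i, measurable_fun setT (X i).
Hypothesis X_indep : mutually_independent P X.
Variables (V : T -> 'cV[R]_M) (ell s : R).
Hypothesis bV : mx_bounded_measurable V.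
Hypothesis V_le : forall x, \sum_i V x i 0 ^+ 2 <= ell.
Hypothesis V_mean : forall k i j,
  mean P (fun w => V (X k w) i 0 * V (X k w) j 0) = (i == j)%:R / n%:R.
Hypotheses (s_ge0 : 0 <= s) (s_lt : s * (n%:R * ell) < 1).

Definition resid (Z : 'I_n -> T) k : 'M[R]_M :=
  1 - s *: \sum_(i < n | (i < k)%N) (V (Z i) *m (V (Z i))^T).

Let H k w := resid (fun i => X i w) k.

Lemma residS Z (k : 'I_n) :
  resid Z k.+1 = resid Z k - s *: (V (Z k) *m (V (Z k))^T).
Proof.
rewrite /resid (bigD1 k)//=.
rewrite (eq_bigl (fun i : 'I_n => (i < k)%N)); last first.
  by move=> i; rewrite ltnS andbC ltn_neqAle.
by rewrite scalerDr opprD addrA addrAC.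
Qed.

Lemma bform_resid Z k u :
  bform (resid Z k) u u = bform 1 u u -
    s * \sum_(i < n | (i < k)%N) bform 1 (V (Z i)) u ^+ 2.
Proof.
rewrite /resid bformBm bformZm; congr (_ - s * _).
rewrite /bform mulmx_sumr mulmx_suml summxE; apply: eq_bigr => i _.
have := bform_outer (1 : 'M[R]_M) 1 u (V (Z i)) (V (Z i)) u.
rewrite /bform mulmx1 mul1mx => ->.
by rewrite -[X in X * _]/(bform 1 u (V (Z i))) -[X in _ * X]/(bform 1 (V (Z i)) u) bform_sym ?trmx1.
Qed.

Lemma trmx_resid Z k : (resid Z k)^T = resid Z k.
Proof.
rewrite /resid linearB linearZ /= trmx1 raddf_sum; congr (_ - _ *: _).
by apply: eq_bigr => i _; rewrite /= trmx_mul trmxK.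
Qed.

Lemma bform1E u : bform (1 : 'M[R]_M) u u = \sum_i u i 0 ^+ 2.
Proof. by rewrite -(moment0 1) /moment expr0. Qed.

Let bform1_ge0 (u : 'cV[R]_M) : 0 <= bform 1 u u.
Proof. by rewrite bform1E sumr_ge0// => i _; exact: sqr_ge0. Qed.

Lemma bform_resid_le Z k u : bform (resid Z k) u u <= bform 1 u u.
Proof.
rewrite bform_resid gerBl mulr_ge0// sumr_ge0// => i _; exact: sqr_ge0.
Qed.

(** Cauchy-Schwarz with |V|^2 <= ell in each of at most n terms. Under [s_lt] it keeps every
    residual positive definite, with a lower spectral bound uniform in the step. *)
Lemma bform_resid_ge Z k u :
  (1 - s * (n%:R * ell)) * bform 1 u u <= bform (resid Z k) u u.
Proof.
rewrite bform_resid mulrBl mul1r lerB// -mulrA ler_wpM2l//.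
apply: le_trans (_ : \sum_(i < n) ell * bform 1 u u <= _); last first.
  by rewrite sumr_const card_ord -mulrA mulr_natl.
rewrite [leRHS](bigID (fun i : 'I_n => (i < k)%N))/= ler_wpDr//.
  apply: sumr_ge0 => i _; rewrite mulr_ge0//.
  by apply: le_trans (V_le (Z i)); rewrite -bform1E.
apply: ler_sum => i _; apply: le_trans (bform_cauchy_schwarz _ _ (psd1 _ _)) _.
by rewrite ler_wpM2r// bform1E.
Qed.

Lemma psd_resid Z k : psd (resid Z k).
Proof.
split; first exact: trmx_resid.
move=> u; apply: le_trans (bform_resid_ge Z k u).
by rewrite mulr_ge0// subr_ge0 ltW.
Qed.

Let residE k w : H k w = resid (fun i => tnth (past X k w) i) k.
Proof.
rewrite /H /resid; congr (_ - _ *: _); apply: eq_bigr => i ik.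
by rewrite tnth_mktuple ik.
Qed.

Let bV_comp d' (T' : measurableType d') (f : T' -> T) : measurable_fun setT f ->
  mx_bounded_measurable (fun x => V (f x)).
Proof. by move=> mf i j; exact: (bm_comp mf (bV i j)). Qed.

Lemma mxbm_resid d' (T' : measurableType d') (Z : 'I_n -> T' -> T) k :
  (forall i, measurable_fun setT (Z i)) ->
  mx_bounded_measurable (fun x => resid (fun i => Z i x) k).
Proof.
move=> mZ i j; rewrite /resid; under eq_fun do rewrite !mxE summxE.
apply: bmB; first exact: bm_cst.
apply: bmZ; apply: bm_sum => l _; apply: mxbmM; first exact: bV_comp.
by move=> a b; under eq_fun do rewrite mxE; exact: (bV_comp (mZ l)).
Qed.

Let bH k : mx_bounded_measurable (H k).
Proof. exact: mxbm_resid. Qed.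

(** The moment is linear in V V^T, which is independent of H_k and has mean 1/n, so the double sum
    over entries collapses to a trace. *)
Lemma mean_past_moment (k : 'I_n) j :
  mean P (fun w => moment (H k w) (V (X k w)) j) =
  n%:R^-1 * mean P (fun w => \tr (H k w ^+ j)).
Proof.
have bHj := mxbmX j (bH k).
have bvv a b : bounded_measurable (fun w => V (X k w) a 0 * V (X k w) b 0).
  by apply: bmM; exact: (bV_comp (mX k)).
have E w : moment (H k w) (V (X k w)) j =
    \sum_a \sum_b (H k w ^+ j) a b * (V (X k w) a 0 * V (X k w) b 0).
  rewrite /moment /bform -mulmxA mxE; apply: eq_bigr => a _.
  by rewrite !mxE mulr_sumr; apply: eq_bigr => b _; ring.
have -> : (fun w => moment (H k w) (V (X k w)) j) = _ := funext E.
have bterm a b : bounded_measurable (fun w => (H k w ^+ j) a b * (V (X k w) a 0 * V (X k w) b 0)).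
  by apply: bmM => //; exact: bHj.
rewrite mean_sum; last by move=> a; apply: bm_sum => b _; exact: bterm.
rewrite /mxtrace mean_sum; last by move=> a; exact: bHj.
rewrite mulr_sumr; apply: eq_bigr => a _.
rewrite mean_sum//.
have mean_prod b : mean P (fun w => (H k w ^+ j) a b * (V (X k w) a 0 * V (X k w) b 0)) =
    mean P (fun w => (H k w ^+ j) a b) * ((a == b)%:R / n%:R).
  rewrite -(V_mean k).
  have mt i : measurable_fun setT (fun t : n.-tuple T => tnth t i) by exact: measurable_tnth.
  have bt := mxbmX j (mxbm_resid k mt).
  have bvv' : bounded_measurable (fun x : T => V x a 0 * V x b 0) by apply: bmM; exact: bV.
  have E1 : (fun w => (H k w ^+ j) a b) =
      (fun t : n.-tuple T => (resid (fun i => tnth t i) k ^+ j) a b) \o past X k.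
    by apply/funext => w; rewrite residE.
  rewrite E1 -(mean_independent (measurable_past mX k) (mX k)
    (past_independent mX X_indep k) (bt a b) bvv').
  by apply: (congr1 (mean P)); apply/funext => w; rewrite residE.
under eq_bigr do rewrite mean_prod.
rewrite (bigD1 a)//= big1 ?addr0; last first.
  by move=> b; rewrite eq_sym => /negbTE ->; rewrite mul0r mulr0.
by rewrite eqxx mul1r mulrC.
Qed.

Let c := 1 - s * (n%:R * ell).
Let theta p := s * p.+2%:R.

(** The rank one bound involves traces with exponents p + 2, p + 1 and p; to close the recursion all
    are compared with the first. H <= 1 gives tr H^(p+1) >= tr H^(p+2), and H >= c gives tr H^p <=
    tr H^(p+2) / c^2. The factor c^(-2) is the price of a finite power. *)
Lemma mean_mxtrace_step (k : 'I_n) p :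
  mean P (fun w => \tr (H k.+1 w ^+ p.+2)) <=
  (1 + (- theta p + theta p ^+ 2 * ell / (2 * c ^+ 2)) / n%:R) *
  mean P (fun w => \tr (H k w ^+ p.+2)).
Proof.
set th := theta p.
have c_gt0 : 0 < c by rewrite subr_gt0.
have ell_ge0 : 0 <= ell.
  by apply: le_trans (V_le point); rewrite sumr_ge0// => i _; exact: sqr_ge0.
have n0 : 0 < n%:R :> R by rewrite ltr0n.
have btr j i : bounded_measurable (fun w => \tr (H j w ^+ i)).
  by apply: bm_mxtrace; exact: mxbmX.
have bmom j i : bounded_measurable (fun w => moment (H j w) (V (X k w)) i).
  by apply: bm_bform; [exact: mxbmX|exact: bV_comp|exact: bV_comp].
have pw w : \tr (H k.+1 w ^+ p.+2) <= \tr (H k w ^+ p.+2) +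
    (- th) * moment (H k w) (V (X k w)) p.+1 +
    (th ^+ 2 * ell / 2) * moment (H k w) (V (X k w)) p.
  have -> : H k.+1 w = H k w - s *: (V (X k w) *m (V (X k w))^T) by exact: residS.
  have psdK : psd (H k w - s *: (V (X k w) *m (V (X k w))^T)).
    by rewrite -residS; exact: psd_resid.
  apply: le_trans (mxtrace_expr_rank1_le s_ge0 (psd_resid _ _) psdK p) _.
  rewrite mulNr -/(theta p) -/th -exprMn -/(theta p) -/th lerD2l.
  rewrite (_ : th ^+ 2 * ell / 2 * _ = th ^+ 2 / 2 * (ell * moment (H k w) (V (X k w)) p)); last ring.
  rewrite ler_wpM2l ?divr_ge0 ?sqr_ge0//.
  by rewrite ler_wpM2r ?moment_ge0 ?moment0//; exact: psd_resid.
apply: le_trans (le_mean P _ _ pw) _ => //.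
  by apply: bmD; [apply: bmD => //; exact: bmZ|exact: bmZ].
rewrite meanD; [|by apply: bmD => //; exact: bmZ|exact: bmZ].
rewrite meanD//; last exact: bmZ.
rewrite !meanZ// !mean_past_moment.
set t2 := mean P _; set t1 := mean P _; set t0 := mean P _.
have t21 : t2 <= t1.
  apply: le_mean => // w; apply: mxtrace_expr_decr; first exact: psd_resid.
  by move=> u; rewrite /moment expr1 expr0; exact: bform_resid_le.
have t12 : c ^+ 2 * t0 <= t2.
  rewrite -meanZ//; apply: le_mean => //; first exact: bmZ.
  move=> w.
  have inc i : c * \tr (H k w ^+ i) <= \tr (H k w ^+ i.+1).
    apply: mxtrace_expr_incr; first exact: psd_resid.
    by move=> u; rewrite /moment expr1 expr0; exact: bform_resid_ge.
  apply: le_trans (inc p.+1); rewrite expr2 -mulrA ler_wpM2l//; exact: ltW.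
have th0 : 0 <= th by rewrite mulr_ge0.
have h0 : t0 <= t2 / c ^+ 2 by rewrite ler_pdivlMr ?exprn_gt0// mulrC.
have h1 : th / n%:R * t2 <= th / n%:R * t1.
  by rewrite ler_wpM2l// divr_ge0// ltW.
have h2 : th ^+ 2 * ell / 2 / n%:R * t0 <= th ^+ 2 * ell / 2 / n%:R * (t2 / c ^+ 2).
  by rewrite ler_wpM2l// !divr_ge0 ?mulr_ge0 ?sqr_ge0// ltW.
have -> : (1 + (- th + th ^+ 2 * ell / (2 * c ^+ 2)) / n%:R) * t2 =
    t2 - th / n%:R * t2 + th ^+ 2 * ell / 2 / n%:R * (t2 / c ^+ 2).
  by field; rewrite !lt0r_neq0.
lra.
Qed.

(** There are n factors 1 + y / n, each at most e^(y / n), starting from the trace M of the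
    identity. *)
Lemma mean_mxtrace_le p :
  mean P (fun w => \tr (H n w ^+ p.+2)) <=
  M%:R * expR (- theta p + theta p ^+ 2 * ell / (2 * c ^+ 2)).
Proof.
set y := - theta p + _.
have n0 : n%:R != 0 :> R by rewrite pnatr_eq0 -lt0n.
have key k : (k <= n)%N -> mean P (fun w => \tr (H k w ^+ p.+2)) <=
    M%:R * expR (y / n%:R) ^+ k.
  elim: k => [_|k IH kn].
    rewrite expr0 mulr1 (_ : (fun _ => _) = cst M%:R) ?mean_cst//.
    apply/funext => w; rewrite /H /resid big1; last by move=> i.
    by rewrite scaler0 subr0 expr1n mxtrace1.
  apply: le_trans (mean_mxtrace_step (Ordinal kn) p) _.
  rewrite -/y exprS mulrCA.
  have t_ge0 : 0 <= mean P (fun w => \tr (H k w ^+ p.+2)).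
    rewrite -(mean_cst P 0); apply: le_mean; first exact: bm_cst.
      by apply: bm_mxtrace; exact: mxbmX.
    by move=> w; apply: mxtrace_expr_ge0; exact: psd_resid.
  apply: le_trans (_ : expR (y / n%:R) * mean P (fun w => \tr (H k w ^+ p.+2)) <= _).
    by rewrite ler_wpM2r// expR_ge1Dx.
  by rewrite ler_wpM2l ?expR_ge0// IH// ltnW.
apply: le_trans (key n (leqnn n)) _.
by rewrite -expRM_natr mulfVK.
Qed.

End TraceMoment.

(** * Integration over the cube *)

Section CubeIntegral.
Context {R : realType} (d : nat) (alpha : R).
Hypothesis al : - 2^-1 <= alpha.
Local Notation T := (d.-tuple R).
Local Notation cube := (@cube R d).
Local Notation weight := (@weight R d alpha).

Lemma measurable_cube : measurable (cube : set T).
Proof.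
rewrite (_ : cube = tuple_box (fun=> `[-1, 1]%classic : set (measurableTypeR R))); last first.
  by apply/seteqP; split => x xc i; have := xc i.
by apply: measurable_tuple_box => i; exact: measurable_itv.
Qed.

Lemma weight_ge0 (x : T) : 0 <= weight x.
Proof. by apply: prodr_ge0 => i _; exact: weight1_ge0. Qed.

Lemma measurable_coord (g : R -> R) (i : 'I_d) : measurable_fun setT g ->
  measurable_fun setT (fun x : T => g (tnth x i)).
Proof. by move=> mg; apply: (measurableT_comp mg); exact: measurable_tnth. Qed.

Lemma measurable_weight A : measurable_fun A (weight : T -> R).
Proof.
apply/measurable_funTS; apply: measurable_prod => i _.
by apply: measurable_coord; exact: measurable_weight1.
Qed.

Lemma integral_cube_prod (q : 'I_d -> {poly R}) :
  (leb d).-integrable cube (fun x : T => (\prod_i (q i).[tnth x i] * weight x)%:E) /\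
  (\int[leb d]_(x in cube) (\prod_i (q i).[tnth x i] * weight x)%:E =
   (\prod_i wint alpha (q i))%:E)%E.
Proof.
pose g i := (fun x : R => (q i).[x] * weight1 alpha x) \_ `[-1, 1].
have ig i : (@lebesgue_measure R).-integrable setT (EFin \o g i).
  have := integrable_polyw (q i) al.
  have mI : measurable (`[-1, 1]%classic : set (measurableTypeR R)) by exact: measurable_itv.
  move=> h; have := (integrable_mkcond _ mI).1 h.
  by rewrite restrict_EFin.
have [h1 h2] := integral_leb_prod ig.
have E : (fun x : T => (\prod_i g i (tnth x i))%:E) =
    (fun x : T => (\prod_i (q i).[tnth x i] * weight x)%:E) \_ cube.
  apply/funext => x; rewrite patchE; case: ifPn => [|xc].
    rewrite inE => xc; congr EFin; rewrite /weight -big_split /=.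
    by apply: eq_bigr => i _; rewrite /g patchE mem_set//; exact: xc.
  have [i xi] : exists i, tnth x i \notin `[-1, 1].
    apply: contrapT => nE; move/negP: xc; apply; rewrite inE => i.
    by apply: contrapT => /negP ni; apply: nE; exists i.
  rewrite (bigD1 i)//= /g patchE memNset ?mul0r//.
  exact/negP.
split.
  by apply/(integrable_mkcond _ measurable_cube); rewrite -E.
rewrite integral_mkcond -E h2; congr EFin; apply: eq_bigr => i _.
by rewrite /wint [RHS]Rintegral_mkcond.
Qed.

Lemma integral_cube_weight :
  (\int[leb d]_(x in cube) (weight x)%:E = (h0 alpha ^+ d)%:E)%E.
Proof.
have [_] := integral_cube_prod (fun=> 1); rewrite prodr_const card_ord wint1 => <-.
apply: eq_integral => x _; rewrite big1 ?mul1r// => i _; exact: hornerC.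
Qed.

Lemma integrable_cube_weight : (leb d).-integrable cube (fun x : T => (weight x)%:E).
Proof.
have [h _] := integral_cube_prod (fun=> 1); apply: eq_integrable h.
  exact: measurable_cube.
move=> x _; rewrite big1 ?mul1r// => i _; exact: hornerC.
Qed.

(** f is controlled only on the cube, so the class is relative to it; integrability then comes from
    the finite mass of the weight. *)
Definition cube_bounded (g : T -> R) :=
  measurable_fun cube g /\ exists K, forall x, cube x -> `|g x| <= K.

Lemma cube_boundedD f g : cube_bounded f -> cube_bounded g ->
  cube_bounded (fun x => f x + g x).
Proof.
move=> [mf [K fK]] [mg [L gL]]; split; first exact: measurable_funD.
exists (K + L) => x xc; apply: le_trans (ler_normD _ _) _.
by apply: lerD; [exact: fK|exact: gL].
Qed.

Lemma cube_boundedM f g : cube_bounded f -> cube_bounded g ->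
  cube_bounded (fun x => f x * g x).
Proof.
move=> [mf [K fK]] [mg [L gL]]; split; first exact: measurable_funM.
by exists (K * L) => x xc; rewrite normrM ler_pM// ?fK ?gL.
Qed.

Lemma cube_bounded_cst c : cube_bounded (cst c).
Proof. by split; [exact: measurable_cst|exists `|c|]. Qed.

Lemma cube_boundedZ c f : cube_bounded f -> cube_bounded (fun x => c * f x).
Proof. by move=> bf; apply: (cube_boundedM (cube_bounded_cst c)). Qed.

Lemma cube_boundedB f g : cube_bounded f -> cube_bounded g ->
  cube_bounded (fun x => f x - g x).
Proof.
move=> bf bg; apply: (cube_boundedD bf).
rewrite (_ : (fun _ => _) = fun x => (-1) * g x); first exact: cube_boundedZ.
by apply/funext => x; rewrite mulN1r.
Qed.

Lemma cube_bounded_sum I (r : seq I) (F : I -> T -> R) :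
  (forall i, cube_bounded (F i)) -> cube_bounded (fun x => \sum_(i <- r) F i x).
Proof.
move=> bF; elim: r => [|i r IH].
  rewrite (_ : (fun _ => _) = cst 0); first exact: cube_bounded_cst.
  by apply/funext => x; rewrite big_nil.
rewrite (_ : (fun _ => _) = fun x => F i x + \sum_(i <- r) F i x).
  exact: cube_boundedD.
by apply/funext => x; rewrite big_cons.
Qed.

Lemma cube_boundedX f k : cube_bounded f -> cube_bounded (fun x => f x ^+ k).
Proof.
move=> bf; elim: k => [|k IH]; first exact: cube_bounded_cst.
by under eq_fun do rewrite exprS; exact: cube_boundedM.
Qed.

Lemma cube_integrable g : cube_bounded g ->
  (leb d).-integrable cube (fun x : T => (g x * weight x)%:E).
Proof.
move=> [mg [K gK]].
have bg : [bounded g x | x in cube].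
  exists K; split; first exact: num_real.
  by move=> y Ky x xc; apply: le_trans (gK x xc) (ltW Ky).
by have := integrableMr measurable_cube mg bg integrable_cube_weight; apply: eq_integrable => //; exact: measurable_cube.
Qed.

Definition cint (g : T -> R) : R := \int[leb d]_(x in cube) (g x * weight x).

Lemma cintE g : cube_bounded g ->
  (\int[leb d]_(x in cube) (g x * weight x)%:E = (cint g)%:E)%E.
Proof.
move=> bg; rewrite /cint /Rintegral fineK//.
by apply: integrable_fin_num; [exact: measurable_cube|exact: cube_integrable].
Qed.

Lemma cintD f g : cube_bounded f -> cube_bounded g ->
  cint (fun x => f x + g x) = cint f + cint g.
Proof.
move=> bf bg; rewrite /cint -RintegralD; [|exact: measurable_cube|exact: cube_integrable|exact: cube_integrable].
by apply: eq_Rintegral => x _; rewrite mulrDl.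
Qed.

Lemma cintZ c f : cube_bounded f -> cint (fun x => c * f x) = c * cint f.
Proof.
move=> bf; rewrite /cint -RintegralZl; [|exact: measurable_cube|exact: cube_integrable].
by apply: eq_Rintegral => x _; rewrite mulrA.
Qed.

Lemma cint_sum I (r : seq I) (F : I -> T -> R) :
  (forall i, cube_bounded (F i)) ->
  cint (fun x => \sum_(i <- r) F i x) = \sum_(i <- r) cint (F i).
Proof.
move=> bF; elim: r => [|i r IH].
  rewrite big_nil (_ : (fun _ => _) = fun x => 0 * cst 0 x); last first.
    by apply/funext => x; rewrite big_nil mul0r.
  by rewrite (cintZ 0 (cube_bounded_cst 0)) mul0r.
rewrite big_cons -IH -cintD//; last exact: cube_bounded_sum.
by congr cint; apply/funext => x; rewrite big_cons.
Qed.

Lemma le_cint f g : cube_bounded f -> cube_bounded g ->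
  (forall x, cube x -> f x <= g x) -> cint f <= cint g.
Proof.
move=> bf bg fg; apply: le_Rintegral; [exact: measurable_cube|exact: cube_integrable|exact: cube_integrable|].
by move=> x xc; rewrite ler_wpM2r ?weight_ge0 ?fg.
Qed.

End CubeIntegral.

(** * The orthonormal basis of the polynomial space *)

Section Basis.
Context {R : realType} (d N m : nat) (alpha : R).
Hypotheses (N_gt0 : (0 < N)%N) (m_gt0 : (0 < m)%N) (al : - 2^-1 <= alpha).
Local Notation T := (d.-tuple R).

Lemma njacobi0 : njacobi alpha 0 = (Num.sqrt (h0 alpha))^-1%:P.
Proof.
have j0 : jacobi alpha alpha 0 = 1.
  rewrite /jacobi big_ord1 !expr0 mulr1 /gbinom subnn !big_ord0 fact0 divr1 mulr1.
  by rewrite scale1r.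
by rewrite njacobiE j0 expr1n wint1 -mul_polyC mulr1.
Qed.

(** The normalized polynomial of degree 0 is h0^(-1/2), so the constant factor is the product over
    the coordinates outside u. *)
Lemma Phi_prodE (uk : mindex d N) (x : T) : uk \in basis_index N m d ->
  Phi alpha uk x = \prod_i (njacobi alpha (uk.2 i)).[tnth x i].
Proof.
rewrite inE => /and3P[_ /forallP uP _]; have hp := h0_gt0 al.
have uk0 i : i \notin uk.1 -> (uk.2 i : nat) = 0%N.
  by rewrite (eqP (uP i)) lt0n negbK => /eqP.
rewrite [RHS](bigID (mem uk.1))/= mulrC; congr (_ * _).
rewrite (eq_bigr (fun=> (Num.sqrt (h0 alpha))^-1)); last first.
  by move=> i /uk0 ->; rewrite njacobi0 hornerC.
rewrite prodr_const; set k := (X in _ ^+ X).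
have kE : d%:R - #|uk.1|%:R = k%:R :> R.
  have kd : (#|uk.1| + k = d)%N by rewrite -[RHS](card_ord d) -(cardC (mem uk.1)).
  by have := congr1 (fun z => z%:R : R) kd; rewrite natrD => <-; rewrite addrC addKr.
rewrite kE -powR12_sqrt ?(ltW hp)// -powRN -powR_mulrn ?powR_ge0// -powRrM.
by congr (_ `^ _); ring.
Qed.

Lemma Phi_bounded (uk : mindex d N) : uk \in basis_index N m d ->
  cube_bounded (Phi alpha uk : T -> R).
Proof.
move=> ukb; have -> : Phi alpha uk = (fun x : T => \prod_i (njacobi alpha (uk.2 i)).[tnth x i]).
  by apply/funext => x; exact: Phi_prodE.
split.
  apply/measurable_funTS; apply: measurable_prod => i _; apply: measurable_coord.
  exact: measurable_poly.
have K i : exists K, 0 <= K /\ forall x, x \in `[-1, 1] -> `|(njacobi alpha (uk.2 i)).[x]| <= K.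
  have [M [_ hM]] := horner_bounded (njacobi alpha (uk.2 i)).
  exists (`|M| + 1); split; first by rewrite addr_ge0.
  by move=> x x1; apply: hM => //; rewrite ltr_pwDr// ler_norm.
have [K' K'P] := choice K.
exists (\prod_i K' i) => x xc; rewrite normr_prod; apply: ler_prod => i _.
by rewrite normr_ge0 (K'P i).2//; exact: xc.
Qed.

Lemma cint_Phi (a b : mindex d N) : a \in basis_index N m d -> b \in basis_index N m d ->
  cint alpha (fun x => Phi alpha a x * Phi alpha b x) = (a == b)%:R.
Proof.
move=> aI bI.
have [_ h] := integral_cube_prod al (fun i : 'I_d => njacobi alpha (a.2 i) * njacobi alpha (b.2 i)).
have -> : cint alpha (fun x => Phi alpha a x * Phi alpha b x) =
    \prod_i wint alpha (njacobi alpha (a.2 i) * njacobi alpha (b.2 i)).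
  apply: EFin_inj; rewrite -h -(cintE al); last first.
    by apply: cube_boundedM; exact: Phi_bounded.
  apply: eq_integral => x _; rewrite !Phi_prodE// -big_split /=.
  by congr (_ * _)%:E; apply: eq_bigr => i _; rewrite hornerM.
under eq_bigr do rewrite wint_njacobi//.
have [->|ab] := eqVneq a b; first by rewrite big1// => i _; rewrite eqxx.
(* The support of k is u, so two distinct indices already differ in k. *)
have [i abi] : exists i, a.2 i != b.2 i.
  apply/existsP; apply: contraNT ab; rewrite negb_exists => /forallP H.
  have E2 : a.2 = b.2 by apply/ffunP => i; apply/eqP; have := H i; rewrite negbK.
  have E1 : a.1 = b.1.
    apply/setP => i; move: aI bI; rewrite !inE => /and3P[_ /forallP/(_ i)/eqP -> _].
    by move=> /and3P[_ /forallP/(_ i)/eqP -> _]; rewrite E2.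
  by rewrite (surjective_pairing a) (surjective_pairing b) E1 E2.
by rewrite (bigD1 i)//= val_eqE (negbTE abi) mul0r.
Qed.

(** Coordinates outside u contribute 1 and those in u at most D^2 / 2. As D^2 / 2 >= 1, the exponent
    |u| can be raised to m, and 2^(-m) <= 1/2 because m >= 1. *)
Lemma Phi_sup (a : mindex d N) (x : T) : a \in basis_index N m d -> cube x ->
  h0 alpha ^+ d * Phi alpha a x ^+ 2 <= Dconst N alpha ^+ (2 * m) / 2.
Proof.
move=> aI xc; rewrite Phi_prodE// -prodrXl -[X in _ ^+ X](card_ord d) -prodr_const -big_split /=.
set D2 := Dconst N alpha ^+ 2; have D4 : 4 <= D2 by exact: Dconst_sqr_ge4.
have hp := h0_gt0 al.
have := aI; rewrite inE => /and3P[am /forallP aP _].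
apply: (@le_trans _ _ ((D2 / 2) ^+ #|a.1|)).
  rewrite (bigID (mem a.1))/= [X in _ * X]big1 ?mulr1; last first.
    move=> i; rewrite (eqP (aP i)) lt0n negbK => /eqP ->.
    by rewrite njacobi0 hornerC exprVn sqr_sqrtr ?(ltW hp)// mulfV ?lt0r_neq0.
  rewrite -prodr_const; apply: ler_prod => i ia.
  rewrite mulr_ge0 ?sqr_ge0 ?(ltW hp)//=.
  have ai0 : (0 < a.2 i)%N by rewrite -(eqP (aP i)).
  have := xc i; rewrite in_itv/= => /andP[x1 x2].
  rewrite -(prednK ai0); apply: le_trans (njacobi_sup _ al x1 x2) _.
  by apply: Dconst_sqr_ge => //; rewrite prednK// -ltnS.
apply: (@le_trans _ _ ((D2 / 2) ^+ m)).
  by apply: ler_weXn2l => //; lra.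
have D20 : 0 <= D2 by lra.
rewrite exprMn exprM -/D2; apply: ler_wpM2l; first exact: exprn_ge0.
have h2 : 2^-1 <= 1 :> R by lra.
by rewrite -[leRHS]expr1; apply: ler_wiXn2l.
Qed.

End Basis.

(** * Least squares *)

Section LowerIntegral.
Local Open Scope ereal_scope.
Context {d} {T : measurableType d} {R : realType} (mu : {measure set T -> \bar R}).
Import HBNNSimple.

(* No measurability is needed because the integral of a nonnegative function
   is a supremum over the simple functions below it. *)
Lemma ge0_le_lower_integral (D : set T) (f g : T -> \bar R) :
  (forall x, D x -> 0 <= f x) -> (forall x, D x -> f x <= g x) ->
  \int[mu]_(x in D) f x <= \int[mu]_(x in D) g x.
Proof.
move=> f0 fg; rewrite integral_mkcond [leRHS]integral_mkcond.
have f0' x : 0 <= (f \_ D) x by rewrite patchE; case: ifPn => // /[!inE] /f0.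
have fg' x : (f \_ D) x <= (g \_ D) x.
  by rewrite !patchE; case: ifPn => // /[!inE] /fg.
rewrite !ge0_integralTE//; last by move=> x; exact: le_trans (fg' x).
apply: le_ereal_sup => _ [h hf <-]; exists h => // x.
exact: le_trans (hf x) (fg' x).
Qed.

End LowerIntegral.

Section LeastSquares.
Context {R : realType}.

(** A kernel vector u satisfies c |u|^2 <= 0. Where the Gram matrix is coercive this excludes the
    default value in [Chat]. *)
Lemma unitmx_coercive M (G : 'M[R]_M) c : 0 < c ->
  (forall u, c * bform 1 u u <= bform G u u) -> G \in unitmx.
Proof.
move=> c0 Gc; rewrite -unitmx_tr -row_free_unit -kermx_eq0.
apply/eqP/row_matrixP => i; rewrite row0; set r := row i _.
have rG : r *m G^T = 0.
  by apply/eqP; have := row_sub i (kermx G^T); rewrite sub_kermx.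
have Gr : G *m r^T = 0 by rewrite -[G]trmxK -trmx_mul rG trmx0.
have := Gc r^T; rewrite {2}/bform -mulmxA Gr mulmx0 mxE.
rewrite pmulr_rle0// bform1E => h.
have : \sum_j r^T j 0 ^+ 2 = 0.
  by apply/eqP; rewrite eq_le h sumr_ge0// => j _; exact: sqr_ge0.
rewrite -(moment0 1) => /moment0_eq0 r0.
by rewrite -[r]trmxK r0 trmx0.
Qed.

(** c |u|^2 <= u^T G u = u^T z <= |u| |z|. *)
Lemma solve_coercive_le M (G : 'M[R]_M) c (u z : 'cV[R]_M) : 0 < c ->
  (forall u, c * bform 1 u u <= bform G u u) -> G *m u = z ->
  bform 1 u u <= bform 1 z z / c ^+ 2.
Proof.
move=> c0 Gc Guz; have := Gc u.
have -> : bform G u u = bform 1 u z by rewrite /bform mulmx1 -mulmxA Guz.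
have := bform_cauchy_schwarz u z (psd1 R M).
set a := bform 1 u u; set b := bform 1 z z; set t := bform 1 u z.
have a0 : 0 <= a by exact: (psd1 R M).2.
have b0 : 0 <= b by exact: (psd1 R M).2.
move=> tab cat; rewrite ler_pdivlMr ?exprn_gt0//.
have [->|an0] := eqVneq a 0; first by rewrite mul0r.
have a_gt0 : 0 < a by rewrite lt_neqAle eq_sym an0.
have h : (c * a) ^+ 2 <= t ^+ 2.
  by rewrite ler_sqr ?nnegrE ?mulr_ge0 ?(ltW c0)//; apply: le_trans cat; rewrite mulr_ge0// ltW.
rewrite -(ler_pM2l a_gt0).
by apply: le_trans (le_trans h tab); rewrite le_eqVlt; apply/orP; left; apply/eqP; ring.
Qed.

(** The normal equations give G (C - c) = F^T (y - F c) for any c, and y - F c consists of the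
    scaled values of f - sum_l c_l Psi_l plus noise at the sample points. *)
Lemma Chat_error alpha d n M (Psi : 'I_M -> d.-tuple R -> R) (X : 'I_n -> d.-tuple R)
    (f : d.-tuple R -> R) (eps : 'I_n -> R) (c : 'I_M -> R) (kappa : R) :
  0 < kappa ->
  (forall u, kappa * bform 1 u u <= bform (Gmx alpha Psi X) u u) ->
  \sum_j (Chat alpha Psi X (fun i => f (X i) + eps i) j 0 - c j) ^+ 2 <=
  (\sum_j ((h0 alpha `^ (d%:R / 2) / Num.sqrt n%:R) ^+ 2 * \sum_i Psi j (X i) *
    (f (X i) - \sum_l c l * Psi l (X i) + eps i)) ^+ 2) / kappa ^+ 2.
Proof.
move=> k0 Gk; have Gu := unitmx_coercive k0 Gk.
set sc := h0 alpha `^ (d%:R / 2) / Num.sqrt n%:R.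
pose cv : 'cV[R]_M := \col_j c j.
pose F := Fmx alpha Psi X.
pose y : 'cV[R]_n := sc *: \col_i (f (X i) + eps i).
pose z := F^T *m (y - F *m cv).
have CE : Chat alpha Psi X (fun i => f (X i) + eps i) = invmx (Gmx alpha Psi X) *m F^T *m y.
  by rewrite /Chat Gu.
have Gz : Gmx alpha Psi X *m (Chat alpha Psi X (fun i => f (X i) + eps i) - cv) = z.
  rewrite CE mulmxBr !mulmxA mulmxV// mul1mx /z mulmxBr /Gmx -/F.
  by rewrite !mulmxA.
have := solve_coercive_le k0 Gk Gz; rewrite !bform1E.
rewrite (eq_bigr (fun j => (Chat alpha Psi X (fun i => f (X i) + eps i) j 0 - c j) ^+ 2)); last first.
  by move=> j _; rewrite !mxE.
move=> /le_trans; apply; rewrite le_eqVlt; apply/orP; left; apply/eqP.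
congr (_ / _); apply: eq_bigr => j _; congr (_ ^+ 2).
rewrite /z mxE mulr_sumr; apply: eq_bigr => i _.
rewrite !mxE -/sc.
have -> : \sum_j0 F i j0 * cv j0 0 = sc * \sum_l c l * Psi l (X i).
  by rewrite mulr_sumr; apply: eq_bigr => l _; rewrite !mxE -/sc; ring.
ring.
Qed.

Variables (d M : nat) (alpha : R) (Psi : 'I_M -> d.-tuple R -> R).
Hypothesis al : - 2^-1 <= alpha.
Hypothesis bPsi : forall j, cube_bounded (Psi j).
Hypothesis oPsi : forall i j, cint alpha (fun x => Psi i x * Psi j x) = (i == j)%:R.
Variables (f : d.-tuple R -> R) (c : 'I_M -> R).
Hypothesis bf : cube_bounded f.
Let p x := \sum_j c j * Psi j x.
Hypothesis fp : forall j, cint alpha (fun x => (f x - p x) * Psi j x) = 0.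

Let bcomb (a : 'I_M -> R) : cube_bounded (fun x => \sum_j a j * Psi j x).
Proof. by apply: cube_bounded_sum => j; exact: cube_boundedZ. Qed.

Lemma cint_comb_sqr (a : 'I_M -> R) :
  cint alpha (fun x => (\sum_j a j * Psi j x) ^+ 2) = \sum_j a j ^+ 2.
Proof.
have -> : (fun x => (\sum_j a j * Psi j x) ^+ 2) =
    (fun x => \sum_i \sum_j (a i * a j) * (Psi i x * Psi j x)).
  apply/funext => x; rewrite expr2 mulr_suml; apply: eq_bigr => i _.
  by rewrite mulr_sumr; apply: eq_bigr => j _; ring.
have bt i j : cube_bounded (fun x => (a i * a j) * (Psi i x * Psi j x)).
  by apply: cube_boundedZ; exact: cube_boundedM.
rewrite (cint_sum al); last by move=> i; exact: cube_bounded_sum.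
apply: eq_bigr => i _; rewrite (cint_sum al)//.
rewrite (bigD1 i)//= big1 ?addr0; last first.
  move=> j ji; rewrite (cintZ al); last exact: cube_boundedM.
  by rewrite oPsi eq_sym (negbTE ji) mulr0.
rewrite (cintZ al); last exact: cube_boundedM.
by rewrite oPsi eqxx mulr1 expr2.
Qed.

Lemma cint_pythagoras (a : 'I_M -> R) :
  cint alpha (fun x => (f x - \sum_j a j * Psi j x) ^+ 2) =
  cint alpha (fun x => (f x - p x) ^+ 2) + \sum_j (a j - c j) ^+ 2.
Proof.
rewrite -cint_comb_sqr.
have bp : cube_bounded (fun x => f x - p x) by apply: cube_boundedB => //; exact: bcomb.
pose q x := \sum_j (a j - c j) * Psi j x.
have bq : cube_bounded q by exact: bcomb.
have -> : (fun x => (f x - \sum_j a j * Psi j x) ^+ 2) =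
  (fun x => ((f x - p x) ^+ 2 + q x ^+ 2) + (-2) * ((f x - p x) * q x)).
  apply/funext => x.
  have -> : \sum_j a j * Psi j x = p x + q x.
    by rewrite /p /q -big_split /=; apply: eq_bigr => j _; ring.
  ring.
rewrite (cintD al); [|by apply: cube_boundedD; exact: cube_boundedX|by apply: cube_boundedZ; exact: cube_boundedM].
rewrite (cintD al); [|exact: cube_boundedX|exact: cube_boundedX].
rewrite (cintZ al); last exact: cube_boundedM.
suff -> : cint alpha (fun x => (f x - p x) * q x) = 0 by rewrite mulr0 addr0.
have -> : (fun x => (f x - p x) * q x) =
  (fun x => \sum_j (a j - c j) * ((f x - p x) * Psi j x)).
  by apply/funext => x; rewrite mulr_sumr; apply: eq_bigr => j _; ring.
rewrite (cint_sum al); last by move=> j; apply: cube_boundedZ; exact: cube_boundedM.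
by rewrite big1// => j _; rewrite (cintZ al) ?fp ?mulr0//; exact: cube_boundedM.
Qed.

End LeastSquares.

(** * The orthogonal projection *)

Section Projection.
Context {R : realType} (d N m : nat) (alpha : R).
Hypotheses (N_gt0 : (0 < N)%N) (m_gt0 : (0 < m)%N) (al : - 2^-1 <= alpha).
Variables (e : 'I_#|basis_index N m d| -> mindex d N) (f : d.-tuple R -> R).
Hypotheses (e_enum : enumerates e) (bf : cube_bounded f).

Lemma enumerates_in j : e j \in basis_index N m d.
Proof. by apply/e_enum.2; exists j. Qed.

Lemma sum_enumerates (F : mindex d N -> R) :
  \sum_(a in basis_index N m d) F a = \sum_j F (e j).
Proof.
transitivity (\sum_(a in [set e j | j in [set: 'I_#|basis_index N m d|]%SET]%SET) F a).
  apply: eq_bigl => a; apply/idP/imsetP => [/e_enum.2[j <-]|[j _ ->]].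
    by exists j; rewrite ?inE.
  exact: enumerates_in.
rewrite big_imset/=; last by move=> i j _ _; exact: e_enum.1.
by apply: eq_bigl => j; rewrite !inE.
Qed.

Lemma cint_enumerates i j :
  cint alpha (fun x => Phi alpha (e i) x * Phi alpha (e j) x) = (i == j)%:R.
Proof.
rewrite (cint_Phi al (enumerates_in i) (enumerates_in j)); congr (_ %:R); congr nat_of_bool.
by apply/eqP/eqP => [/e_enum.1|->].
Qed.

Lemma Proj_enumerates : exists c, [/\
  Proj alpha N m f = (fun x => \sum_j c j * Phi alpha (e j) x) &
  forall j, cint alpha (fun x => (f x - Proj alpha N m f x) * Phi alpha (e j) x) = 0].
Proof.
have bPhi j : cube_bounded (Phi alpha (e j)) by apply: (@Phi_bounded _ _ _ m) => //; exact: enumerates_in.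
set A := [set p | Pspace alpha N m p /\ forall q, Pspace alpha N m q -> inner alpha (f \- p) q = 0].
(* The Fourier sum is a witness, so [xget] does not return its default; afterwards only the defining
   property of [Proj] is used. *)
have A0 : A !=set0.
  pose b j := cint alpha (fun x => f x * Phi alpha (e j) x).
  have bb : cube_bounded (fun x => \sum_j b j * Phi alpha (e j) x).
    by apply: cube_bounded_sum => j; exact: cube_boundedZ.
  exists (fun x => \sum_j b j * Phi alpha (e j) x); split.
    exists (fun a => cint alpha (fun x => f x * Phi alpha a x)).
    by apply/funext => x; rewrite sum_enumerates.
  have orth j : cint alpha (fun x => (f x - \sum_l b l * Phi alpha (e l) x) * Phi alpha (e j) x) = 0.
    have -> : (fun x => (f x - \sum_l b l * Phi alpha (e l) x) * Phi alpha (e j) x) =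
      (fun x => f x * Phi alpha (e j) x + (-1) * \sum_l b l * (Phi alpha (e l) x * Phi alpha (e j) x)).
      apply/funext => x; rewrite mulrBl mulN1r mulr_suml; congr (_ - _).
      by apply: eq_bigr => l _; rewrite mulrA.
    have bl l : cube_bounded (fun x => b l * (Phi alpha (e l) x * Phi alpha (e j) x)).
      by apply: cube_boundedZ; exact: cube_boundedM.
    rewrite (cintD al); [|exact: cube_boundedM|by apply: cube_boundedZ; exact: cube_bounded_sum].
    rewrite (cintZ al); last exact: cube_bounded_sum.
    rewrite (cint_sum al)// (bigD1 j)//= big1; last first.
      move=> l lj; rewrite (cintZ al); last exact: cube_boundedM.
      by rewrite cint_enumerates (negbTE lj) mulr0.
    rewrite (cintZ al); last exact: cube_boundedM.
    by rewrite cint_enumerates eqxx mulr1 addr0 mulN1r subrr.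
  move=> q [c ->]; rewrite -[LHS]/(cint alpha (fun x => (f x - \sum_l b l * Phi alpha (e l) x) *
    \sum_(a in basis_index N m d) c a * Phi alpha a x)).
  have -> : (fun x => (f x - \sum_l b l * Phi alpha (e l) x) *
    \sum_(a in basis_index N m d) c a * Phi alpha a x) = (fun x => \sum_j c (e j) *
      ((f x - \sum_l b l * Phi alpha (e l) x) * Phi alpha (e j) x)).
    by apply/funext => x; rewrite sum_enumerates mulr_sumr; apply: eq_bigr => j _; ring.
  have bd j : cube_bounded (fun x => (f x - \sum_l b l * Phi alpha (e l) x) * Phi alpha (e j) x).
    by apply: cube_boundedM => //; exact: cube_boundedB.
  rewrite (cint_sum al); last by move=> j; exact: cube_boundedZ.
  by rewrite big1// => j _; rewrite (cintZ al)// orth mulr0.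
have [[c pE] orth] : A (Proj alpha N m f) by exact: xgetPex A0.
exists (fun j => c (e j)); split.
  by rewrite [LHS]pE; apply/funext => x; rewrite sum_enumerates.
move=> j; apply: orth; exists (fun a => (a == e j)%:R).
apply/funext => x; rewrite (bigD1 (e j))/= ?enumerates_in// eqxx mul1r big1 ?addr0//.
by move=> a /andP[_ /negbTE ->]; rewrite mul0r.
Qed.

End Projection.

(** * Moments involving the noise *)

Section HasMean.
Context {d0} {Omega : measurableType d0} {R : realType} (P : probability Omega R).
Implicit Types f g : Omega -> R.

(** The noise may be unbounded, so integrability is carried along with the value of the integral. *)
Definition has_mean f v :=
  P.-integrable setT (EFin \o f) /\ (\int[P]_w (f w)%:E = v%:E)%E.

Lemma has_meanD f g u v : has_mean f u -> has_mean g v -> has_mean (fun w => f w + g w) (u + v).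
Proof.
move=> [fi fu] [gi gv]; split; first exact: integrableD fi gi.
by under eq_integral do rewrite EFinD; rewrite integralD// fu gv.
Qed.

Lemma has_meanZ c f u : has_mean f u -> has_mean (fun w => c * f w) (c * u).
Proof.
move=> [fi fu]; split.
  by have := integrableZl measurableT c fi; exact: eq_integrable.
by under eq_integral do rewrite EFinM; rewrite integralZl// fu.
Qed.

Lemma has_mean0 : has_mean (cst 0) 0.
Proof. by split; [exact: integrable0|rewrite integral0]. Qed.

Lemma has_mean_sum I (r : seq I) (F : I -> Omega -> R) (v : I -> R) :
  (forall i, has_mean (F i) (v i)) ->
  has_mean (fun w => \sum_(i <- r) F i w) (\sum_(i <- r) v i).
Proof.
move=> Fv; elim: r => [|i r IH].
  by under eq_fun do rewrite big_nil; rewrite big_nil; exact: has_mean0.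
under eq_fun do rewrite big_cons; rewrite big_cons; exact: has_meanD.
Qed.

Lemma has_mean_bm f : bounded_measurable f -> has_mean f (mean P f).
Proof. by move=> bf; split; [exact: bm_integrable|rewrite meanE//; exact: bm_integrable]. Qed.

Lemma has_mean_independent d1 d2 (T1 : measurableType d1) (T2 : measurableType d2)
    (U : Omega -> T1) (W : Omega -> T2) (a : T1 -> R) (b : T2 -> R) u v :
  measurable_fun setT U -> measurable_fun setT W -> independent_pair P U W ->
  measurable_fun setT a -> measurable_fun setT b ->
  has_mean (a \o U) u -> has_mean (b \o W) v ->
  has_mean (fun w => a (U w) * b (W w)) (u * v).
Proof.
move=> mU mW UW ma mb [ia eu] [ib ev].
have [i1 e1] := integral_independent mU mW UW ma mb ia ib.
by split; rewrite // e1 [X in (X * _)%E]eu [X in (_ * X)%E]ev.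
Qed.

Lemma mutually_independent_pair d1 (T : measurableType d1) n (Z : 'I_n -> Omega -> T) i j :
  mutually_independent P Z -> i != j -> independent_pair P (Z i) (Z j).
Proof.
move=> ZI ij A B mA mB.
have := ZI [set i; j]%SET (fun l => if l == i then A else B).
have -> : \bigcap_(l in [set l | l \in [set i; j]%SET]) (Z l @^-1` (if l == i then A else B)) =
    Z i @^-1` A `&` Z j @^-1` B.
  apply/seteqP; split => [w h|w [wA wB] l /=].
    split; first by have := h i; rewrite /= !inE eqxx => /(_ isT).
    by have := h j; rewrite /= !inE eqxx orbT eq_sym (negbTE ij) => /(_ isT).
  by rewrite !inE => /orP[]/eqP ->; rewrite ?eqxx// eq_sym (negbTE ij).
move=> ->; last by move=> l; case: ifP.
by rewrite big_setU1 ?inE//= big_set1 eqxx eq_sym (negbTE ij).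
Qed.

Lemma has_mean_eps (eps : Omega -> R) (sigma : R) : measurable_fun setT eps ->
  ('E_P[eps] = 0)%E -> ('V_P[eps] = (sigma ^+ 2)%:E)%E ->
  has_mean eps 0 /\ has_mean (fun w => eps w ^+ 2) (sigma ^+ 2).
Proof.
move=> me E0 V.
have E2 : (\int[P]_w (eps w ^+ 2)%:E = (sigma ^+ 2)%:E)%E.
  rewrite -V /variance unlock E0 unlock; apply: eq_integral => w _.
  by congr EFin; rewrite expr2 -[RHS]/((eps w - fine 0) * (eps w - fine 0)) /= subr0.
have i2 : P.-integrable setT (EFin \o (fun w => eps w ^+ 2)).
  apply/integrableP; split; first by apply/measurable_EFinP; exact: measurable_funX.
  under eq_integral do rewrite gee0_abs ?lee_fin ?sqr_ge0//.
  by rewrite [X in (X < _)%E]E2 ltry.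
split; last by split.
split; last by rewrite -[RHS]E0 unlock.
(* Integrability of the noise itself comes from |eps| <= 1 + eps^2. *)
have i3 : P.-integrable setT (EFin \o (fun w => 1 + eps w ^+ 2)).
  by have := integrableD measurableT (bm_integrable P (bm_cst 1)) i2; exact: eq_integrable.
apply: le_integrable i3 => //; first exact/measurable_EFinP.
move=> w _ /=; rewrite lee_fin [leRHS]ger0_norm ?addr_ge0 ?sqr_ge0//.
rewrite ler_norml; have h1 := sqr_ge0 (eps w - 1); have h2 := sqr_ge0 (eps w + 1).
by apply/andP; split; nra.
Qed.

End HasMean.

Section SecondMoment.
Context {d0 d1} {Omega : measurableType d0} {T : measurableType d1} {R : realType}
  (P : probability Omega R) (n : nat).
Variables (X : 'I_n -> Omega -> T) (eps : 'I_n -> Omega -> R) (sigma : R).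
Hypothesis mX : forall i, measurable_fun setT (X i).
Hypothesis meps : forall i, measurable_fun setT (eps i).
Hypothesis X_indep : mutually_independent P X.
Hypothesis eps_indep : mutually_independent P eps.
Hypothesis X_eps_indep : independent_pair P (joint X) (joint eps).
Hypothesis eps1 : forall i, has_mean P (eps i) 0.
Hypothesis eps2 : forall i, has_mean P (fun w => eps i w ^+ 2) (sigma ^+ 2).

Lemma measurable_joint d' (T' : measurableType d') (Z : 'I_n -> Omega -> T') :
  (forall i, measurable_fun setT (Z i)) -> measurable_fun setT (joint Z).
Proof.
move=> mZ; apply/measurable_fun_tnthP => i.
rewrite (_ : _ \o _ = Z i)//.
by apply/funext => w /=; rewrite tnth_mktuple.
Qed.

Lemma has_mean_design_noise (a b : T -> R) i j (g : n.-tuple R -> R) v :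
  bounded_measurable a -> bounded_measurable b ->
  measurable_fun setT g -> has_mean P (g \o joint eps) v ->
  has_mean P (fun w => a (X i w) * b (X j w) * g (joint eps w))
    (mean P (fun w => a (X i w) * b (X j w)) * v).
Proof.
move=> ba bb mg gv.
pose h (t : n.-tuple T) := a (tnth t i) * b (tnth t j).
have bh : bounded_measurable h.
  by apply: bmM; [exact: (bm_comp (measurable_tnth i) ba)|exact: (bm_comp (measurable_tnth j) bb)].
have hE w : h (joint X w) = a (X i w) * b (X j w) by rewrite /h !tnth_mktuple.
have hm : has_mean P (h \o joint X) (mean P (fun w => a (X i w) * b (X j w))).
  have -> : (fun w => a (X i w) * b (X j w)) = h \o joint X.
    by apply/funext => w; rewrite /= hE.
  by apply: has_mean_bm; exact: (bm_comp (measurable_joint mX) bh).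
have := has_mean_independent (measurable_joint mX) (measurable_joint meps) X_eps_indep bh.1 mg hm gv.
by under eq_fun do rewrite hE.
Qed.

Lemma has_mean_eps_mul i j :
  has_mean P (fun w => eps i w * eps j w) (if i == j then sigma ^+ 2 else 0).
Proof.
have [->|ij] := eqVneq i j; first by under eq_fun do rewrite -expr2; exact: eps2.
rewrite -(mulr0 0).
exact: (has_mean_independent (a := id) (b := id) (meps i) (meps j)
  (mutually_independent_pair eps_indep ij) (@measurable_id _ _ _) (@measurable_id _ _ _) (eps1 i) (eps1 j)).
Qed.

Variables (p q : T -> R) (A B : R).
Hypotheses (bp : bounded_measurable p) (bq : bounded_measurable q).
Hypothesis p1 : forall i, mean P (p \o X i) = 0.
Hypothesis p2 : forall i, mean P (fun w => p (X i w) * p (X i w)) = A.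
Hypothesis q2 : forall i, mean P (fun w => q (X i w) * q (X i w)) = B.

(** p is the centred approximation part and q the weight of the noise. In the expanded square the
    pairs i <> j vanish by independence and centring; the mixed terms in p, q and eps vanish even
    for i = j, the noise being centred and independent of the sample. The diagonal leaves A + B
    sigma^2. *)
Lemma second_moment :
  has_mean P (fun w => (\sum_i (p (X i w) + q (X i w) * eps i w)) ^+ 2)
    (n%:R * (A + B * sigma ^+ 2)).
Proof.
have E w : (\sum_i (p (X i w) + q (X i w) * eps i w)) ^+ 2 =
  \sum_i \sum_j ((p (X i w) * p (X j w) + p (X i w) * q (X j w) * eps j w) +
    (q (X i w) * p (X j w) * eps i w + q (X i w) * q (X j w) * (eps i w * eps j w))).
  rewrite expr2 mulr_suml; apply: eq_bigr => i _; rewrite mulr_sumr.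
  by apply: eq_bigr => j _; ring.
have -> : (fun w => (\sum_i (p (X i w) + q (X i w) * eps i w)) ^+ 2) = _ := funext E.
have me i : measurable_fun setT (fun t : n.-tuple R => tnth t i) by exact: measurable_tnth.
have mee i j : measurable_fun setT (fun t : n.-tuple R => tnth t i * tnth t j).
  by apply: measurable_funM; exact: measurable_tnth.
have h1 i : has_mean P ((fun t : n.-tuple R => tnth t i) \o joint eps) 0.
  rewrite (_ : _ \o _ = eps i); first exact: eps1.
  by apply/funext => w /=; rewrite tnth_mktuple.
have h2 i j : has_mean P ((fun t : n.-tuple R => tnth t i * tnth t j) \o joint eps)
    (if i == j then sigma ^+ 2 else 0).
  rewrite (_ : _ \o _ = (fun w => eps i w * eps j w)); first exact: has_mean_eps_mul.
  by apply/funext => w /=; rewrite !tnth_mktuple.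
have tE w i : tnth (joint eps w) i = eps i w by rewrite tnth_mktuple.
have term i j : has_mean P (fun w =>
    (p (X i w) * p (X j w) + p (X i w) * q (X j w) * eps j w) +
    (q (X i w) * p (X j w) * eps i w + q (X i w) * q (X j w) * (eps i w * eps j w)))
    (if i == j then A + B * sigma ^+ 2 else 0).
  have t1 : has_mean P (fun w => p (X i w) * p (X j w)) (if i == j then A else 0).
    have [->|ij] := eqVneq i j.
      rewrite -(p2 j); apply: has_mean_bm.
      by apply: bmM; exact: (bm_comp (mX j) bp).
    rewrite -(mulr0 0) -{1}(p1 i) -(p1 j).
    apply: (has_mean_independent (mX i) (mX j) (mutually_independent_pair X_indep ij) bp.1 bp.1).
      by apply: has_mean_bm; exact: (bm_comp (mX i) bp).
    by apply: has_mean_bm; exact: (bm_comp (mX j) bp).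
  have t2 := has_mean_design_noise i j bp bq (me j) (h1 j).
  have t3 := has_mean_design_noise i j bq bp (me i) (h1 i).
  have t4 := has_mean_design_noise i j bq bq (mee i j) (h2 i j).
  have := has_meanD (has_meanD t1 t2) (has_meanD t3 t4).
  rewrite !mulr0 addr0 add0r.
  rewrite (_ : (if i == j then A else 0) + _ = (if i == j then A + B * sigma ^+ 2 else 0)).
    by under eq_fun do rewrite !tE.
  have [->|ij] := eqVneq i j; first by rewrite q2.
  by rewrite mulr0 addr0.
have := has_mean_sum (index_enum 'I_n) (fun i => has_mean_sum (index_enum 'I_n) (term i)).
rewrite (_ : \sum_i \sum_j _ = n%:R * (A + B * sigma ^+ 2))//.
rewrite (eq_bigr (fun=> A + B * sigma ^+ 2)); last first.
  move=> i _; rewrite (bigD1 i)//= eqxx big1 ?addr0// => j ji.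
  by rewrite eq_sym (negbTE ji).
by rewrite sumr_const card_ord mulr_natl.
Qed.

End SecondMoment.

(** * The law of the design points *)

Section DesignDensity.
Context {R : realType} (d : nat) (alpha : R).
Hypothesis al : - 2^-1 <= alpha.
Context {d0} {Omega : measurableType d0} (P : probability Omega R).
Variable X : {RV P >-> d.-tuple R}.
Hypothesis X_density : forall A : set (d.-tuple R), measurable A ->
    distribution P X A =
    (\int[leb d]_(x in A `&` @cube R d)
       ((h0 alpha ^+ d)^-1 * weight alpha x)%:E)%E.

Lemma mean_design (phi : d.-tuple R -> R) : bounded_measurable phi ->
  mean P (fun w => phi (X w)) = (h0 alpha ^+ d)^-1 * cint alpha phi.
Proof.
move=> bphi; pose rho := (fun x : d.-tuple R => (h0 alpha ^+ d)^-1 * weight alpha x) \_ (@cube R d).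
have hp : 0 <= (h0 alpha ^+ d)^-1 by rewrite invr_ge0 exprn_ge0// ltW// h0_gt0.
have rho0 x : 0 <= rho x.
  by rewrite /rho patchE; case: ifP => // _; rewrite mulr_ge0// weight_ge0.
have mrho : measurable_fun setT rho.
  apply: (measurable_restrictT _ (@measurable_cube R d)).1.
  by apply: measurable_funM => //; exact: measurable_weight.
have nuE A : measurable A -> distribution P X A = (\int[leb d]_(x in A) (rho x)%:E)%E.
  move=> mA; rewrite X_density// integral_mkcondr; apply: eq_integral => x _.
  by rewrite /rho !patchE; case: ifP.
have bphiX : bounded_measurable (fun w => phi (X w)) by exact: (bm_comp (f := phi) (U := X) _ bphi).
have cb : cube_bounded phi.
  split; first by apply: measurable_funTS; exact: bphi.1.
  by have [K h] := bphi.2; exists K => x _.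
rewrite /mean /Rintegral.
have -> : (\int[P]_x (phi (X x))%:E = \int[distribution P X]_x (phi x)%:E)%E.
  rewrite integral_distribution//; last exact: bm_integrable.
  by apply/measurable_EFinP; exact: bphi.1.
rewrite (integral_density rho0 mrho nuE bphi.1).
have -> : (\int[leb d]_x (phi x * rho x)%:E =
    \int[leb d]_(x in @cube R d) (((h0 alpha ^+ d)^-1 * phi x) * weight alpha x)%:E)%E.
  rewrite [RHS]integral_mkcond; apply: eq_integral => x _.
  rewrite /rho !patchE; case: ifP => _; last by rewrite mulr0.
  by congr EFin; ring.
rewrite (cintE al (cube_boundedZ _ cb)) /=.
by rewrite (cintZ al).
Qed.

End DesignDensity.

(** * The risk bound *)

Section Numeric.
Context {R : realType}.

(** Put theta = s p = delta / L. The leading term is - theta delta = - theta^2 L. The quadratic term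
    costs at most (3/8) theta^2 L because c >= 7/8, and passing from (1 - x)^(-p) to exp (p x) costs
    at most (1/8) theta^2 L because p >= 16 / L. What remains is the exponent - theta^2 L / 2 = -
    delta^2 / (2 L). *)
Lemma chernoff_numeric (delta L c s : R) (p : nat) :
  0 < delta -> delta < 1 -> 0 < L -> 7 / 8 <= c -> (0 < p)%N ->
  16 / L <= p%:R -> 2 * (delta / L) <= p%:R -> s = delta / L / p%:R ->
  0 <= s * (1 - delta) <= 2^-1 /\
  expR (- (s * p%:R) + (s * p%:R) ^+ 2 * (L / 2) / (2 * c ^+ 2)) /
    (1 - s * (1 - delta)) ^+ p <= expR (- (delta ^+ 2 / (2 * L))).
Proof.
move=> d0 d1 L0 c78 p0 pL pd sE.
have p_gt0 : 0 < p%:R :> R by rewrite ltr0n.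
set theta := delta / L; have th0 : 0 < theta by rewrite divr_gt0.
have spE : s * p%:R = theta by rewrite sE divfK// lt0r_neq0.
have s0 : 0 < s by rewrite sE divr_gt0.
have s2 : s <= 2^-1.
  by rewrite sE ler_pdivrMr//; move: pd; rewrite -/theta; lra.
set x := s * (1 - delta).
have x0 : 0 <= x by rewrite mulr_ge0 ?(ltW s0)//; lra.
have xs : x <= s by rewrite -[leRHS]mulr1 ler_wpM2l ?(ltW s0)//; lra.
have x2 : x <= 2^-1 by exact: le_trans xs s2.
split; first by apply/andP.
(* (1 - x)(1 + x + 2 x^2) = 1 + x^2 (1 - 2 x) >= 1 for x <= 1/2, whence exp (- y) <= 1 - x. *)
set y := x + 2 * x ^+ 2; have y0 : 0 <= y by rewrite addr_ge0// mulr_ge0// sqr_ge0.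
have ex : expR (- y) <= 1 - x.
  rewrite expRN; apply: le_trans (_ : (1 + y)^-1 <= _).
    by rewrite lef_pV2 ?posrE ?expR_gt0 ?expR_ge1Dx//; lra.
  rewrite -div1r ler_pdivrMr; last lra.
  have h : 0 <= x ^+ 2 * (1 - 2 * x) by rewrite mulr_ge0 ?sqr_ge0//; lra.
  rewrite -subr_ge0 (_ : _ - _ = x ^+ 2 * (1 - 2 * x))// /y; ring.
rewrite ler_pdivrMr; last by apply: exprn_gt0; lra.
apply: le_trans (_ : expR (- (delta ^+ 2 / (2 * L))) * expR (- y) ^+ p <= _); last first.
  by rewrite ler_wpM2l ?expR_ge0// lerXn2r ?nnegrE ?expR_ge0//; lra.
rewrite -expRM_natr -expRD ler_expR spE.
have yp : y * p%:R <= theta * (1 - delta) + theta ^+ 2 * L / 8.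
  have -> : y * p%:R = (s * p%:R) * (1 - delta) + 2 * (x ^+ 2 * p%:R) by rewrite /y /x; ring.
  rewrite spE lerD2l.
  have h1 : x ^+ 2 * p%:R <= theta ^+ 2 / p%:R.
    have -> : theta ^+ 2 / p%:R = s ^+ 2 * p%:R.
      by rewrite -spE; field; exact: lt0r_neq0.
    by rewrite ler_wpM2r ?(ltW p_gt0)// lerXn2r ?nnegrE ?(ltW s0).
  have h2 : theta ^+ 2 / p%:R <= theta ^+ 2 * (L / 16).
    rewrite ler_wpM2l ?sqr_ge0// -[leRHS]invrK lef_pV2 ?posrE// ?invr_gt0 ?divr_gt0//.
    by rewrite invf_div.
  lra.
have dE : delta = theta * L by rewrite /theta divfK// lt0r_neq0.
have -> : delta ^+ 2 / (2 * L) = theta ^+ 2 * L / 2.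
  by rewrite dE; field; exact: lt0r_neq0.
have cc : (2 * c ^+ 2)^-1 <= 3 / 4.
  have c2 : (7 / 8) ^+ 2 <= c ^+ 2 by rewrite lerXn2r ?nnegrE; lra.
  by rewrite -div1r ler_pdivrMr; lra.
have tL : 0 <= theta ^+ 2 * (L / 2) by rewrite mulr_ge0 ?sqr_ge0//; lra.
have := ler_wpM2l tL cc; rewrite mulNr.
have tdE : theta * delta = theta ^+ 2 * L by rewrite dE; ring.
lra.
Qed.

(** Truncation is the nearest-point map onto [-K, K], an interval that contains f x. *)
Lemma truncation_dist (T : Type) (K : R) (f g : T -> R) x : `|f x| <= K ->
  `|f x - truncation K g x| <= `|f x - g x| /\ `|f x - truncation K g x| <= 2 * K.
Proof.
rewrite /truncation => fK; have /andP[fK1 fK2] : - K <= f x <= K by rewrite -ler_norml.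
have [g0|g0|g0] := ltgtP (g x) 0.
- rewrite ltr0_sg// (ltr0_norm g0) mulN1r.
  have [Kg|Kg] := leP K (- g x).
    rewrite opprK ger0_norm; last lra.
    by split; [apply: le_trans _ (ler_norm _); lra|lra].
  rewrite opprK; split => //; rewrite ler_norml; apply/andP; split; lra.
- rewrite gtr0_sg// (gtr0_norm g0) mul1r.
  have [Kg|Kg] := leP K (g x).
    rewrite ler0_norm; last lra.
    by split; [rewrite -normrN; apply: le_trans _ (ler_norm _); lra|lra].
  split => //; rewrite ler_norml; apply/andP; split; lra.
- rewrite g0 sgr0 mul0r; split => //.
  by rewrite subr0 (le_trans fK)//; lra.
Qed.

End Numeric.

Section TailEvent.
Context {R : realType}.

(** The Rayleigh quotient of H at the normalized u is at least 1 - s kappa; Jensen raises it to the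
    power 2 q, which the trace dominates. Strictness of the hypothesis makes u nonzero. *)
Lemma trace_ge_of_small_direction M (H G : 'M[R]_M) (s kappa : R) q u :
  0 <= s -> 0 <= 1 - s * kappa -> psd H ->
  (forall u, bform H u u = bform 1 u u - s * bform G u u) ->
  bform G u u < kappa * bform 1 u u ->
  (1 - s * kappa) ^+ q.*2 <= \tr (H ^+ q.*2).
Proof.
move=> s0 sk psdH HG Gu; set a := bform 1 u u.
have a0 : 0 <= a by exact: (psd1 R M).2.
have a_gt0 : 0 < a.
  rewrite lt_neqAle a0 andbT eq_sym; apply/eqP => aE.
  have u0 : u = 0 by apply: (@moment0_eq0 _ _ 1); rewrite /moment expr0.
  by move: Gu; rewrite -/a aE mulr0 u0 /bform mulmx0 mxE ltxx.
pose t := (Num.sqrt a)^-1; pose v := t *: u.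
have tt : t * t = a^-1 by rewrite /t -invfM -expr2 sqr_sqrtr.
have v1 : bform 1 v v = 1 by rewrite /v bformZl bformZr mulrA tt mulVf// lt0r_neq0.
have m0 : moment H v 0 = 1 by rewrite /moment expr0.
have m1 : 1 - s * kappa <= moment H v 1.
  rewrite /moment expr1 HG v1 lerB// ler_wpM2l// /v bformZl bformZr mulrA tt.
  by rewrite mulrC ler_pdivrMr// ltW.
apply: le_trans (moment_double_le_mxtrace q psdH.1 m0).
by apply: le_trans (moment_geX q.*2 psdH m0); rewrite lerXn2r ?nnegrE// (le_trans sk).
Qed.

Lemma bform_Gmx alpha d n M (Psi : 'I_M -> d.-tuple R -> R) (Z : 'I_n -> d.-tuple R) u :
  bform (Gmx alpha Psi Z) u u = \sum_i bform 1
    (\col_j (h0 alpha `^ (d%:R / 2) / Num.sqrt n%:R * Psi j (Z i))) u ^+ 2.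
Proof.
rewrite /bform /Gmx !mulmxA -trmx_mul -mulmxA mxE; apply: eq_bigr => i _.
rewrite mxE -expr2; congr (_ ^+ 2); rewrite mulmx1 !mxE.
by apply: eq_bigr => j _; rewrite !mxE.
Qed.

End TailEvent.

Section RiskBound.
Context {R : realType} (d N n m : nat).
Hypotheses (N_gt0 : (0 < N)%N) (n_gt0 : (0 < n)%N) (m_gt0 : (0 < m)%N) (mN : (m <= N)%N).
Variables (alpha delta : R).
Hypotheses (al : - 2^-1 <= alpha) (delta_gt0 : 0 < delta) (delta_lt1 : delta < 1).
Variable e : 'I_#|basis_index N m d| -> mindex d N.
Hypothesis e_enum : enumerates e.
Variables (f : d.-tuple R -> R) (Kf : R).
Hypothesis f_meas : measurable_fun (@cube R d) f.
Hypothesis f_bound : forall x, @cube R d x -> `|f x| <= Kf.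
Context (dO : measure_display) (Omega : measurableType dO) (P : probability Omega R).
Variables (X : 'I_n -> {RV P >-> d.-tuple R}) (eps : 'I_n -> {RV P >-> R}) (sigma : R).
Hypothesis X_indep : mutually_independent P (fun i w => X i w).
Hypothesis X_density : forall i (A : set (d.-tuple R)), measurable A ->
    distribution P (X i) A =
    (\int[leb d]_(x in A `&` @cube R d)
       ((h0 alpha ^+ d)^-1 * weight alpha x)%:E)%E.
Hypothesis eps_indep : mutually_independent P (fun i w => eps i w).
Hypothesis eps_centered : forall i, ('E_P[eps i] = 0)%E.
Hypothesis eps_variance : forall i, ('V_P[eps i] = (sigma ^+ 2)%:E)%E.
Hypothesis X_eps_indep : independent_pair P
     (joint (fun i w => X i w)) (joint (fun i w => eps i w)).

Local Notation cube := (@cube R d).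
Local Notation Mcard := #|basis_index N m d|.
Let Psi j := Phi alpha (e j) : d.-tuple R -> R.
Let M : R := (Mdim N m d)%:R.
Let D2m : R := Dconst N alpha ^+ (2 * m).
Let hd : R := h0 alpha ^+ d.
Let sc : R := h0 alpha `^ (d%:R / 2) / Num.sqrt n%:R.
Let pf := Proj alpha N m f.
Let errR : R := cint alpha (fun x => (f x - pf x) ^+ 2).

Let n0 : 0 < n%:R :> R. Proof. by rewrite ltr0n. Qed.

Let hd0 : 0 < hd. Proof. by rewrite exprn_gt0// h0_gt0. Qed.

Let sc2 : sc ^+ 2 = hd / n%:R.
Proof.
rewrite /sc exprMn exprVn sqr_sqrtr//; congr (_ / _).
by rewrite -powR_mulrn ?powR_ge0// -powRrM divfK// powR_mulrn// ltW// h0_gt0.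
Qed.

Let bf : cube_bounded f. Proof. by split; [|exists Kf]. Qed.

Let bPsi j : cube_bounded (Psi j).
Proof. by apply: (@Phi_bounded _ _ _ m) => //; exact: enumerates_in. Qed.

Let Mcard_le : Mcard%:R <= M.
Proof. by rewrite ler_nat card_basis_index_le. Qed.

Let M_ge0 : 0 <= M. Proof. exact: ler0n. Qed.

Let D2m_ge0 : 0 <= D2m. Proof. by rewrite /D2m exprM exprn_ge0// sqr_ge0. Qed.

Let bpf : cube_bounded pf.
Proof.
have [c [E _]] := Proj_enumerates al e_enum bf; rewrite /pf E.
by apply: cube_bounded_sum => j; exact: (cube_boundedZ _ (bPsi j)).
Qed.

(** Extension by zero gives bounded measurable functions on the whole space, where the design
    variables take their values. *)
Let cut (g : d.-tuple R -> R) := g \_ cube.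

Let bcut g : cube_bounded g -> bounded_measurable (cut g).
Proof.
move=> [mg [K gK]]; split.
  exact: (measurable_restrictT _ (@measurable_cube R d)).1.
exists (`|K|) => x; rewrite /cut patchE; case: ifPn => [|_]; last by rewrite normr0.
by rewrite inE => /gK /le_trans; apply; exact: ler_norm.
Qed.

Let eq_cint g h : (forall x, cube x -> g x = h x) -> cint alpha g = cint alpha h.
Proof.
by move=> gh; apply: eq_Rintegral => x; rewrite inE => /gh ->.
Qed.

Let cutE g x : cube x -> cut g x = g x.
Proof. by move=> xc; rewrite /cut patchE mem_set. Qed.

Let mean_cut g i : bounded_measurable g ->
  mean P (fun w => g (X i w)) = hd^-1 * cint alpha g.
Proof. by move=> bg; exact: (mean_design al (X_density i) bg). Qed.

(** Per observation, [q j] multiplies the noise and [p j] carries f - Pi f in the j-th entry of G (C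
    - c). *)
Let q j x := sc ^+ 2 * cut (Psi j) x.
Let p j x := q j x * cut (fun x => f x - pf x) x.
Let bq j : bounded_measurable (q j).
Proof. by apply: bmZ; exact: bcut. Qed.

Let bp j : bounded_measurable (p j).
Proof. by apply: bmM => //; apply: bcut; exact: cube_boundedB. Qed.

Let orth j : cint alpha (fun x => (f x - pf x) * Psi j x) = 0.
Proof. by have [c [_]] := Proj_enumerates al e_enum bf; exact. Qed.

Let errR_ge0 : 0 <= errR.
Proof.
have b0 : cube_bounded (cst 0 : d.-tuple R -> R) by exact: cube_bounded_cst.
have <- : cint alpha (cst 0 : d.-tuple R -> R) = 0.
  rewrite -[RHS](mul0r (cint alpha (cst 0 : d.-tuple R -> R))) -(cintZ al 0 b0).
  by apply: eq_cint => x _; rewrite mul0r.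
apply: (le_cint al) => //; first by apply: cube_boundedX; exact: cube_boundedB.
by move=> x _; exact: sqr_ge0.
Qed.

(** [p j] is centred because f - Pi f is orthogonal to Psi_j. The noise contributes hd sigma^2 / n
    by the normalization of Psi_j, and the approximation error is weighted by Psi_j^2, at most
    D^(2m) / hd. *)
Let noise j : exists2 v, has_mean P (fun w => (\sum_i (p j (X i w) + q j (X i w) * eps i w)) ^+ 2) v &
  v <= n%:R^-1 * (D2m * errR + sigma ^+ 2 * hd).
Proof.
have mX i : measurable_fun setT (fun w => X i w) by [].
have meps i : measurable_fun setT (fun w => eps i w) by [].
have e12 i := has_mean_eps (meps i) (eps_centered i) (eps_variance i).
have bpp : bounded_measurable (fun x => p j x * p j x) by exact: bmM.
have bqq : bounded_measurable (fun x => q j x * q j x) by exact: bmM.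
have p1 i : mean P (p j \o X i) = 0.
  rewrite (mean_cut i (bp j)).
  have -> : cint alpha (p j) = cint alpha (fun x => sc ^+ 2 * ((f x - pf x) * Psi j x)).
    by apply: eq_cint => x xc; rewrite /p /q !cutE//; ring.
  rewrite (cintZ al) ?orth ?mulr0//.
  by apply: cube_boundedM => //; exact: cube_boundedB.
have [h1 h2] := second_moment mX meps X_indep eps_indep X_eps_indep
  (fun i => (e12 i).1) (fun i => (e12 i).2) (bp j) (bq j) p1
  (fun i => mean_cut i bpp) (fun i => mean_cut i bqq).
exists (n%:R * (hd^-1 * cint alpha (fun x => p j x * p j x) +
  hd^-1 * cint alpha (fun x => q j x * q j x) * sigma ^+ 2)) => //.
have bg : cube_bounded (fun x => f x - pf x) by exact: cube_boundedB.
have qqE : cint alpha (fun x => q j x * q j x) = (hd / n%:R) ^+ 2.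
  have -> : cint alpha (fun x => q j x * q j x) =
      cint alpha (fun x => (sc ^+ 2) ^+ 2 * (Psi j x * Psi j x)).
    by apply: eq_cint => x xc; rewrite /q !cutE//; ring.
  rewrite (cintZ al); last exact: cube_boundedM.
  by rewrite (cint_enumerates al e_enum) eqxx mulr1 sc2.
have ppE : cint alpha (fun x => p j x * p j x) <= (hd / n%:R) ^+ 2 * (D2m / hd * errR).
  have -> : cint alpha (fun x => p j x * p j x) =
      cint alpha (fun x => (hd / n%:R) ^+ 2 * (Psi j x ^+ 2 * (f x - pf x) ^+ 2)).
    by apply: eq_cint => x xc; rewrite /p /q !cutE// sc2; ring.
  have bb : cube_bounded (fun x => Psi j x ^+ 2 * (f x - pf x) ^+ 2).
    by apply: cube_boundedM; exact: cube_boundedX.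
  rewrite (cintZ al)//; apply: ler_wpM2l; first exact: sqr_ge0.
  rewrite -(cintZ al); last exact: cube_boundedX.
  apply: (le_cint al) => //; first by apply: cube_boundedZ; exact: cube_boundedX.
  move=> x xc; rewrite ler_wpM2r ?sqr_ge0// ler_pdivlMr// mulrC.
  apply: le_trans (Phi_sup N_gt0 m_gt0 al (enumerates_in e_enum j) xc) _.
  by move: D2m_ge0; rewrite /D2m; lra.
rewrite qqE.
have := ler_wpM2l (_ : 0 <= n%:R * hd^-1) ppE; rewrite mulr_ge0 ?invr_ge0 ?(ltW hd0)// => /(_ isT) h.
have -> : n%:R^-1 * (D2m * errR + sigma ^+ 2 * hd) =
  n%:R * hd^-1 * ((hd / n%:R) ^+ 2 * (D2m / hd * errR)) + n%:R * (hd^-1 * (hd / n%:R) ^+ 2 * sigma ^+ 2).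
  by field; rewrite !lt0r_neq0.
by rewrite mulrDr mulrA lerD2r.
Qed.

Let M_gt0 : 0 < M.
Proof. by rewrite ltr0n /Mdim big_ord_recl !bin0. Qed.

Let D2m_gt0 : 0 < D2m.
Proof.
by rewrite /D2m exprM exprn_gt0// (lt_le_trans _ (Dconst_sqr_ge4 N_gt0 al)).
Qed.

(** Bounds |V|^2; the 2 in the denominator comes from [Phi_sup]. *)
Let ell := M * D2m / (2 * n%:R).

Let V x : 'cV[R]_Mcard := \col_j (sc * cut (Psi j) x).

Let bV : mx_bounded_measurable V.
Proof.
move=> i j; under eq_fun do rewrite mxE.
by apply: bmZ; exact: bcut.
Qed.

Let V_le x : \sum_i V x i 0 ^+ 2 <= ell.
Proof.
apply: le_trans (_ : \sum_(i < Mcard) D2m / (2 * n%:R) <= _); last first.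
  rewrite sumr_const card_ord -[leLHS]mulr_natl /ell -mulrA ler_wpM2r//.
  by rewrite divr_ge0// mulr_ge0.
apply: ler_sum => i _; rewrite mxE exprMn sc2.
have [xc|xc] := pselect (cube x); last first.
  rewrite /cut patchE memNset// expr0n/= mulr0.
  by rewrite divr_ge0// mulr_ge0.
rewrite cutE//.
have h := Phi_sup N_gt0 m_gt0 al (enumerates_in e_enum i) xc.
have -> : hd / n%:R * Psi i x ^+ 2 = n%:R^-1 * (hd * Psi i x ^+ 2) by ring.
have -> : D2m / (2 * n%:R) = n%:R^-1 * (D2m / 2) by field; rewrite lt0r_neq0.
by rewrite ler_wpM2l ?invr_ge0.
Qed.

Let V_mean k i j : mean P (fun w => V (X k w) i 0 * V (X k w) j 0) = (i == j)%:R / n%:R.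
Proof.
have bg : bounded_measurable (fun x => V x i 0 * V x j 0) by apply: bmM; exact: bV.
rewrite (mean_cut k bg).
have -> : cint alpha (fun x => V x i 0 * V x j 0) =
    cint alpha (fun x => sc ^+ 2 * (Psi i x * Psi j x)).
  by apply: eq_cint => x xc; rewrite !mxE !cutE//; ring.
rewrite (cintZ al); last exact: cube_boundedM.
rewrite (cint_enumerates al e_enum) sc2.
by field; rewrite !lt0r_neq0.
Qed.

(** T is the trace of H_n^k2 divided by (1 - x)^k2: Markov's inequality in pointwise form, T
    dominating the indicator of the bad event within the cube. *)
Let tail : exists T : Omega -> R, [/\ bounded_measurable T, forall w, 0 <= T w,
  mean P T <= M * expR (- (delta ^+ 2 * n%:R / (2 * D2m * M))) &
  forall w u, (forall i, cube (X i w)) ->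
    bform (Gmx alpha Psi (fun i => X i w)) u u < (1 - delta) * bform 1 u u -> 1 <= T w].
Proof.
pose L := M * D2m / n%:R.
have L0 : 0 < L by rewrite divr_gt0// mulr_gt0.
have L16 : 0 <= 16 / L by rewrite divr_ge0// ltW.
have dL : 0 <= delta / L by rewrite divr_ge0 ?ltW.
(* The summand 4 n makes s n ell = delta n / (2 k2) at most 1/8, hence c >= 7/8; the other two are
   the conditions on the power in [chernoff_numeric]. *)
have /archi_boundP/ltW : 0 <= 4 * n%:R + 16 / L + 2 * (delta / L) by rewrite addr_ge0 ?addr_ge0 ?L16// mulr_ge0.
move: (Num.bound _) => k kB.
(* Even for [moment_double_le_mxtrace], and of the form p + 2 for [mean_mxtrace_le]. *)
set k2 := k.*2.+2.
have kk : k%:R <= k2%:R :> R by rewrite ler_nat /k2 -addnn 2?leqW// leq_addr.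
have k2_gt0 : 0 < k2%:R :> R by rewrite ltr0n.
pose s := delta / L / k2%:R.
have s0 : 0 <= s by rewrite !mulr_ge0 ?invr_ge0 ?ltW.
have snE : s * (n%:R * ell) = delta * n%:R / (2 * k2%:R).
  by rewrite /s /L /ell; field; rewrite !lt0r_neq0.
have sn8 : s * (n%:R * ell) <= 8^-1.
  rewrite snE ler_pdivrMr ?mulr_gt0//.
  have h : delta * n%:R <= n%:R by rewrite ler_piMl// ltW.
  lra.
have n0' := n0; have L16' := L16; have dL' := dL.
have c78 : 7 / 8 <= 1 - s * (n%:R * ell) by lra.
have k16 : 16 / L <= k2%:R by lra.
have kd : 2 * (delta / L) <= k2%:R by lra.
have [/andP[x0 x2] ch] := chernoff_numeric delta_gt0 delta_lt1 L0 c78 (ltn0Sn _ : (0 < k2)%N) k16 kd (erefl s).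
set x := s * (1 - delta) in x0 x2 ch.
have x1 : 0 < (1 - x) ^+ k2 by apply: exprn_gt0; lra.
have s_lt : s * (n%:R * ell) < 1 by lra.
pose H w := resid V s (fun i => X i w) n.
have mX i : measurable_fun setT (fun w => X i w) by [].
have bH : mx_bounded_measurable H by exact: mxbm_resid.
have psdH w : psd (H w) by exact: (psd_resid V_le).
have btr : bounded_measurable (fun w => \tr (H w ^+ k2)).
  by apply: bm_mxtrace; exact: mxbmX.
exists (fun w => ((1 - x) ^+ k2)^-1 * \tr (H w ^+ k2)); split.
- exact: bmZ.
- by move=> w; rewrite mulr_ge0 ?invr_ge0 ?(ltW x1)// mxtrace_expr_ge0.
- rewrite meanZ//.
  have h := mean_mxtrace_le n_gt0 mX X_indep bV V_le V_mean s0 s_lt k.*2.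
  rewrite -/k2 in h.
  rewrite mulrC; apply: le_trans (ler_wpM2r _ h) _; first by rewrite invr_ge0 ltW.
  have -> : delta ^+ 2 * n%:R / (2 * D2m * M) = delta ^+ 2 / (2 * L).
    by rewrite /L; field; rewrite !lt0r_neq0.
  apply: le_trans (ler_pM _ _ Mcard_le ch) => //; last first.
    by rewrite divr_ge0 ?expR_ge0// ltW.
  have -> : L / 2 = ell by rewrite /L /ell; field; rewrite !lt0r_neq0.
  by rewrite [leRHS]mulrA lexx.
- move=> w u wc Gu; rewrite mulrC ler_pdivlMr// mul1r.
  apply: (@trace_ge_of_small_direction _ _ _ (Gmx alpha Psi (fun i => X i w)) s (1 - delta) k.+1 u) => //.
    by rewrite -/x; lra.
  move=> v; rewrite /H bform_resid bform_Gmx; congr (_ - _ * _).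
  rewrite (eq_bigl xpredT); last by move=> i; exact: ltn_ord.
  apply: eq_bigr => i _; congr (bform _ _ _ ^+ _).
  by apply/colP => j; rewrite !mxE cutE.
Qed.

Let Kf_ge0 : 0 <= Kf.
Proof.
have t0 : cube [tuple 0 | i < d].
  by move=> i; rewrite tnth_mktuple /= in_itv/= lerN10 ler01.
exact: le_trans (f_bound t0).
Qed.

(** Design points outside the cube have probability zero; adding this indicator to the majorant
    makes it valid at every outcome without changing its mean. *)
Let off (x : d.-tuple R) : R := \1_(~` cube) x.

Let bm_off : bounded_measurable off.
Proof.
split; first by apply: measurable_indic; apply: measurableC; exact: measurable_cube.
by exists 1 => x; rewrite /off indicE; case: (_ \in _); rewrite ?normr1 ?normr0.
Qed.

Let mean_off i : mean P (fun w => off (X i w)) = 0.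
Proof.
rewrite (mean_cut i bm_off) (eq_cint (h := fun x => 0 * 1)); last first.
  by move=> x xc; rewrite mul0r /off indicE memNset//= => /(_ xc).
by rewrite (cintZ al) ?mul0r ?mulr0//; exact: cube_bounded_cst.
Qed.

Let cint_cst c : cint alpha (cst c : d.-tuple R -> R) = c * hd.
Proof.
apply/EFin_inj; rewrite -(cintE al); last exact: cube_bounded_cst.
under eq_integral do rewrite EFinM.
rewrite integralZl; [|exact: measurable_cube|exact: integrable_cube_weight].
by rewrite integral_cube_weight.
Qed.

Let Fhat w := truncation Kf
  (fhat alpha Psi (fun i => X i w) (fun i => f (X i w) + eps i w)).

Let normsq_le g h : cube_bounded h ->
  (forall x, cube x -> g x ^+ 2 <= h x) -> (normsq alpha g <= (cint alpha h)%:E)%E.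
Proof.
move=> bh gh; rewrite -(cintE al bh); apply: ge0_le_lower_integral => x xc.
  by rewrite lee_fin mulr_ge0 ?sqr_ge0 ?weight_ge0.
by rewrite lee_fin ler_wpM2r ?weight_ge0 ?gh.
Qed.

Let normsq_crude w : (normsq alpha (f \- Fhat w)%R <= (4 * Kf ^+ 2 * hd)%:E)%E.
Proof.
rewrite -cint_cst; apply: normsq_le; first exact: cube_bounded_cst.
move=> x xc; rewrite /= -[leLHS]real_normK ?num_real//.
have [_ h] := truncation_dist (fhat alpha Psi (fun i => X i w) (fun i => f (X i w) + eps i w)) (f_bound xc).
rewrite (_ : 4 * Kf ^+ 2 = (2 * Kf) ^+ 2); last ring.
by rewrite lerXn2r ?nnegrE// mulr_ge0.
Qed.

Let zeta j w := \sum_i (p j (X i w) + q j (X i w) * eps i w).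

Let normsq_good w : (forall i, cube (X i w)) ->
  (forall u, (1 - delta) * bform 1 u u <= bform (Gmx alpha Psi (fun i => X i w)) u u) ->
  (normsq alpha (f \- Fhat w)%R <=
   (errR + (1 - delta) ^- 2 * \sum_j zeta j w ^+ 2)%:E)%E.
Proof.
move=> wc Gw; have k0 : 0 < 1 - delta by rewrite subr_gt0.
have [c [E fp]] := Proj_enumerates al e_enum bf.
set C := Chat alpha Psi (fun i => X i w) (fun i => f (X i w) + eps i w).
have bh : cube_bounded (fun x => f x - \sum_j C j 0 * Psi j x).
  apply: cube_boundedB => //; apply: cube_bounded_sum => j.
  exact: (cube_boundedZ _ (bPsi j)).
apply: le_trans (normsq_le (cube_boundedX 2 bh) _) _.
  move=> x xc; rewrite -[leLHS]real_normK ?num_real// -[leRHS]real_normK ?num_real//.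
  rewrite lerXn2r ?nnegrE//.
  by have [] := truncation_dist (fhat alpha Psi (fun i => X i w) (fun i => f (X i w) + eps i w)) (f_bound xc).
have fp' j : cint alpha (fun x => (f x - \sum_j c j * Psi j x) * Psi j x) = 0.
  by have := fp j; rewrite E.
rewrite lee_fin (cint_pythagoras al bPsi (cint_enumerates al e_enum) bf fp' (fun j => C j 0)).
have -> : cint alpha (fun x => (f x - \sum_j c j * Psi j x) ^+ 2) = errR by rewrite /errR /pf E.
rewrite lerD2l mulrC.
apply: le_trans (Chat_error f (fun i => eps i w) c k0 Gw) _.
rewrite -/sc le_eqVlt; apply/orP; left; apply/eqP; congr (_ / _); apply: eq_bigr => j _; congr (_ ^+ 2).
rewrite mulr_sumr /zeta; apply: eq_bigr => i _.
by rewrite /p /q !cutE// /pf E; ring.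
Qed.

(** U dominates the loss at every outcome, so monotonicity of the integral suffices. If a design
    point leaves the cube or the Gram matrix is not coercive, the factor of K4 is at least 1 and the
    crude bound applies; otherwise [normsq_good] does. *)
Let risk : (\int[P]_w normsq alpha (f \- Fhat w)%R <=
  (4 * Kf ^+ 2 * hd * M * expR (- (delta ^+ 2 * n%:R / (2 * D2m * M))) +
   M / (n%:R * (1 - delta) ^+ 2) * (D2m * errR + sigma ^+ 2 * hd) + errR)%:E)%E.
Proof.
have [T [bT T0 mT T1]] := tail.
set K4 := 4 * Kf ^+ 2 * hd; have K40 : 0 <= K4 by apply: mulr_ge0; [rewrite mulr_ge0 ?sqr_ge0|exact: ltW].
pose B w := errR + K4 * (T w + \sum_i off (X i w)).
pose U w := B w + (1 - delta) ^- 2 * \sum_j zeta j w ^+ 2.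
have boff i : bounded_measurable (fun w => off (X i w)) by exact: (bm_comp _ bm_off).
have bsoff : bounded_measurable (fun w => \sum_i off (X i w)) by exact: bm_sum.
have bB : bounded_measurable B.
  by apply: bmD; [exact: bm_cst|apply: bmZ; exact: bmD].
have off0 x : 0 <= off x by rewrite /off indicE ler0n.
have soff0 w : 0 <= \sum_i off (X i w) by rewrite sumr_ge0.
have z0 w : 0 <= (1 - delta) ^- 2 * \sum_j zeta j w ^+ 2.
  by rewrite mulr_ge0 ?invr_ge0 ?sqr_ge0// sumr_ge0// => j _; exact: sqr_ge0.
have crude w : 1 <= T w + \sum_i off (X i w) -> (normsq alpha (f \- Fhat w)%R <= (U w)%:E)%E.
  move=> h; apply: le_trans (normsq_crude w) _; rewrite lee_fin /U /B -/K4.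
  by have := ler_wpM2l K40 h; have := z0 w; have := errR_ge0; lra.
have pw w : (normsq alpha (f \- Fhat w)%R <= (U w)%:E)%E.
  have [wc|] := pselect (forall i, cube (X i w)); last first.
    move=> /existsNP[i wi]; apply: crude; rewrite (bigD1 i)//=.
    have -> : off (X i w) = 1 by rewrite /off indicE mem_set.
    have h : 0 <= \sum_(j < n | j != i) off (X j w) by exact: sumr_ge0.
    by have := T0 w; lra.
  have [[u Gu]|noG] := pselect (exists u, bform (Gmx alpha Psi (fun i => X i w)) u u < (1 - delta) * bform 1 u u).
    by apply: crude; have := T1 w u wc Gu; have := soff0 w; lra.
  apply: le_trans (normsq_good wc _) _.
    by move=> u; rewrite leNgt; apply/negP => Gu; apply: noG; exists u.
  rewrite lee_fin /U /B lerD2r lerDl mulr_ge0// addr_ge0//.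
have hz j : has_mean P (fun w => zeta j w ^+ 2) (mean P (fun w => zeta j w ^+ 2)) /\
    mean P (fun w => zeta j w ^+ 2) <= n%:R^-1 * (D2m * errR + sigma ^+ 2 * hd).
  have [v vh vle] := noise j.
  have <- : v = mean P (fun w => zeta j w ^+ 2) by rewrite /mean /Rintegral vh.2.
  by [].
have hU := has_meanD (has_mean_bm P bB)
  (has_meanZ ((1 - delta) ^- 2) (has_mean_sum (index_enum 'I_Mcard) (fun j => (hz j).1))).
apply: le_trans (_ : (\int[P]_w (U w)%:E <= _)%E).
  apply: ge0_le_lower_integral => w _ //.
  by apply: integral_ge0 => x _; rewrite lee_fin mulr_ge0 ?sqr_ge0 ?weight_ge0.
rewrite hU.2 lee_fin.
have -> : mean P B = errR + K4 * mean P T.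
  rewrite meanD; [|exact: bm_cst|apply: bmZ; exact: bmD].
  rewrite mean_cst meanZ; last exact: bmD.
  by rewrite meanD// mean_sum// big1 ?addr0// => i _; exact: mean_off.
have h1 := ler_wpM2l K40 mT.
have h2 : \sum_(j < Mcard) mean P (fun w => zeta j w ^+ 2) <=
    M * (n%:R^-1 * (D2m * errR + sigma ^+ 2 * hd)).
  apply: le_trans (_ : \sum_(j < Mcard) n%:R^-1 * (D2m * errR + sigma ^+ 2 * hd) <= _).
    by apply: ler_sum => j _; exact: (hz j).2.
  rewrite sumr_const card_ord -[leLHS]mulr_natl ler_wpM2r//.
  apply: mulr_ge0; first by rewrite invr_ge0.
  by apply: addr_ge0; apply: mulr_ge0 => //; [exact: sqr_ge0|exact: ltW].
have k2 : 0 <= (1 - delta) ^- 2 by rewrite invr_ge0 sqr_ge0.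
have h3 := ler_wpM2l k2 h2.
have -> : M / (n%:R * (1 - delta) ^+ 2) * (D2m * errR + sigma ^+ 2 * hd) =
    (1 - delta) ^- 2 * (M * (n%:R^-1 * (D2m * errR + sigma ^+ 2 * hd))).
  by rewrite invfM; ring.
rewrite -[K4 * M * _]mulrA; lra.
Qed.

Lemma truncated_estimator_risk :
  (\int[P]_w normsq alpha (f \- truncation Kf (fhat alpha Psi (fun i => X i w)
       (fun i => f (X i w) + eps i w)))%R <=
     (4 * Kf ^+ 2 * hd * M * expR (- (delta ^+ 2 * n%:R / (2 * D2m * M))))%:E
     + (M / (n%:R * (1 - delta) ^+ 2))%:E *
         (D2m%:E * normsq alpha (f \- pf)%R + (sigma ^+ 2 * hd)%:E)
     + normsq alpha (f \- pf)%R)%E.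
Proof.
have -> : normsq alpha (f \- pf)%R = errR%:E.
  by rewrite -(cintE al)//; apply: cube_boundedX; exact: cube_boundedB.
exact: risk.
Qed.

End RiskBound.

Theorem theorem2 (R : realType) (d N n m : nat)
  (d_ge1 : (1 <= d)%N) (N_ge1 : (1 <= N)%N) (n_ge1 : (1 <= n)%N)
  (m_ge1 : (1 <= m)%N) (m_le : (m <= minn d N)%N)
  (alpha delta : R) (alpha_ge : - 2^-1 <= alpha)
  (delta_gt0 : 0 < delta) (delta_lt1 : delta < 1)
  (e : 'I_#|basis_index N m d| -> mindex d N)
  (e_enum : enumerates e)
  (f : d.-tuple R -> R) (Kf : R)
  (f_meas : measurable_fun (@cube R d) f)
  (f_bound : forall x, @cube R d x -> `|f x| <= Kf)
  (dO : measure_display) (Omega : measurableType dO) (P : probability Omega R)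
  (X : 'I_n -> {RV P >-> d.-tuple R})
  (eps : 'I_n -> {RV P >-> R}) (Y : 'I_n -> {RV P >-> R})
  (sigma : R)
  (Y_def : forall i w, Y i w = f (X i w) + eps i w)
  (X_indep : mutually_independent P (fun i w => X i w))
  (X_density : forall i (A : set (d.-tuple R)), measurable A ->
    distribution P (X i) A =
    (\int[leb d]_(x in A `&` @cube R d)
       ((h0 alpha ^+ d)^-1 * weight alpha x)%:E)%E)
  (eps_indep : mutually_independent P (fun i w => eps i w))
  (eps_ident : forall i j (A : set R), measurable A ->
    distribution P (eps i) A = distribution P (eps j) A)
  (eps_centered : forall i, ('E_P[eps i] = 0)%E)
  (eps_variance : forall i, ('V_P[eps i] = (sigma ^+ 2)%:E)%E)
  (X_eps_indep : independent_pair P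
     (joint (fun i w => X i w)) (joint (fun i w => eps i w))) :
  let Psi j := Phi alpha (e j) in
  let Fhat w :=
    truncation Kf (fhat alpha Psi (fun i => X i w) (fun i => Y i w)) in
  let M : R := (Mdim N m d)%:R in
  let D2m : R := Dconst N alpha ^+ (2 * m) in
  let err := normsq alpha (f \- Proj alpha N m f) in
  (\int[P]_w normsq alpha (f \- Fhat w)%R <=
     (4 * Kf ^+ 2 * h0 alpha ^+ d * M *
        expR (- (delta ^+ 2 * n%:R / (2 * D2m * M))))%:E
     + (M / (n%:R * (1 - delta) ^+ 2))%:E *
         (D2m%:E * err + (sigma ^+ 2 * h0 alpha ^+ d)%:E)
     + err)%E.
Proof.
have mN : (m <= N)%N by rewrite (leq_trans m_le)// geq_minr.
have YE w : (fun i => Y i w) = (fun i => f (X i w) + eps i w).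
  by apply/funext => i; exact: Y_def.
cbv zeta; under eq_integral do rewrite YE.
exact: truncated_estimator_risk.
Qed.
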